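(* The third blocked LRFC ensemble on $n$ qubits with patch size $\xi$ forms an approximate unitary $k$-design with measurable error $\mathcal{O}(nk^2/2^\xi)$.
   Context: It is implicitly assumed that $n/\xi$ is an integer. LRFC ensemble on $N$ qubits ($N$ even): $U=S_LS_RFC$, where $S_L|x_L\|x_R\rangle=|x_L\oplus h_L(x_R)\|x_R\rangle$ and $S_R|x_L\|x_R\rangle=|x_L\|x_R\oplus h_R(x_L)\rangle$ for uniformly random functions $h_L,h_R:\{0,1\}^{N/2}\to\{0,1\}^{N/2}$ ($x_L,x_R$ the left and right halves of $x$), $F|x\rangle=(-1)^{f(x)}|x\rangle$ with $f:\{0,1\}^N\to\{0,1\}$ uniformly random, and $C$ a uniformly random $N$-qubit Clifford, all independent. Third blocked LRFC ensemble: divide $n$ qubits into consecutive patches of $\xi$ qubits; $U=(\mathrm{LRFC})_e(\mathrm{LRFC})_o$, where $(\mathrm{LRFC})_o$ (resp. $(\mathrm{LRFC})_e$) is a tensor product of independent LRFC unitaries on $2\xi$ qubits acting on each odd (resp. even) pair of consecutive patches $(a,a+1)$. Measurable error: a $k$-query experiment prepares $W_{k+1}(U\otimes 1_m)W_k\cdots(U\otimes 1_m)W_1|0^{n+m}\rangle$ for arbitrary unitaries $W_i$; an ensemble has measurable error $\varepsilon$ if for every such experiment the expected outputs for $U$ from the ensemble and $U$ Haar-random on $U(2^n)$ are within trace-norm distance $\varepsilon$. *)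

(* Defs.v *)
From HB Require Import structures.
From mathcomp Require Import all_boot all_order all_algebra.
From mathcomp Require Import all_classical all_reals.
From mathcomp Require Import measure lebesgue_measure lebesgue_integral probability.
From mathcomp Require Import complex.

Set Implicit Arguments.
Unset Strict Implicit.
Unset Printing Implicit Defensive.

Import Order.TTheory GRing.Theory Num.Theory.
Local Open Scope classical_set_scope.
Local Open Scope ring_scope.

Definition cmx (R : realType) (d : nat) := 'M[R[i]]_d.
HB.instance Definition _ (R : realType) d := Choice.on (cmx R d).
HB.instance Definition _ (R : realType) d := isPointed.Build (cmx R d) 0.

Section QuantumDefs.
Variable R : realType.
Local Notation C := (R[i]).

(* computational basis of N qubits: bit strings x = x_0 ... x_{N-1} *)
Definition bits (N : nat) := {ffun 'I_N -> bool}.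

(* operators on the Hilbert space with orthonormal basis T *)
Definition op (T : finType) := 'M[C]_#|T|.

Definition ent (T : finType) (A : op T) (y x : T) : C :=
  A (enum_rank y) (enum_rank x).

Definition mkop (T : finType) (f : T -> T -> C) : op T :=
  \matrix_(i, j) f (enum_val i) (enum_val j).

Definition adjm (m n : nat) (A : 'M[C]_(m, n)) : 'M[C]_(n, m) :=
  (map_mx (@conjc R) A)^T.

Definition unitary (d : nat) (A : 'M[C]_d) : Prop := adjm A *m A = 1%:M.

Definition permop (T : finType) (s : T -> T) : op T :=
  mkop (fun y x => (y == s x)%:R).

Definition phaseop (T : finType) (f : T -> bool) : op T :=
  mkop (fun y x => (y == x)%:R * (-1) ^+ f x).

(* single-qubit Paulis I, X, Y, Z (indices 0,1,2,3); entry <a|P|b> *)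
Definition pauli1 (p : 'I_4) (a b : bool) : C :=
  match val p with
  | 0 => (a == b)%:R
  | 1 => (a != b)%:R
  | 2 => if a != b then (if b then Complex 0 (-1) else Complex 0 1) else 0
  | _ => if a == b then (-1) ^+ a else 0
  end.

Definition pauli (N : nat) (p : {ffun 'I_N -> 'I_4}) : op (bits N) :=
  mkop (fun y x : bits N => \prod_(q : 'I_N) pauli1 (p q) (y q) (x q)).

Definition is_clifford (N : nat) (M : op (bits N)) : Prop :=
  unitary M /\
  forall p : {ffun 'I_N -> 'I_4}, exists (s : bool) (p' : {ffun 'I_N -> 'I_4}),
    M *m pauli p *m adjm M = (-1) ^+ s *: pauli p'.

(* canonical representative of a Clifford modulo global phase: its first
   nonzero entry (in column-major order) is a positive real *)
Definition phase_normalized (d : nat) (M : 'M[C]_d) : Prop :=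
  exists i j : 'I_d, 0 < M i j /\
    forall i' j' : 'I_d, ((j' < j)%N || ((j' == j) && (i' < i)%N)) -> M i' j' = 0.

Definition clifford_rep (N : nat) (M : op (bits N)) : Prop :=
  is_clifford M /\ phase_normalized M.

(* duplicate-free enumeration of the (finite) Clifford group modulo phase *)
Definition clifford_enum (N : nat) : seq (op (bits N)) :=
  match pselect (exists s : seq (op (bits N)),
                   uniq s /\ forall M, M \in s <-> clifford_rep M) with
  | left e => proj1_sig (cid e)
  | right _ => [::]
  end.

Definition clifford (N : nat) := seq_sub (@clifford_enum N).

Section LRFC.
Variable h : nat.

Definition left_half (x : bits (h + h)) : bits h := [ffun j => x (lshift h j)].
Definition right_half (x : bits (h + h)) : bits h := [ffun j => x (rshift h j)].
Definition join (a b : bits h) : bits (h + h) :=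
  [ffun i : 'I_(h + h) => match fintype.split i with inl j => a j | inr j => b j end].
Definition bxor (a b : bits h) : bits h := [ffun j => a j (+) b j].

Definition SL (hL : {ffun bits h -> bits h}) : op (bits (h + h)) :=
  permop (fun x => join (bxor (left_half x) (hL (right_half x))) (right_half x)).
Definition SR (hR : {ffun bits h -> bits h}) : op (bits (h + h)) :=
  permop (fun x => join (left_half x) (bxor (right_half x) (hR (left_half x)))).

(* randomness of one LRFC unitary: (h_L, h_R, f, C), drawn uniformly *)
Definition lrfc_param :=
  ({ffun bits h -> bits h} * {ffun bits h -> bits h}
   * {ffun bits (h + h) -> bool} * clifford (h + h))%type.

Definition lrfc (t : lrfc_param) : op (bits (h + h)) :=
  let: (hL, hR, f, Cl) := t in
  SL hL *m SR hR *m phaseop f *m val Cl.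

End LRFC.

Section Blocked.
Variables n xi : nat.

Definition npatch := (n %/ xi)%N.

(* restriction of x to the 2*xi qubits of patches (a, a+1) (0-indexed a) *)
Definition restr (x : bits n) (a : nat) : bits (xi + xi) :=
  [ffun j : 'I_(xi + xi) =>
     oapp x false (insub (a * xi + j)%N : option 'I_n)].

(* (0-indexed) a is the first patch of a pair of the layer;
   odd_layer = true : pairs (a', a'+1) with a' = a+1 odd (paper's 1-indexing) *)
Definition in_layer (odd_layer : bool) (a : 'I_npatch) : bool :=
  (odd a.+1 == odd_layer) && (a.+1 < npatch)%N.

Definition covered (odd_layer : bool) (q : 'I_n) : bool :=
  [exists a : 'I_npatch,
     [&& in_layer odd_layer a, (a * xi <= q)%N & (q < a * xi + (xi + xi))%N]].

(* tensor product of the LRFC unitaries on the pairs of a layer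
   (identity on qubits not covered by any pair) *)
Definition layer (odd_layer : bool) (t : {ffun 'I_npatch -> lrfc_param xi})
  : op (bits n) :=
  mkop (fun y x : bits n =>
    (\prod_(a : 'I_npatch | in_layer odd_layer a)
        ent (lrfc (t a)) (restr y a) (restr x a))
    * ([forall q : 'I_n, ~~ covered odd_layer q ==> (y q == x q)])%:R).

(* randomness: independent LRFC parameters for the odd and the even layer *)
Definition blocked_param :=
  ({ffun 'I_npatch -> lrfc_param xi} * {ffun 'I_npatch -> lrfc_param xi})%type.

Definition blocked_lrfc (t : blocked_param) : op (bits n) :=
  layer false t.2 *m layer true t.1.

End Blocked.

Section Experiment.
Variables n m k : nat.

Definition sys_part (y : bits (n + m)) : bits n := [ffun i => y (lshift m i)].
Definition anc_part (y : bits (n + m)) : bits m := [ffun i => y (rshift n i)].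

Definition ext (U : op (bits n)) : op (bits (n + m)) :=
  mkop (fun y x : bits (n + m) => ent U (sys_part y) (sys_part x) * (anc_part y == anc_part x)%:R).

Definition zero_state : 'cV[C]_#|bits (n + m)| :=
  \col_i (enum_val i == [ffun _ => false])%:R.

Variable W : 'I_k.+1 -> op (bits (n + m)).

Fixpoint run (U : op (bits n)) (j : nat) : 'cV[C]_#|bits (n + m)| :=
  match j with
  | 0 => W (inord 0) *m zero_state
  | j'.+1 => W (inord j) *m (ext U *m run U j')
  end.

Definition output (U : op (bits n)) : 'M[C]_#|bits (n + m)| :=
  run U k *m adjm (run U k).

End Experiment.

(* sigma-algebra on complex d x d matrices generated by the real and imaginary
   parts of the entries (= Borel sigma-algebra of C^{d x d} = R^{2 d^2}) *)
Definition entry_gen (d : nat) : set (set (cmx R d)) :=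
  [set A | exists (i j : 'I_d) (B : set R), measurable B /\
     (A = [set M : cmx R d | B (complex.Re (M i j))] \/ A = [set M : cmx R d | B (complex.Im (M i j))])].

Definition haarT (d : nat) := g_sigma_algebraType (@entry_gen d).

Definition is_haar (d : nat) (P : probability (haarT d) R) : Prop :=
  measurable [set M : haarT d | unitary M] /\
  P [set M : haarT d | unitary M] = 1%E /\
  forall V : 'M[C]_d, unitary V ->
    forall A : set (haarT d), measurable A ->
      P [set M : haarT d | A (V *m M)] = P A.

Definition cexpect (d : nat) (P : probability (haarT d) R) (g : haarT d -> C) : C :=
  Complex (Rintegral P setT (fun M => complex.Re (g M)))
          (Rintegral P setT (fun M => complex.Im (g M))).

Definition haar_avg (d D : nat) (P : probability (haarT d) R)
    (F : 'M[C]_d -> 'M[C]_D) : 'M[C]_D :=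
  \matrix_(i, j) cexpect P (fun M => F M i j).

Definition ens_avg (Th : finType) (D : nat) (F : Th -> 'M[C]_D) : 'M[C]_D :=
  (#|Th|%:R)^-1 *: \sum_(t : Th) F t.

Definition eigenvalues (d : nat) (A : 'M[C]_d) : seq C :=
  sval (closed_field_poly_normal (char_poly A)).

Definition trace_norm (d : nat) (A : 'M[C]_d) : R :=
  \sum_(z <- eigenvalues (adjm A *m A)) complex.Re (sqrtC z).

Definition measurable_error (n k : nat) (Th : finType) (Uf : Th -> op (bits n))
    (eps : R) : Prop :=
  forall (P : probability (haarT #|bits n|) R), is_haar P ->
  forall (m : nat) (W : 'I_k.+1 -> op (bits (n + m))),
    (forall i, unitary (W i)) ->
    trace_norm (ens_avg (fun t => output W (Uf t))
                - haar_avg P (fun U => output W U)) <= eps.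

End QuantumDefs.

(* Main.v *)
(** Fix a Hermitian unitary [V] testing the output (the sign of the difference of
    the two averages).  Expanding the [k] queries of an experiment in the
    computational basis gives amplitudes [A y x], indexed by the output strings [y]
    and the input strings [x] of all the gates in all the queries.  For one gate,
    averaging over the functions [h_L], [h_R] and the signs [f] pairs a tuple of
    strings only with its permutations by [S_k], provided the tuple has no
    collisions; the random Clifford makes collisions among the inputs unlikely,
    since it sends a nonidentity Pauli to a uniformly random one.  Hence the
    average over the ensemble is close to a sum over one permutation per gate.
    Neighbouring gates share a patch, which forces their permutations to agree,
    and what remains is a form [Kfin] that does not change when every query is
    multiplied on the right by a fixed unitary [M].  So both [U] and [U *m M] give a
    value close to [Kfin]; averaging over Haar-random [M] and using left invariance
    turns the second into the Haar value.  The total error is at most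
    [12 n k^2 / 2^xi]. *)

Require Import Defs.
From HB Require Import structures.
From mathcomp Require Import all_boot all_order all_algebra all_fingroup.
From mathcomp Require Import all_classical all_reals.
From mathcomp Require Import measure lebesgue_measure lebesgue_integral probability.
From mathcomp Require Import measurable_realfun.
From mathcomp Require Import complex spectral sesquilinear.
From mathcomp Require Import ring lra zify.
Set Implicit Arguments.
Unset Strict Implicit.
Unset Printing Implicit Defensive.
Import Order.TTheory GRing.Theory Num.Theory.
Local Open Scope ring_scope.

(** * Operators and sesquilinear forms *)

(** Error terms are not estimated separately for each test [V]: since [hform V] is dominated by
    [hform 1%:M], each error for [V] is at most the same error for the identity. There the totals
    are known. The ensemble value is 1, since runs are unit vectors, and [Kfin 1%:M] is the fraction
    of gate-output tuples without collisions, so normalisation bounds whatever the pairing does not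
    reach. For domination to apply, pairing sums must be rewritten with diagonal values
    [hform H v v]; symmetrising over the permutations does this. What remains is the weight of
    colliding gate inputs. The experiment is adaptive, and inputs of the second layer depend on
    outputs of the first, so the Clifford bound is proved for arbitrary vector-valued amplitudes.
    Per gate and ordered pair of queries, in units of [1 / 2^xi], output collisions cost 2 (one for
    each half) and input collisions 2, the latter counted twice: once as missing from the paired
    part, once in the unpaired remainder. The sum 6 is doubled because both averages are compared
    with [Kfin]. *)

Section OpBasics.
Variable R : realType.
Local Notation C := (R[i]).
Implicit Types (T : finType).

Lemma conjcE (z : C) : conjc z = z^*.
Proof. by []. Qed.

Lemma ent_mkop T (f : T -> T -> C) y x : ent (mkop f) y x = f y x.
Proof. by rewrite /ent /mkop mxE !enum_rankK. Qed.

Lemma ent_inj T (A B : op R T) : (forall y x, ent A y x = ent B y x) -> A = B.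
Proof.
move=> AB; apply/matrixP => i j.
by have := AB (enum_val i) (enum_val j); rewrite /ent !enum_valK.
Qed.

Lemma sum_enum_rank (V : nmodType) T (F : 'I_#|T| -> V) :
  \sum_i F i = \sum_(x : T) F (enum_rank x).
Proof.
rewrite (reindex (@enum_rank T)) //=.
by exists enum_val => i _; rewrite ?enum_rankK ?enum_valK.
Qed.

Lemma ent_mul T (A B : op R T) y x :
  ent (A *m B) y x = \sum_z ent A y z * ent B z x.
Proof. by rewrite /ent mxE sum_enum_rank. Qed.

Lemma ent_trace T (A : op R T) : \tr A = \sum_y ent A y y.
Proof. by rewrite /mxtrace sum_enum_rank. Qed.

Lemma ent_adj T (A : op R T) y x : ent (adjm A) y x = (ent A x y)^*.
Proof. by rewrite /ent !mxE. Qed.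

Lemma ent1 T (y x : T) : ent (1%:M : op R T) y x = (y == x)%:R.
Proof. by rewrite /ent mxE (inj_eq enum_rank_inj). Qed.

Lemma ent_scale T a (A : op R T) y x : ent (a *: A) y x = a * ent A y x.
Proof. by rewrite /ent mxE. Qed.

Lemma ent_add T (A B : op R T) y x : ent (A + B) y x = ent A y x + ent B y x.
Proof. by rewrite /ent mxE. Qed.

Lemma adjmE m n (A : 'M[C]_(m, n)) : adjm A = map_mx Num.conj A^T.
Proof. by apply/matrixP => i j; rewrite !mxE. Qed.

Lemma adjmM m n p (A : 'M[C]_(m, n)) (B : 'M[C]_(n, p)) :
  adjm (A *m B) = adjm B *m adjm A.
Proof. by rewrite !adjmE trmx_mul map_mxM. Qed.

Lemma adjmK m n (A : 'M[C]_(m, n)) : adjm (adjm A) = A.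
Proof. by apply/matrixP => i j; rewrite !mxE !conjcE conjCK. Qed.

Lemma adjmD m n (A B : 'M[C]_(m, n)) : adjm (A + B) = adjm A + adjm B.
Proof. by apply/matrixP => i j; rewrite !mxE !conjcE rmorphD. Qed.

Lemma adjmZ m n a (A : 'M[C]_(m, n)) : adjm (a *: A) = a^* *: adjm A.
Proof. by apply/matrixP => i j; rewrite !mxE !conjcE rmorphM. Qed.

Lemma adjm1 n : adjm (1%:M : 'M[C]_n) = 1%:M.
Proof. by apply/matrixP => i j; rewrite !mxE conjcE rmorph_nat eq_sym. Qed.

Lemma unitary1 n : unitary (1%:M : 'M[C]_n).
Proof. by rewrite /unitary adjm1 mul1mx. Qed.

Lemma unitaryM n (A B : 'M[C]_n) : unitary A -> unitary B -> unitary (A *m B).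
Proof.
move=> uA uB; rewrite /unitary adjmM mulmxA -(mulmxA (adjm B)) uA mulmx1.
exact: uB.
Qed.

Lemma unitary_mulr n (A : 'M[C]_n) : unitary A -> A *m adjm A = 1%:M.
Proof. exact: mulmx1C. Qed.

Lemma unitaryP T (A : op R T) :
  unitary A <->
  forall x x', \sum_y (ent A y x)^* * ent A y x' = (x == x')%:R.
Proof.
split=> [uA x x'|H].
  rewrite -ent1 -uA ent_mul; apply: eq_bigr => y _; by rewrite ent_adj.
apply: ent_inj => x x'; rewrite ent_mul ent1 -H.
by apply: eq_bigr => y _; rewrite ent_adj.
Qed.

Lemma permop_unitary T (s : T -> T) : injective s -> unitary (permop R s).
Proof.
move=> s_inj; apply/unitaryP => x x'.
rewrite (bigD1 (s x)) //= !ent_mkop eqxx rmorph1 mul1r (inj_eq s_inj) big1 ?addr0 //.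
by move=> y ys; rewrite ent_mkop (negPf ys) rmorph0 mul0r.
Qed.

Lemma phaseop_unitary T (f : T -> bool) : unitary (phaseop R f).
Proof.
apply/unitaryP => x x'.
rewrite (bigD1 x) //= !ent_mkop eqxx mul1r big1 ?addr0 //.
  case: eqVneq => [<-|_]; last by rewrite mul0r mulr0.
  by rewrite mul1r rmorphXn rmorphN rmorph1 -exprMn mulN1r opprK expr1n.
by move=> y yx; rewrite ent_mkop (negPf yx) mul0r rmorph0 mul0r.
Qed.

(** For a test operator [H], [hform H v v] is its expectation in the state [v]; two arguments keep
    the expansions of bra and ket separate. *)
Definition hform N (H : 'M[C]_N) (u v : 'cV[C]_N) : C := (adjm u *m H *m v) 0 0.

Section Form.
Variables (N : nat) (H : 'M[C]_N).
Implicit Types u v : 'cV[C]_N.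

Lemma hformDl u u' v : hform H (u + u') v = hform H u v + hform H u' v.
Proof. by rewrite /hform adjmD !mulmxDl mxE. Qed.

Lemma hformDr u v v' : hform H u (v + v') = hform H u v + hform H u v'.
Proof. by rewrite /hform mulmxDr mxE. Qed.

Lemma hformZl a u v : hform H (a *: u) v = a^* * hform H u v.
Proof. by rewrite /hform adjmZ -!scalemxAl mxE. Qed.

Lemma hformZr a u v : hform H u (a *: v) = a * hform H u v.
Proof. by rewrite /hform -!scalemxAr mxE. Qed.

Lemma hform0l v : hform H 0 v = 0.
Proof. by rewrite -(scale0r 0) hformZl rmorph0 mul0r. Qed.

Lemma hform0r u : hform H u 0 = 0.
Proof. by rewrite -(scale0r 0) hformZr mul0r. Qed.

Lemma hformNl u v : hform H (- u) v = - hform H u v.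
Proof. by rewrite -scaleN1r hformZl rmorphN rmorph1 mulN1r. Qed.

Lemma hformNr u v : hform H u (- v) = - hform H u v.
Proof. by rewrite -scaleN1r hformZr mulN1r. Qed.

Lemma hform_suml I r (P : pred I) (F : I -> 'cV[C]_N) v :
  hform H (\sum_(i <- r | P i) F i) v = \sum_(i <- r | P i) hform H (F i) v.
Proof. by elim/big_rec2: _ => [|i x y _ <-]; rewrite ?hform0l ?hformDl. Qed.

Lemma hform_sumr I r (P : pred I) (F : I -> 'cV[C]_N) u :
  hform H u (\sum_(i <- r | P i) F i) = \sum_(i <- r | P i) hform H u (F i).
Proof. by elim/big_rec2: _ => [|i x y _ <-]; rewrite ?hform0r ?hformDr. Qed.

End Form.

Lemma hform1E N (u v : 'cV[C]_N) : hform 1%:M u v = \sum_i (u i 0)^* * v i 0.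
Proof. by rewrite /hform mulmx1 mxE; apply: eq_bigr => i _; rewrite !mxE. Qed.

Lemma hform1_ge0 N (u : 'cV[C]_N) : 0 <= hform 1%:M u u.
Proof. by rewrite hform1E sumr_ge0 // => i _; rewrite mulrC mul_conjC_ge0. Qed.

Lemma hformHD N (A B : 'M[C]_N) u v : hform (A + B) u v = hform A u v + hform B u v.
Proof. by rewrite /hform mulmxDr mulmxDl mxE. Qed.

Lemma hformHZ N a (A : 'M[C]_N) u v : hform (a *: A) u v = a * hform A u v.
Proof. by rewrite /hform -scalemxAr -scalemxAl mxE. Qed.

Lemma hform_mulmx N (H A B : 'M[C]_N) u v :
  hform H (A *m u) (B *m v) = hform (adjm A *m H *m B) u v.
Proof. by rewrite /hform adjmM !mulmxA. Qed.

Lemma hform_unitary N (A : 'M[C]_N) u v :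
  unitary A -> hform 1%:M (A *m u) (A *m v) = hform 1%:M u v.
Proof. by move=> uA; rewrite hform_mulmx mulmx1 uA. Qed.

(* [(1 +- V)^2 = 2 (1 +- V)], so both [1 + V] and [1 - V] are positive. *)
Lemma hform_reflection_le N (V : 'M[C]_N) u :
  adjm V = V -> V *m V = 1%:M -> `|hform V u u| <= hform 1%:M u u.
Proof.
move=> Vh VV.
have pm (e : C) : e^* = e -> e * e = 1 -> 0 <= hform 1%:M u u + e * hform V u u.
  move=> eR ee; have := hform1_ge0 ((1%:M + e *: V) *m u).
  rewrite hform_mulmx mulmx1 adjmD adjmZ adjm1 Vh eR.
  rewrite mulmxDl mul1mx mulmxDr mulmx1 -scalemxAr -scalemxAl VV scalerA ee scale1r.
  rewrite addrACA addrC (addrC (e *: V) 1%:M) -mulr2n.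
  have -> : hform ((1%:M + e *: V) *+ 2) u u = 2 * (hform 1%:M u u + e * hform V u u).
    by rewrite mulr2n !hformHD hformHZ; ring.
  by rewrite pmulr_rge0 ?ltr0n.
have p1 := pm 1 (rmorph1 _) (mulr1 _).
have m1 : 0 <= hform 1%:M u u + -1 * hform V u u.
  by apply: pm; [rewrite rmorphN rmorph1 | rewrite mulN1r opprK].
have r1 := ger0_real (hform1_ge0 u).
have rV : hform V u u \is Num.real.
  have -> : hform V u u = (hform 1%:M u u + 1 * hform V u u) - hform 1%:M u u by ring.
  by rewrite realB // ger0_real.
rewrite real_ler_norml //; rewrite mul1r in p1; rewrite mulN1r in m1.
by apply/andP; split; rewrite -subr_ge0 // opprK addrC.
Qed.

End OpBasics.

Section TensorAction.
Variable R : realType.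
Local Notation C := (R[i]).
Variables (J Y : finType).
Local Notation tup := {ffun J -> Y}.

(* [tact M F] applies the tensor product of the operators [M j] to the
   vector-valued function [F] of the tuple of basis states. *)
Definition tact (E : lmodType C) (M : J -> op R Y) (F : tup -> E) (x : tup) : E :=
  \sum_(v : tup) (\prod_j ent (M j) (x j) (v j)) *: F v.

Lemma tact_comp (E : lmodType C) (M M' : J -> op R Y) (F : tup -> E) x :
  tact M (tact M' F) x = tact (fun j => M j *m M' j) F x.
Proof.
rewrite /tact; under eq_bigr do rewrite scaler_sumr.
rewrite exchange_big; apply: eq_bigr => v _ /=.
under eq_bigr do rewrite scalerA.
rewrite -scaler_suml; congr (_ *: _).
under [LHS]eq_bigr do rewrite -big_split /=.
rewrite -(bigA_distr_bigA (fun j y => ent (M j) (x j) y * ent (M' j) y (v j))).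
by apply: eq_bigr => j _; rewrite ent_mul.
Qed.

Lemma tact_eq (E : lmodType C) (M M' : J -> op R Y) (F F' : tup -> E) :
  M =1 M' -> F =1 F' -> tact M F =1 tact M' F'.
Proof.
by move=> MM FF x; apply: eq_bigr => v _; rewrite FF; under eq_bigr do rewrite MM.
Qed.

Lemma tact1 (E : lmodType C) (F : tup -> E) x : tact (fun=> 1%:M) F x = F x.
Proof.
rewrite /tact (bigD1 x) //= big1 ?scale1r; last by move=> j _; rewrite ent1 eqxx.
rewrite big1 ?addr0 // => v vx.
have [j jx] : exists j, x j != v j.
  by apply/existsP; apply: contraNT vx => /existsPn H; apply/eqP/ffunP => j;
     apply/esym/eqP; have := H j; rewrite negbK.
by rewrite (bigD1 j) //= ent1 (negPf jx) mul0r scale0r.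
Qed.

Lemma tact_sum (E : lmodType C) I (r : seq I) (P : pred I) M (F : I -> tup -> E) x :
  tact M (fun v => \sum_(i <- r | P i) F i v) x = \sum_(i <- r | P i) tact M (F i) x.
Proof.
rewrite /tact exchange_big; apply: eq_bigr => v _; exact: scaler_sumr.
Qed.

(** The columns of each [M j] are orthonormal, so summing over [x] leaves Kronecker deltas between
    the two input tuples. In this way the Cliffords disappear from [Kform] and the shift [M] from
    [Kfin]. *)
Lemma tact_form N (H : 'M[C]_N) (M : J -> op R Y) (F G : tup -> 'cV[C]_N) :
  (forall j, unitary (M j)) ->
  \sum_x hform H (tact M F x) (tact M G x) = \sum_x hform H (F x) (G x).
Proof.
move=> uM; transitivity (\sum_(v : tup) \sum_(v' : tup) (\prod_j (v j == v' j)%:R) * hform H (F v) (G v')).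
  rewrite /tact; under eq_bigr do rewrite hform_suml.
  rewrite exchange_big; apply: eq_bigr => v _ /=.
  under eq_bigr do rewrite hform_sumr.
  rewrite exchange_big; apply: eq_bigr => v' _ /=.
  under eq_bigr do rewrite hformZl hformZr mulrA rmorph_prod -big_split /=.
  rewrite -mulr_suml; congr (_ * _).
  rewrite -(bigA_distr_bigA (fun j y => (ent (M j) y (v j))^* * ent (M j) y (v' j))).
  by apply: eq_bigr => j _; have /unitaryP -> := uM j.
apply: eq_bigr => v _; rewrite (bigD1 v) //= big1 => [|j _]; last by rewrite eqxx.
rewrite mul1r big1 ?addr0 // => v' vv'.
have [j jx] : exists j, v j != v' j.
  by apply/existsP; apply: contraNT vv' => /existsPn h; apply/eqP/ffunP => j;
     apply/esym/eqP; have := h j; rewrite negbK.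
by rewrite (bigD1 j) //= (negPf jx) !mul0r.
Qed.

Definition tcomp (x : tup) (s : J -> J) : tup := [ffun j => x (s j)].

Lemma tcomp_bij (s : J -> J) : bijective s -> bijective (fun x => tcomp x s).
Proof.
by case=> t st ts; exists (fun x => tcomp x t) => x; apply/ffunP => j;
  rewrite !ffunE ?st ?ts.
Qed.

Lemma tact_tcomp (E : lmodType C) (M : J -> op R Y) (F : tup -> E) (s : J -> J) x :
  bijective s -> (forall j, M (s j) = M j) ->
  tact M F (tcomp x s) = tact M (fun v => F (tcomp v s)) x.
Proof.
move=> sb Ms; rewrite /tact (reindex (fun v => tcomp v s)) /=; last first.
  exact/onW_bij/tcomp_bij.
apply: eq_bigr => v _; congr (_ *: _).
rewrite [RHS](reindex s) /=; last exact/onW_bij.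
by apply: eq_bigr => j _; rewrite !ffunE Ms.
Qed.

End TensorAction.

(** * Paulis and Cliffords *)

Ltac ord4_cases p := case: p => [[|[|[|[|//]]]] ?].

Section Pauli.
Variable R : realType.
Local Notation C := (R[i]).
Local Notation ci := (Complex 0 1 : C).
Local Notation o4 k := (@Ordinal 4 k isT).

Definition panti (p q : 'I_4) : bool :=
  match val p, val q with
  | 1, 2 | 2, 3 | 3, 1 | 2, 1 | 3, 2 | 1, 3 => true
  | _, _ => false
  end%N.

Definition pmul (p q : 'I_4) : 'I_4 :=
  match val p, val q with
  | 1, 2 | 2, 1 => o4 3
  | 2, 3 | 3, 2 => o4 1
  | 3, 1 | 1, 3 => o4 2
  | 0, _ => q
  | _, 0 => p
  | _, _ => o4 0
  end%N.

Definition pphase (p q : 'I_4) : C :=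
  match val p, val q with
  | 1, 2 | 2, 3 | 3, 1 => ci
  | 2, 1 | 3, 2 | 1, 3 => (- ci)%R
  | _, _ => 1%R
  end%N.

Lemma complex1E : (1 : C) = Complex 1 0. Proof. by []. Qed.
Lemma complex0E : (0 : C) = Complex 0 0. Proof. by []. Qed.

Ltac complex_calc :=
  apply/eqP; rewrite ?(complex1E, complex0E) eq_complex /=;
  apply/andP; split; apply/eqP; ring.

Lemma pauli1_herm (p : 'I_4) a b : (pauli1 R p a b)^* = pauli1 R p b a.
Proof. by ord4_cases p; case: a; case: b; rewrite /pauli1 /= ?expr0 ?expr1; complex_calc. Qed.

Lemma pauli1_mul (p q : 'I_4) a b :
  \sum_c pauli1 R p a c * pauli1 R q c b = pphase p q * pauli1 R (pmul p q) a b.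
Proof.
rewrite big_bool /=; ord4_cases p; ord4_cases q;
  by case: a; case: b; rewrite /pauli1 /pphase /= ?expr0 ?expr1; complex_calc.
Qed.

Lemma pphase4 (p q : 'I_4) : pphase p q ^+ 4 = 1.
Proof. by ord4_cases p; ord4_cases q; rewrite /pphase /= ?expr1n //; complex_calc. Qed.

Lemma pphaseC (p q : 'I_4) : pphase p q = (-1) ^+ panti p q * pphase q p.
Proof.
by ord4_cases p; ord4_cases q; rewrite /pphase /panti /= ?expr0 ?expr1; complex_calc.
Qed.

Lemma pmulC (p q : 'I_4) : pmul p q = pmul q p.
Proof. by ord4_cases p; ord4_cases q; apply: val_inj. Qed.

Lemma pauli1_orth (p q : 'I_4) :
  \sum_a \sum_b pauli1 R p a b * pauli1 R q b a = 2 * (p == q)%:R.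
Proof.
rewrite !big_bool /=; ord4_cases p; ord4_cases q;
  by rewrite /pauli1 -val_eqE /= ?expr0 ?expr1; complex_calc.
Qed.

(** Entrywise form of a tensor identity: the sum of P ⊗ P over the four Paulis is twice the swap of
    two qubits. *)
Lemma pauli1_swap a b c d :
  \sum_(p : 'I_4) pauli1 R p a b * pauli1 R p c d = 2 * ((a == d) && (c == b))%:R.
Proof.
rewrite !big_ord_recl big_ord0 /=.
by case: a; case: b; case: c; case: d; rewrite /pauli1 /= ?expr0 ?expr1; complex_calc.
Qed.

Section Qubits.
Variable N : nat.
Local Notation PI := {ffun 'I_N -> 'I_4}.
Local Notation P := (pauli R).

Definition pauli_mulx (p q : PI) : PI := [ffun j => pmul (p j) (q j)].
Definition pauli_phase (p q : PI) : C := \prod_j pphase (p j) (q j).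
Definition pauli_anti (p q : PI) : bool := odd (\sum_j panti (p j) (q j)).

Lemma pauli_mul (p q : PI) : P p *m P q = pauli_phase p q *: P (pauli_mulx p q).
Proof.
apply: ent_inj => y x; rewrite ent_mul ent_scale !ent_mkop.
under eq_bigr do rewrite !ent_mkop -big_split /=.
rewrite -(bigA_distr_bigA (fun j c => pauli1 R (p j) (y j) c * pauli1 R (q j) c (x j))).
by rewrite -big_split; apply: eq_bigr => j _; rewrite pauli1_mul ffunE.
Qed.

Lemma pauli_phase4 (p q : PI) : pauli_phase p q ^+ 4 = 1.
Proof. by rewrite -prodrXl big1 // => j _; rewrite pphase4. Qed.

Lemma pauli_comm (p q : PI) : P p *m P q = (-1) ^+ pauli_anti p q *: (P q *m P p).
Proof.
rewrite !pauli_mul scalerA; congr (_ *: P _); last first.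
  by apply/ffunP => j; rewrite !ffunE pmulC.
rewrite /pauli_phase /pauli_anti signr_odd.
rewrite -prodrXr -big_split /=; apply: eq_bigr => j _; exact: pphaseC.
Qed.

Lemma pauli_herm (p : PI) : adjm (P p) = P p.
Proof.
apply: ent_inj => y x; rewrite ent_adj !ent_mkop rmorph_prod.
by apply: eq_bigr => j _; exact: pauli1_herm.
Qed.

Definition pauli0 : PI := [ffun=> o4 0].

Lemma pauli0E : P pauli0 = 1%:M.
Proof.
apply: ent_inj => y x; rewrite ent_mkop ent1.
under eq_bigr do rewrite ffunE /pauli1 /=.
case: eqVneq => [->|yx]; first by rewrite big1 // => j _; rewrite eqxx.
have [j jx] : exists j, y j != x j.
  by apply/existsP; apply: contraNT yx => /existsPn h; apply/eqP/ffunP => j;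
     apply/eqP; have := h j; rewrite negbK.
by rewrite (bigD1 j) //= (negPf jx) mul0r.
Qed.

Lemma pauli_sqr (p : PI) : P p *m P p = 1%:M.
Proof.
rewrite pauli_mul /pauli_phase big1 => [|j _]; last by ord4_cases (p j).
rewrite scale1r -pauli0E; congr P; apply/ffunP => j; rewrite !ffunE.
by ord4_cases (p j); apply: val_inj.
Qed.

(** Paulis with different labels are orthogonal for the trace form, while a Pauli has nonzero
    pairing with itself. *)
Lemma pauli_inj (p q : PI) a : P p = a *: P q -> p = q.
Proof.
move=> Ppq; apply/ffunP => j; apply/eqP; apply/negPn/negP => pqj.
have tr (r s : PI) : \tr (P r *m P s) = \prod_j (2 * (r j == s j)%:R).
  rewrite ent_trace.
  under [LHS]eq_bigr => y _.
    rewrite ent_mul; under eq_bigr do rewrite !ent_mkop -big_split /=.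
    rewrite -(bigA_distr_bigA (fun j c => pauli1 R (r j) (y j) c * pauli1 R (s j) c (y j))).
    over.
  rewrite -(bigA_distr_bigA (fun j d => \sum_c pauli1 R (r j) d c * pauli1 R (s j) c d)).
  by apply: eq_bigr => i _; rewrite pauli1_orth.
have := tr p p; rewrite {2}Ppq -scalemxAr mxtraceZ tr (bigD1 j) //= (negPf pqj).
rewrite mulr0 mul0r mulr0 => /esym/eqP/prodf_eq0[i _].
by rewrite eqxx mulr1 pnatr_eq0.
Qed.

End Qubits.
End Pauli.

(** * Cliffords that exchange two anticommuting Paulis *)

Section Clifford.
Variable R : realType.
Local Notation C := (R[i]).
Variable N : nat.
Local Notation PI := {ffun 'I_N -> 'I_4}.
Local Notation P := (pauli R).
Local Notation OP := (op R (bits N)).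
Local Notation o4 k := (@Ordinal 4 k isT).

Lemma scalar_op_inj (a b : C) : a *: (1%:M : OP) = b *: 1%:M -> a = b.
Proof.
move/(congr1 (fun A : OP => ent A [ffun=> false] [ffun=> false])).
by rewrite !ent_scale ent1 eqxx !mulr1.
Qed.

Lemma sign_sqr (s : bool) : (-1) ^+ s * (-1) ^+ s = 1 :> C.
Proof. by case: s; rewrite ?expr1 ?expr0 ?mulrNN mulr1. Qed.

(** A product of Paulis is a Pauli up to a fourth root of unity. Hermiticity makes that phase real,
    which leaves the sign demanded by [is_clifford]. *)
Lemma hermitian_pauli_sign (l : C) (r : PI) :
  l ^+ 4 = 1 -> adjm (l *: P r) = l *: P r -> exists s : bool, l = (-1) ^+ s.
Proof.
move=> l4; rewrite adjmZ pauli_herm => /(congr1 (fun A => A *m P r)).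
rewrite -!scalemxAl pauli_sqr => /scalar_op_inj lR.
have rl : l \is Num.real by apply/CrealP.
have : (l ^+ 2 == 1).
  have : (l ^+ 2) ^+ 2 = 1 by rewrite -exprM.
  have l2 : 0 <= l ^+ 2 by rewrite real_exprn_even_ge0.
  by move/eqP; rewrite pexpr_eq1.
rewrite sqrf_eq1 => /orP[]/eqP ->; first by exists false.
by exists true; rewrite expr1.
Qed.

Section Swap.
Variables (p q : PI).
Hypothesis anti_pq : pauli_anti p q.

(* Conjugation by this Clifford exchanges the anticommuting Paulis [P p] and [P q]. *)
Definition pauli_swap : OP := (sqrtC 2)^-1 *: (P p + P q).

Let half : (sqrtC 2)^-1 * (sqrtC 2)^-1 = 2^-1 :> C.
Proof. by rewrite -invfM -expr2 sqrtCK. Qed.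

Let qpN : P q *m P p = - (P p *m P q).
Proof.
by rewrite (pauli_comm R p q) anti_pq expr1 scaleN1r opprK.
Qed.

Lemma pauli_swap_herm : adjm pauli_swap = pauli_swap.
Proof.
rewrite /pauli_swap adjmZ adjmD !pauli_herm; congr (_ *: _).
by apply/CrealP; rewrite realV ger0_real // sqrtC_ge0.
Qed.

(** Of the four terms of the expansion, the two mixed ones cancel when [e1 = e2], because [P p] and
    [P q] anticommute; otherwise the two diagonal ones cancel and the mixed ones add up. *)
Lemma pauli_swap_conj (r : PI) (e1 e2 : bool) :
  P p *m P r = (-1) ^+ e1 *: (P r *m P p) ->
  P q *m P r = (-1) ^+ e2 *: (P r *m P q) ->
  pauli_swap *m P r *m pauli_swap =
  if e1 == e2 then (-1) ^+ e1 *: P r else (-1) ^+ e2 *: (P p *m P q *m P r).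
Proof.
have comm (t : PI) (e : bool) : P t *m P r = (-1) ^+ e *: (P r *m P t) ->
    P r *m P t = (-1) ^+ e *: (P t *m P r).
  by move=> ->; rewrite scalerA sign_sqr scale1r.
move=> /comm pr /comm qr; rewrite /pauli_swap -!scalemxAl -scalemxAr scalerA half.
rewrite mulmxDr !mulmxDl -!mulmxA pr qr -!scalemxAr !mulmxA !pauli_sqr qpN !mulNmx !mul1mx.
move: (P r) (P p *m P q *m P r) => X Y.
case: e1 {pr}; case: e2 {qr} => /=; rewrite ?expr0 ?expr1 ?scaleN1r ?scale1r;
  by apply/matrixP => i j; rewrite !mxE; field.
Qed.

Lemma pauli_swap_sqr : pauli_swap *m pauli_swap = 1%:M.
Proof.
have := @pauli_swap_conj (pauli0 N) false false.
by rewrite pauli0E !mulmx1 !mul1mx expr0 !scale1r eqxx => ->.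
Qed.

Lemma pauli_swap_unitary : unitary pauli_swap.
Proof. by rewrite /unitary pauli_swap_herm pauli_swap_sqr. Qed.

Lemma pauli_swapE : pauli_swap *m P p *m pauli_swap = P q.
Proof.
rewrite (@pauli_swap_conj p false true) ?expr0 ?scale1r ?expr1 ?scaleN1r //=.
  by rewrite -mulmxA qpN mulmxN opprK mulmxA pauli_sqr mul1mx.
Qed.

Lemma pauli_swap_clifford : is_clifford pauli_swap.
Proof.
split=> [|r]; first exact: pauli_swap_unitary.
rewrite pauli_swap_herm.
have := pauli_swap_conj (pauli_comm R p r) (pauli_comm R q r).
case: eqP => [_ ->|_ E]; first by exists (pauli_anti p r), r.
pose t := pauli_mulx (pauli_mulx p q) r.
pose l := (-1) ^+ pauli_anti q r * (pauli_phase R p q * pauli_phase R (pauli_mulx p q) r).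
have El : pauli_swap *m P r *m pauli_swap = l *: P t.
  by rewrite E pauli_mul -scalemxAl pauli_mul !scalerA.
have [||s ls] := @hermitian_pauli_sign l t; last by exists s, t; rewrite El ls.
  by rewrite !exprMn !pauli_phase4 !mulr1 -exprM mulnC exprM (_ : (-1) ^+ 4 = 1) ?expr1n //; ring.
by rewrite -El !adjmM pauli_swap_herm pauli_herm mulmxA.
Qed.

End Swap.

Lemma pauli_anti_sym (p q : PI) : pauli_anti p q = pauli_anti q p.
Proof.
rewrite /pauli_anti; congr odd; apply: eq_bigr => j _.
by rewrite /panti; ord4_cases (p j); ord4_cases (q j).
Qed.

Lemma pauli_anti_single (p : PI) j (t : 'I_4) (s : PI) :
  s j = t -> (forall i, i != j -> panti (p i) (s i) = false) ->
  pauli_anti p s = panti (p j) t.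
Proof.
move=> sj si; rewrite /pauli_anti (bigD1 j) //= big1 ?addn0 ?sj ?oddb //.
by move=> i /si ->.
Qed.

Lemma panti_common (a b : 'I_4) : a != o4 0 -> b != o4 0 ->
  exists t, panti a t && panti b t.
Proof.
ord4_cases a; ord4_cases b; rewrite -!val_eqE //= => _ _;
  by [exists (o4 1) | exists (o4 2) | exists (o4 3)].
Qed.

Lemma panti0 (a : 'I_4) : panti a (o4 0) = false.
Proof. by ord4_cases a. Qed.

Lemma pauli_neq0P (p : PI) : p != pauli0 N -> exists j, p j != o4 0.
Proof.
move=> p0; apply/existsP; apply: contraNT p0 => /existsPn h.
by apply/eqP/ffunP => j; rewrite ffunE; apply/eqP; have := h j; rewrite negbK.
Qed.

(** Connects any two nonidentity Paulis by two anticommuting steps. If one of the chosen qubits is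
    nontrivial for both, a single-qubit Pauli works; otherwise [p] and [q] are handled on two
    different qubits. *)
Lemma pauli_anti_common (p q : PI) : p != pauli0 N -> q != pauli0 N ->
  exists t, pauli_anti p t && pauli_anti q t.
Proof.
move=> /pauli_neq0P[j pj] /pauli_neq0P[k qk].
have single i (t : 'I_4) (r : PI) :
    pauli_anti r [ffun l => if l == i then t else o4 0] = panti (r i) t.
  apply: (pauli_anti_single (j := i)); first by rewrite ffunE eqxx.
  by move=> l li; rewrite ffunE (negPf li) panti0.
have [qj|qj] := eqVneq (q j) (o4 0); last first.
  have [t pqt] := panti_common pj qj.
  by exists [ffun l => if l == j then t else o4 0]; rewrite !single.
have [pk|pk] := eqVneq (p k) (o4 0); last first.
  have [t pqt] := panti_common pk qk.
  by exists [ffun l => if l == k then t else o4 0]; rewrite !single.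
have jk : j != k by apply: contraNneq pj => ->; rewrite pk.
have [s /andP[ps _]] := panti_common pj pj; have [t /andP[qt _]] := panti_common qk qk.
exists [ffun l => if l == j then s else if l == k then t else o4 0].
rewrite (pauli_anti_single (j := j) (t := s)) ?ffunE ?eqxx ?ps //=; last first.
  by move=> l lj; rewrite ffunE (negPf lj); case: eqP => [->|_]; rewrite ?pk ?panti0.
rewrite (pauli_anti_single (j := k) (t := t)) ?ffunE ?eqxx ?qt //=.
  by rewrite eq_sym (negPf jk).
by move=> l lk; rewrite ffunE (negPf lk); case: eqP => [->|_]; rewrite ?qj ?panti0.
Qed.

End Clifford.

Lemma sum1_neq (A : nzRingType) (T : finType) (x0 : T) :
  \sum_(x | x != x0) 1 = #|T|%:R - 1 :> A.
Proof.
apply/eqP; rewrite -(can_eq (addrK 1)) subrK addrC.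
by rewrite -(bigD1 x0 (P := predT) (F := fun=> 1)) //= sumr_const.
Qed.

(** All fibres away from [x0] have the same size [m], so the image of a uniform point is uniform
    there; the identity is multiplied out to avoid division. *)
Lemma sum_uniform_image (A : comNzRingType) (T S : finType) (im : T -> S) (x0 : S)
    (m : nat) (g : S -> A) :
  (forall c, im c != x0) -> (forall p, p != x0 -> #|[pred c | im c == p]| = m) ->
  (#|S|%:R - 1) * (\sum_c g (im c)) = #|T|%:R * \sum_(p | p != x0) g p.
Proof.
move=> im0 imm.
have sumE (h : S -> A) : \sum_c h (im c) = \sum_(p | p != x0) m%:R * h p.
  rewrite (partition_big im (fun p => p != x0)) //=.
  apply: eq_bigr => p p0; under eq_bigr => c /eqP -> do [].
  by rewrite sumr_const mulr_natl -(imm p p0).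
have cardE : #|T|%:R = m%:R * (#|S|%:R - 1) :> A.
  rewrite -[LHS]sumr_const (sumE (fun=> 1)) -(sum1_neq _ x0) mulr_sumr.
  by apply: eq_bigr.
rewrite sumE cardE -mulr_sumr mulrA [_ * m%:R]mulrC; congr (_ * _).
Qed.

Lemma leq_card_inj (T : finType) (f : T -> T) (A B : {set T}) :
  injective f -> (forall x, x \in A -> f x \in B) -> (#|A| <= #|B|)%N.
Proof.
move=> f_inj fAB; rewrite -(card_imset (mem A) f_inj).
by apply/subset_leq_card/fintype.subsetP => y /imsetP[x xA ->]; exact: fAB.
Qed.

(** * The Clifford group modulo phase and its action on Paulis *)

Section CliffordGroup.
Variable R : realType.
Local Notation C := (R[i]).
Variable N : nat.
Local Notation PI := {ffun 'I_N -> 'I_4}.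
Local Notation P := (pauli R).
Local Notation OP := (op R (bits N)).
Local Notation o4 k := (@Ordinal 4 k isT).

Definition zpauli (z : bits N) : PI := [ffun j => if z j then o4 3 else o4 0].
Definition zchar (z x : bits N) : C := \prod_j (-1) ^+ (z j && x j).

Lemma ent_zpauli z y x : ent (P (zpauli z)) y x = (y == x)%:R * zchar z x.
Proof.
rewrite ent_mkop /zchar; case: eqVneq => [->|yx].
  rewrite mul1r; apply: eq_bigr => j _; rewrite ffunE.
  by case: (z j); rewrite /pauli1 /= eqxx ?expr0.
have [j jx] : exists j, y j != x j.
  by apply/existsP; apply: contraNT yx => /existsPn h; apply/eqP/ffunP => j;
     apply/eqP; have := h j; rewrite negbK.
rewrite mul0r (bigD1 j) //= ffunE.
by case: (z j); rewrite /pauli1 /= (negPf jx) mul0r.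
Qed.

(** Schur's lemma for the Pauli group: Z-type Paulis kill the off-diagonal entries, and X-type
    Paulis equate the diagonal ones. *)
Lemma pauli_commutant (X : OP) :
  (forall p, X *m P p = P p *m X) -> exists l, X = l *: 1%:M.
Proof.
move=> comX; pose o : bits N := [ffun=> false].
have off y x : y != x -> ent X y x = 0.
  move=> yx; have [j jx] : exists j, y j != x j.
    by apply/existsP; apply: contraNT yx => /existsPn h; apply/eqP/ffunP => j;
       apply/eqP; have := h j; rewrite negbK.
  pose z : bits N := [ffun i => i == j].
  have zE (v : bits N) : zchar z v = (-1) ^+ v j.
    rewrite /zchar (bigD1 j) //= ffunE eqxx big1 ?mulr1 // => i ij.
    by rewrite ffunE (negPf ij).
  have := congr1 (fun A : OP => ent A y x) (comX (zpauli z)).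
  rewrite !ent_mul (bigD1 x) //= ent_zpauli eqxx mul1r big1 ?addr0; last first.
    by move=> v vx; rewrite ent_zpauli (negPf vx) mul0r mulr0.
  rewrite (bigD1 y) //= ent_zpauli eqxx mul1r big1 ?addr0; last first.
    by move=> v vx; rewrite ent_zpauli eq_sym (negPf vx) !mul0r.
  rewrite !zE; move: jx; case: (y j); case: (x j) => // _; rewrite ?expr0 ?expr1.
    by rewrite mulr1 mulN1r => /eqP; rewrite -subr_eq0 opprK -mulr2n mulrn_eq0 => /eqP.
  by rewrite mul1r mulrN1 => /esym/eqP; rewrite -subr_eq0 opprK -mulr2n mulrn_eq0 => /eqP.
have diag y x : ent X y y = ent X x x.
  pose p : PI := [ffun j => if y j == x j then o4 0 else o4 1].
  have Pyx : ent (P p) y x = 1.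
    by rewrite ent_mkop big1 // => j _; rewrite ffunE; case: eqP => h;
       rewrite /pauli1 /= ?h ?eqxx //; move/eqP: h => ->.
  have := congr1 (fun A : OP => ent A y x) (comX p).
  rewrite !ent_mul (bigD1 y) //= Pyx mulr1 big1 ?addr0; last first.
    by move=> v vy; rewrite off ?mul0r // eq_sym.
  rewrite (bigD1 x) //= Pyx mul1r big1 ?addr0 // => v vx.
  by rewrite (off v x) ?mulr0.
exists (ent X o o); apply: ent_inj => y x; rewrite ent_scale ent1.
by case: eqVneq => [->|/off ->]; rewrite ?mulr0 // mulr1.
Qed.

(** A nonzero multiple has its first nonzero entry at the same place. Positivity of both entries
    makes [l] nonnegative, and unitarity gives [l * l = 1]. *)
Lemma normalized_phase_unique d (M M' : 'M[C]_d) l :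
  unitary M -> unitary M' -> M' = l *: M ->
  phase_normalized M -> phase_normalized M' -> M = M'.
Proof.
move=> uM uM' E [i [j [Mij Mlt]]] [i' [j' [Mij' Mlt']]].
have l0 : l != 0.
  by apply: contraTneq Mij' => l0; rewrite E l0 scale0r mxE ltxx.
have [ii jj] : i' = i /\ j' = j.
  have h1 : ~~ ((j' < j)%N || ((j' == j) && (i' < i)%N)).
    apply/negP => /Mlt M0; move: Mij'; rewrite E mxE M0 mulr0 ltxx //.
  have h2 : ~~ ((j < j')%N || ((j == j') && (i < i')%N)).
    apply/negP => /Mlt'; rewrite E mxE => /eqP.
    by rewrite mulf_eq0 (negPf l0) /= => /eqP M0; move: Mij; rewrite M0 ltxx.
  move: h1 h2; rewrite !negb_or -!leqNgt => /andP[a1 b1] /andP[a2 b2].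
  have jj : j' = j by apply/val_inj/eqP; rewrite eqn_leq a1 a2.
  move: b1 b2; rewrite jj !eqxx /= -!leqNgt => b1 b2.
  by split=> //; apply/val_inj/eqP; rewrite eqn_leq b1 b2.
have lge0 : 0 <= l.
  move: Mij'; rewrite ii jj E mxE pmulr_lgt0 //; exact: ltW.
have : l * l = 1.
  have := uM'; rewrite /unitary E adjmZ -scalemxAl -scalemxAr scalerA uM.
  move/(congr1 (fun A : 'M[C]_d => A i i)); rewrite !mxE eqxx mulr1.
  by rewrite (CrealP (ger0_real lge0)).
move/eqP; rewrite -expr2 pexpr_eq1 // => /eqP l1.
by rewrite E l1 scale1r.
Qed.

Lemma phase_normalizable d (A : 'M[C]_d) : A != 0 ->
  exists l, l^* * l = 1 /\ phase_normalized (l *: A).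
Proof.
move=> A0.
have [[i0 j0] /= Aij0] : exists ij : 'I_d * 'I_d, A ij.1 ij.2 != 0.
  apply/existsP; apply: contraNT A0 => /existsPn h.
  by apply/eqP/matrixP => i j; rewrite mxE; apply/eqP; have := h (i, j); rewrite negbK.
(* Position in column-major order, as in [phase_normalized]: the minimiser is the first nonzero
   entry. *)
pose pos (ij : 'I_d * 'I_d) := (ij.2 * d + ij.1)%N.
have := @arg_minnP _ (i0, j0) (fun ij => A ij.1 ij.2 != 0) pos Aij0.
case=> -[i j] /= Aij minA.
exists (`|A i j| / A i j); split.
  by rewrite mulrC -normCK normrM normfV normr_id divff ?expr1n // normr_eq0.
exists i, j; split; first by rewrite mxE divfK // normr_gt0.
move=> i' j' lt'; rewrite mxE; apply/eqP; rewrite mulf_eq0; apply/orP; right.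
apply/negPn/negP => /(minA (i', j')); rewrite /pos /= leqNgt => /negP; apply.
case/orP: lt' => [jj|/andP[/eqP -> ii]]; last by rewrite ltn_add2l.
have := ltn_ord i'; have := ltn_ord i; nia.
Qed.

Lemma clifford_id : is_clifford (1%:M : OP).
Proof.
split; first exact: unitary1.
by move=> p; exists false, p; rewrite adjm1 mulmx1 mul1mx expr0 scale1r.
Qed.

Lemma clifford_mul (A B : OP) : is_clifford A -> is_clifford B -> is_clifford (A *m B).
Proof.
move=> [uA cA] [uB cB]; split; first exact: unitaryM.
move=> p; have [s [q Bq]] := cB p; have [t [r Ar]] := cA q.
exists (t (+) s), r; rewrite adjmM !mulmxA -(mulmxA A B) -(mulmxA A (B *m _)) Bq.
by rewrite -scalemxAr -scalemxAl Ar scalerA signr_addb mulrC.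
Qed.

Lemma clifford_scale (A : OP) l : l^* * l = 1 -> is_clifford A -> is_clifford (l *: A).
Proof.
move=> ll [uA cA]; split.
  by rewrite /unitary adjmZ -scalemxAl -scalemxAr scalerA ll scale1r.
move=> p; have [s [q Aq]] := cA p; exists s, q.
by rewrite adjmZ -!scalemxAl -scalemxAr scalerA mulrC ll scale1r.
Qed.

Lemma clifford_same_action (A B : OP) :
  unitary A -> unitary B ->
  (forall p, A *m P p *m adjm A = B *m P p *m adjm B) -> exists l, B = l *: A.
Proof.
move=> uA uB AB; have [|l El] := @pauli_commutant (adjm A *m B).
  move=> p; transitivity (adjm A *m (B *m P p *m adjm B) *m B).
    by rewrite -!mulmxA uB mulmx1.
  by rewrite -AB !mulmxA uA mul1mx.
exists l; rewrite -(mul1mx B) -(unitary_mulr uA) -mulmxA El.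
by rewrite -scalemxAr mulmx1.
Qed.

(** A Clifford is determined up to phase by its action on Paulis with signs, and normalisation fixes
    the phase, so representatives are indexed within a finite function space. This excludes the
    default [[::]] in [clifford_enum]. *)
Lemma clifford_enumerable : exists s : seq OP,
  uniq s /\ forall M, M \in s <-> clifford_rep M.
Proof.
pose sg (b : bool) : C := (-1) ^+ b.
pose acts (f : {ffun PI -> bool * PI}) (M : OP) :=
  clifford_rep M /\ forall p, M *m P p *m adjm M = sg (f p).1 *: P (f p).2.
have acts_unique f M M' : acts f M -> acts f M' -> M = M'.
  move=> [[[uM _] nM] fM] [[[uM' _] nM'] fM'].
  have [|l El] := clifford_same_action uM uM'; first by move=> p; rewrite fM fM'.
  exact: normalized_phase_unique El nM nM'.
pose pick f : option OP :=
  if pselect (exists M, acts f M) is left e then Some (projT1 (cid e)) else None.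
exists (undup (pmap pick (enum {ffun PI -> bool * PI}))); split; first exact: undup_uniq.
move=> M; rewrite mem_undup mem_pmap; split.
  case/mapP => f _; rewrite /pick; case: pselect => // e [->].
  by case: (projT2 (cid e)).
move=> rM; have [_ cM] := rM.1.
have /choice[f fP] p : exists fp : bool * PI, M *m P p *m adjm M = sg fp.1 *: P fp.2.
  by have [s [q E]] := cM p; exists (s, q).
have aM : acts (finfun f) M by split=> // p; rewrite ffunE.
apply/mapP; exists (finfun f); first by rewrite mem_enum.
rewrite /pick; case: pselect => [e|]; last by case; exists M.
by congr Some; apply: acts_unique aM (projT2 (cid e)).
Qed.

Lemma mem_clifford_enum M : M \in clifford_enum R N <-> clifford_rep M.
Proof.
rewrite /clifford_enum; case: pselect => [e|]; last by case; exact: clifford_enumerable.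
by case: (projT2 (cid e)).
Qed.

Lemma clifford_valP (c : clifford R N) : clifford_rep (val c).
Proof. exact/mem_clifford_enum/(valP c). Qed.

Lemma clifford_of (M : OP) : is_clifford M ->
  exists (c : clifford R N) (l : C), val c = l *: M /\ l^* * l = 1.
Proof.
move=> cM; have M0 : M != 0.
  apply/eqP => M0; have := cM.1; rewrite /unitary M0 mulmx0 => /esym.
  by rewrite -[1%:M]scale1r -[0 in RHS](scale0r 1%:M) => /scalar_op_inj/eqP; rewrite oner_eq0.
have [l [ll nl]] := phase_normalizable M0.
have rM : clifford_rep (l *: M) by split=> //; exact: clifford_scale.
have lin : l *: M \in clifford_enum R N by apply/mem_clifford_enum.
by exists (SeqSub lin), l.
Qed.

Lemma clifford_unitary (c : clifford R N) : unitary (val c).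
Proof. by case: (clifford_valP c) => -[]. Qed.

Lemma clifford_card_gt0 : (0 < #|{: clifford R N}|)%N.
Proof. by have [c _] := clifford_of clifford_id; apply/card_gt0P; exists c. Qed.

(** The adjoint stands on the left because an observable measured after the gate is pulled back
    through it. *)
Definition clifford_maps (c : clifford R N) (z p : PI) : bool :=
  [exists s : bool, adjm (val c) *m P z *m val c == (-1) ^+ s *: P p].

(** [is_clifford] controls conjugation in the forward direction only. Its label map [g] is injective
    on a finite set, hence bijective, and its inverse labels the pull-back. *)
Lemma clifford_maps_ex c z : exists p, clifford_maps c z p.
Proof.
have [[u cc] _] := clifford_valP c.
have [f fP] := choice cc; have [g gP] := choice fP.
have E r : adjm (val c) *m P (g r) *m val c = (-1) ^+ f r *: P r.
  have -> : P (g r) = (-1) ^+ f r *: (val c *m P r *m adjm (val c)).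
    by rewrite gP scalerA sign_sqr scale1r.
  rewrite -scalemxAr -scalemxAl; congr (_ *: _).
  by rewrite !mulmxA u mul1mx -mulmxA u mulmx1.
have g_inj : injective g.
  move=> p q pq; apply: (@pauli_inj R N p q ((-1) ^+ f p * (-1) ^+ f q)).
  have := E q; rewrite -pq E => /(congr1 (fun A => (-1) ^+ f p *: A)).
  by rewrite !scalerA sign_sqr scale1r.
have [h _ hK] := injF_bij g_inj.
by exists (h z); apply/existsP; exists (f (h z)); rewrite -E hK.
Qed.

Lemma clifford_maps_unique c z p q : clifford_maps c z p -> clifford_maps c z q -> p = q.
Proof.
move=> /existsP[s /eqP Es] /existsP[t /eqP E]; rewrite Es in E.
apply: (@pauli_inj R N p q ((-1) ^+ s * (-1) ^+ t)).
by move: E => /(congr1 (fun A => (-1) ^+ s *: A)); rewrite !scalerA sign_sqr scale1r.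
Qed.

Lemma clifford_maps_neq0 c z p : z != pauli0 N -> clifford_maps c z p -> p != pauli0 N.
Proof.
move=> z0 /existsP[s /eqP E]; apply: contraNneq z0 => p0; apply/eqP.
have u := clifford_unitary c.
apply: (@pauli_inj R N _ _ ((-1) ^+ s)).
have -> : P z = val c *m (adjm (val c) *m P z *m val c) *m adjm (val c).
  by rewrite !mulmxA unitary_mulr // mul1mx -mulmxA unitary_mulr // mulmx1.
by rewrite E p0 pauli0E -scalemxAr mulmx1 -scalemxAl unitary_mulr.
Qed.

(** Right multiplication by the swap of [p] and [q], followed by phase normalisation, is injective
    on Cliffords modulo phase and carries the label [p] to [q]. *)
Lemma clifford_maps_swap_le z p q : pauli_anti p q ->
  (#|[set c | clifford_maps c z p]| <= #|[set c | clifford_maps c z q]|)%N.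
Proof.
move=> apq; have [G [cG hG GE]] : exists G : OP,
    [/\ is_clifford G, adjm G = G & G *m P p *m G = P q].
  exists (pauli_swap R p q); split; first exact: pauli_swap_clifford.
    exact: pauli_swap_herm.
  exact: pauli_swapE.
have /choice[f fP] (c : clifford R N) : exists d : clifford R N, exists l,
    val d = l *: (val c *m G) /\ l^* * l = 1.
  apply: clifford_of; apply: clifford_mul; last exact: cG.
  by case: (clifford_valP c).
have uG : unitary G by case: cG.
have f_inj : injective f.
  move=> c d cd; apply: val_inj.
  have [l [El ll]] := fP c; have [m [Em mm]] := fP d.
  have l0 : m != 0 by apply: contra_eq_neq mm => ->; rewrite mulr0 eq_sym oner_eq0.
  have E : val d = (m^-1 * l) *: val c.
    rewrite -[LHS]mulmx1 -[val c]mulmx1 -(unitary_mulr uG) !mulmxA.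
    have -> : val d *m G = m^-1 *: val (f d) by rewrite Em scalerA mulVf ?scale1r.
    by rewrite -cd El scalerA -!scalemxAl.
  by apply: (normalized_phase_unique _ _ E); try exact: clifford_unitary;
     case: (clifford_valP c); case: (clifford_valP d).
apply: (leq_card_inj f_inj) => c.
rewrite !finset.inE => /existsP[s /eqP Es]; apply/existsP; exists s; apply/eqP.
have [l [-> ll]] := fP c.
rewrite adjmZ -!scalemxAl -scalemxAr scalerA ll scale1r adjmM hG.
transitivity (G *m (adjm (val c) *m P z *m val c) *m G); first by rewrite !mulmxA.
rewrite Es; transitivity ((-1) ^+ s *: (G *m P p *m G)).
  by rewrite scalemxAl scalemxAr.
by rewrite GE.
Qed.

Lemma pauli_anti_connected (T : Type) (n : PI -> T) p q :
  (forall p' q', pauli_anti p' q' -> n p' = n q') ->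
  p != pauli0 N -> q != pauli0 N -> n p = n q.
Proof.
move=> swap p0 q0; have [t /andP[pt qt]] := pauli_anti_common p0 q0.
by rewrite (swap _ _ pt) (swap _ _ qt).
Qed.

Definition clifford_count z p := #|[set c | clifford_maps c z p]|.

Lemma clifford_count_transitive z p q : p != pauli0 N -> q != pauli0 N ->
  clifford_count z p = clifford_count z q.
Proof.
apply: pauli_anti_connected => p' q' a; apply: anti_leq; apply/andP.
by split; apply: clifford_maps_swap_le => //; rewrite pauli_anti_sym.
Qed.

(** The swaps make all counts [clifford_count z p] equal, so the pull-back of a fixed nonidentity
    Pauli through a uniform Clifford is uniform over the nonidentity Paulis. *)
Lemma clifford_pauli_mixing (g : PI -> C) (z : PI) (im : clifford R N -> PI) :
  z != pauli0 N -> (forall c, clifford_maps c z (im c)) ->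
  (#|PI|%:R - 1) * (\sum_c g (im c)) = #|{: clifford R N}|%:R * \sum_(p | p != pauli0 N) g p.
Proof.
move=> z0 imP.
apply: (sum_uniform_image g (m := clifford_count z z)).
  by move=> c; exact: clifford_maps_neq0 (imP c).
move=> p p0; rewrite -(clifford_count_transitive z p0 z0) /clifford_count cardsE.
apply: eq_card => c; apply/eqP/idP => [<-|]; first exact: imP.
exact: clifford_maps_unique.
Qed.

End CliffordGroup.

(** * Collisions under a random Clifford *)

Section Collision.
Variable R : realType.
Local Notation C := (R[i]).

(** Orthogonality of the characters of [bits h], used as an indicator of [a == b]. *)
Lemma sum_sign_chars h (a b : bits h) :
  \sum_(z : bits h) (\prod_q (-1) ^+ (z q && a q)) * (\prod_q (-1) ^+ (z q && b q)) =
  2 ^+ h * (a == b)%:R :> C.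
Proof.
under eq_bigr do rewrite -big_split /=.
rewrite -(bigA_distr_bigA (fun q (t : bool) => (-1) ^+ (t && a q) * (-1) ^+ (t && b q) : C)).
transitivity (\prod_(q < h) (2 * (a q == b q)%:R) : C).
  apply: eq_bigr => q _; rewrite big_bool /= !expr0.
  by case: (a q); case: (b q); rewrite /= ?expr0 ?expr1; ring.
rewrite big_split /= prodr_const card_ord; congr (_ * _).
case: eqVneq => [->|ab]; first by rewrite big1 // => q _; rewrite eqxx.
have [q qab] : exists q, a q != b q.
  by apply/existsP; apply: contraNT ab => /existsPn H; apply/eqP/ffunP => q;
     apply/eqP; have := H q; rewrite negbK.
by rewrite (bigD1 q) //= (negPf qab) mul0r.
Qed.

Lemma join_lshift h (a b : bits h) q : join a b (lshift h q) = a q.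
Proof. by rewrite ffunE (unsplitK (inl q)). Qed.

Lemma join_rshift h (a b : bits h) q : join a b (rshift h q) = b q.
Proof. by rewrite ffunE (unsplitK (inr q)). Qed.

Lemma join_halves h (x : bits (h + h)) : join (left_half x) (right_half x) = x.
Proof.
apply/ffunP => q; rewrite -(splitK q); case: (fintype.split q) => k /=.
  by rewrite join_lshift ffunE.
by rewrite join_rshift ffunE.
Qed.

Lemma left_join h (a b : bits h) : left_half (join a b) = a.
Proof. by apply/ffunP => q; rewrite ffunE join_lshift. Qed.

Lemma right_join h (a b : bits h) : right_half (join a b) = b.
Proof. by apply/ffunP => q; rewrite ffunE join_rshift. Qed.

Section Pair.
Variable h : nat.
Local Notation Y := (bits (h + h)).
Local Notation PI := {ffun 'I_(h + h) -> 'I_4}.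
Local Notation P := (pauli R).
Variables (J : finType) (i j : J).
Hypothesis ij : i != j.
Local Notation tup := {ffun J -> Y}.

Definition pairop (Q : op R Y) (l : J) : op R Y :=
  if (l == i) || (l == j) then Q else 1%:M.

Lemma prod_pairop (Q : op R Y) (x v : tup) :
  \prod_l ent (pairop Q l) (x l) (v l) =
  ent Q (x i) (v i) * ent Q (x j) (v j) *
  \prod_(l | (l != i) && (l != j)) (x l == v l)%:R.
Proof.
rewrite (bigD1 i) //= (bigD1 j) 1?eq_sym //= mulrA /pairop !eqxx orbT /=.
congr (_ * _); apply: eq_bigr => l /andP[li lj].
by rewrite (negPf li) (negPf lj) ent1.
Qed.

Definition lchar (z : bits h) (x : Y) : C := \prod_q (-1) ^+ (z q && left_half x q).
Definition lpauli (z : bits h) : PI := zpauli (join z [ffun=> false]).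

Lemma ent_lpauli z y x : ent (P (lpauli z)) y x = (y == x)%:R * lchar z x.
Proof.
rewrite ent_zpauli; congr (_ * _).
rewrite /zchar big_split_ord /= [X in _ * X]big1 ?mulr1.
  by apply: eq_bigr => q _; rewrite join_lshift ffunE.
by move=> q _; rewrite join_rshift ffunE.
Qed.

Variables (N : nat).
Implicit Types F : tup -> 'cV[C]_N.

Lemma tact_pair_lpauli z F x :
  tact (pairop (P (lpauli z))) F x = (lchar z (x i) * lchar z (x j)) *: F x.
Proof.
rewrite /tact (bigD1 x) //= prod_pairop !ent_lpauli !eqxx !mul1r [X in (_ * X) *: _]big1 ?mulr1;
  last by move=> l _; rewrite eqxx.
rewrite big1 ?addr0 // => v vx; rewrite prod_pairop !ent_lpauli.
have [l lx] : exists l, x l != v l.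
  by apply/existsP; apply: contraNT vx => /existsPn H; apply/eqP/ffunP => l;
     apply/esym/eqP; have := H l; rewrite negbK.
have [li|li] := eqVneq l i; first by rewrite -li (negPf lx) !mul0r scale0r.
have [lj|lj] := eqVneq l j; first by rewrite -lj (negPf lx) !mul0r mulr0 mul0r scale0r.
by rewrite (bigD1 l) ?li //= (negPf lx) mul0r mulr0 scale0r.
Qed.

Lemma tact_pair_sign s (Q : op R Y) F x :
  tact (pairop ((-1) ^+ nat_of_bool s *: Q)) F x = tact (pairop Q) F x.
Proof.
apply: eq_bigr => v _; rewrite !prod_pairop !ent_scale mulrACA.
by case: s; rewrite ?expr0 ?expr1 ?mulrNN !mul1r.
Qed.

(** [pauli1_swap] applied qubit by qubit: the sum of P ⊗ P is a multiple of the swap of positions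
    [i] and [j]. *)
Lemma tact_pair_swap F x :
  \sum_p tact (pairop (P p)) F x = 2 ^+ (h + h) *: F (tcomp x (tperm i j)).
Proof.
rewrite /tact exchange_big /= (bigD1 (tcomp x (tperm i j))) //=.
have E (v : tup) : \sum_(p : PI) (\prod_l ent (pairop (P p) l) (x l) (v l)) *: F v =
    (2 ^+ (h + h) * ((x i == v j) && (x j == v i))%:R *
     \prod_(l | (l != i) && (l != j)) (x l == v l)%:R) *: F v.
  rewrite -scaler_suml; congr (_ *: _).
  under [LHS]eq_bigr do rewrite prod_pairop !ent_mkop -big_split /=.
  rewrite -mulr_suml; congr (_ * _).
  rewrite -(bigA_distr_bigA (fun q p => pauli1 R p (x i q) (v i q) * pauli1 R p (x j q) (v j q))).
  under eq_bigr do rewrite pauli1_swap.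
  rewrite big_split /= prodr_const card_ord; congr (_ * _).
  case: (x i =P v j) => [->|/eqP xi] /=.
    case: (x j =P v i) => [->|/eqP xj] /=; first by rewrite big1 // => q _; rewrite !eqxx.
    have [q qx] : exists q, x j q != v i q.
      by apply/existsP; apply: contraNT xj => /existsPn H; apply/eqP/ffunP => l;
        apply/eqP; have := H l; rewrite negbK.
    by rewrite (bigD1 q) //= (negPf qx) andbF mul0r.
  have [q qx] : exists q, x i q != v j q.
    by apply/existsP; apply: contraNT xi => /existsPn H; apply/eqP/ffunP => l;
      apply/eqP; have := H l; rewrite negbK.
  by rewrite (bigD1 q) //= (negPf qx) mul0r.
rewrite E !ffunE tpermL tpermR !eqxx mulr1 big1 ?mulr1; last first.
  by move=> l /andP[li lj]; rewrite ffunE tpermD 1?eq_sym // eqxx.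
rewrite big1 ?addr0 // => v vx; rewrite E.
have [l lx] : exists l, x (tperm i j l) != v l.
  by apply/existsP; apply: contraNT vx => /existsPn H; apply/eqP/ffunP => l;
    rewrite ffunE; apply/esym/eqP; have := H l; rewrite negbK.
move: lx; case: tpermP => [->|->|li lj] lx.
- by rewrite (negPf lx) andbF mulr0 mul0r scale0r.
- by rewrite (negPf lx) mulr0 mul0r scale0r.
by rewrite (bigD1 l) /= ?(negPf lx) ?mul0r ?mulr0 ?scale0r //; apply/andP; split; apply/eqP.
Qed.

Definition fnorm F : C := \sum_x hform 1%:M (F x) (F x).
Definition pcorr F (Q : op R Y) : C := \sum_x hform 1%:M (F x) (tact (pairop Q) F x).

Lemma fnorm_ge0 F : 0 <= fnorm F.
Proof. by apply: sumr_ge0 => x _; exact: hform1_ge0. Qed.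

(** By [tact_pair_swap] the sum is [2 ^ (h + h)] times the overlap of [F] with its swapped copy [G];
    expanding the nonnegative norm of [F - G] bounds this overlap by [fnorm F]. *)
Lemma pcorr_sum_le F : \sum_p pcorr F (P p) <= 2 ^+ (h + h) * fnorm F.
Proof.
rewrite /pcorr exchange_big /=.
under eq_bigr do rewrite -hform_sumr tact_pair_swap hformZr.
rewrite -mulr_sumr ler_pM2l ?exprn_gt0 ?ltr0n //.
pose G x := F (tcomp x (tperm i j)).
have sb : bijective (fun x : tup => tcomp x (tperm i j)).
  by apply: tcomp_bij; exists (tperm i j) => l; rewrite tpermK.
have GG : \sum_x hform 1%:M (G x) (G x) = fnorm F.
  by rewrite /fnorm [RHS](reindex _ (onW_bij _ sb)).
have GF : \sum_x hform 1%:M (G x) (F x) = \sum_x hform 1%:M (F x) (G x).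
  rewrite [RHS](reindex _ (onW_bij _ sb)); apply: eq_bigr => x _; congr hform.
  by rewrite /G; congr F; apply/ffunP => l; rewrite !ffunE tpermK.
have : 0 <= \sum_x hform 1%:M (F x - G x) (F x - G x).
  by apply: sumr_ge0 => x _; exact: hform1_ge0.
under eq_bigr do rewrite hformDl !hformDr !hformNl !hformNr opprK.
rewrite !big_split /= !sumrN GF GG -/(fnorm F).
have -> : fnorm F - \sum_x hform 1%:M (F x) (G x) + (- \sum_x hform 1%:M (F x) (G x) + fnorm F)
  = 2 * (fnorm F - \sum_x hform 1%:M (F x) (G x)) by ring.
by rewrite pmulr_rge0 ?ltr0n // subr_ge0.
Qed.

Lemma pcorr_id F : pcorr F 1%:M = fnorm F.
Proof.
apply: eq_bigr => x _; congr hform; rewrite -[RHS]tact1; apply: tact_eq => // l.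
by rewrite /pairop; case: ifP.
Qed.

(** Character orthogonality writes the collision indicator as the average over [z] of [lpauli z]
    acting at both [i] and [j]. After pull-back through [M], the unitaries at all other positions
    cancel. *)
Lemma collision_pcorr (M : J -> op R Y) F :
  (forall l, unitary (M l)) -> M i = M j ->
  \sum_(x : tup | left_half (x i) == left_half (x j)) hform 1%:M (tact M F x) (tact M F x) =
  2 ^- h * \sum_z pcorr F (adjm (M i) *m P (lpauli z) *m M i).
Proof.
move=> uM Mij; pose T := tact M F.
transitivity (2 ^- h * \sum_z pcorr T (P (lpauli z))); last first.
  congr (_ * _); apply: eq_bigr => z _.
  rewrite /pcorr -[RHS](tact_form 1%:M F _ uM); apply: eq_bigr => x _; congr hform.
  rewrite !tact_comp; apply: tact_eq => // l; rewrite /pairop.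
  have [->|li] /= := eqVneq l i; first by rewrite !mulmxA unitary_mulr // mul1mx.
  have [->|lj] /= := eqVneq l j; first by rewrite Mij !mulmxA unitary_mulr // mul1mx.
  by rewrite mulmx1 mul1mx.
rewrite /pcorr exchange_big /= mulr_sumr big_mkcond; apply: eq_bigr => x _.
under eq_bigr do rewrite tact_pair_lpauli hformZr.
rewrite -mulr_suml sum_sign_chars mulrA mulrA mulVf ?mul1r ?expf_neq0 ?pnatr_eq0 //.
by case: eqP; rewrite ?mul1r ?mul0r.
Qed.

Lemma lpauli_eq0 z : (lpauli z == pauli0 _) = (z == [ffun=> false]).
Proof.
apply/eqP/eqP => [/ffunP E|->].
  by apply/ffunP => q; have := E (lshift h q); rewrite /lpauli /zpauli ffunE join_lshift !ffunE; case: (z q).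
apply/ffunP => q; rewrite !ffunE; case: (fintype.split q) => k; by rewrite ffunE.
Qed.

(** In [collision_pcorr], the term [z = 0] contributes the full norm. For [z != 0] and [d = 2 ^ h],
    mixing over [d^4 - 1] Paulis together with [pcorr_sum_le] gives a mean of at most
    [(d^2 - 1) / (d^4 - 1) = 1 / (d^2 + 1)], hence at most [1 / d]. The [d] terms, weighted by
    [1 / d], add up to at most [2 / d]. *)
Lemma clifford_collision (M : clifford R (h + h) -> J -> op R Y) F :
  (forall c l, unitary (M c l)) -> (forall c, M c i = val c) -> (forall c, M c j = val c) ->
  \sum_(c : clifford R (h + h)) \sum_(x : tup | left_half (x i) == left_half (x j))
     hform 1%:M (tact (M c) F x) (tact (M c) F x) <=
  #|{: clifford R (h + h)}|%:R * (2 / 2 ^+ h) * fnorm F.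
Proof.
move=> uM Mi Mj.
under eq_bigr => c _ do rewrite collision_pcorr // ?Mi ?Mj //.
rewrite -mulr_sumr exchange_big /=.
set K := (#|_|%:R : C); set S := fnorm F.
have S0 : 0 <= S := fnorm_ge0 F.
have K0 : 0 <= K by rewrite ler0n.
have zero z : z = [ffun=> false] ->
    \sum_(c : clifford R (h + h)) pcorr F (adjm (val c) *m P (lpauli z) *m val c) = K * S.
  move=> z0; have -> : lpauli z = pauli0 _ by apply/eqP; rewrite lpauli_eq0 z0.
  rewrite pauli0E; under eq_bigr => c _ do
    rewrite mulmx1 (clifford_unitary c) pcorr_id.
  by rewrite sumr_const mulr_natl.
have nonzero z : z != [ffun=> false] ->
    \sum_(c : clifford R (h + h)) pcorr F (adjm (val c) *m P (lpauli z) *m val c) <= K * S / 2 ^+ h.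
  move=> z0; have z0' : lpauli z != pauli0 _ by rewrite lpauli_eq0.
  have /choice[im imP] (c : clifford R (h + h)) := clifford_maps_ex c (lpauli z).
  have -> : \sum_(c : clifford R (h + h)) pcorr F (adjm (val c) *m P (lpauli z) *m val c) =
            \sum_(c : clifford R (h + h)) pcorr F (P (im c)).
    apply: eq_bigr => c _; have /existsP[s /eqP ->] := imP c.
    by apply: eq_bigr => x _; rewrite tact_pair_sign.
  have mix := clifford_pauli_mixing (fun p => pcorr F (P p)) z0' imP.
  set X := \sum_(c : clifford R (h + h)) _ in mix *.
  (* A nonzero [z] forces at least one qubit, so the factor [d * d - 1] can be cancelled below. *)
  have h0 : (0 < h)%N.
    by case: (posnP h) z0 => // h0; case/eqP; apply/ffunP => -[q qh]; exfalso;
       move: qh; rewrite h0.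
  pose d : C := 2 ^+ h.
  have d1 : 1 < d by rewrite exprn_egt1 ?ltr1n // -lt0n.
  have d0 : 0 < d := lt_trans ltr01 d1.
  have dd1 : 1 < d * d by rewrite mulr_egt1 // ltW.
  have cardPI : #|PI|%:R = (d * d) * (d * d) :> C.
    rewrite card_ffun !card_ord /d -!exprD natrX -[4%:R]/((2 * 2)%:R) natrM -expr2 -exprM.
    by congr (_ ^+ _); lia.
  have le1 : \sum_(p | p != pauli0 (h + h)) pcorr F (P p) <= (d * d - 1) * S.
    have := pcorr_sum_le F; rewrite (bigD1 (pauli0 _)) //= pauli0E pcorr_id exprD -/d -/S.
    by rewrite mulrBl mul1r lerBrDl.
  have le2 : (d * d - 1) * ((d * d + 1) * X) <= (d * d - 1) * (K * S).
    have -> : (d * d - 1) * ((d * d + 1) * X) = (#|PI|%:R - 1) * X by rewrite cardPI; ring.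
    by rewrite mix [leRHS]mulrCA -/K ler_wpM2l.
  rewrite ler_pM2l ?subr_gt0 // in le2.
  have dd0 : 0 < d * d + 1 by rewrite addr_gt0 // mulr_gt0.
  rewrite mulrC -ler_pdivlMr // in le2; apply: le_trans le2 _.
  apply: ler_wpM2l; first exact: mulr_ge0.
  rewrite lef_pV2 ?posrE // (le_trans (ler_peMr (ltW d0) (ltW d1))) // lerDl //.
rewrite (bigD1 [ffun=> false]) //= zero //.
have card1 : \sum_(z : bits h | z != [ffun=> false]) (1 : C) = 2 ^+ h - 1.
  by rewrite sum1_neq card_ffun card_bool card_ord natrX.
apply: (@le_trans _ _ (2 ^- h * (K * S + \sum_(z : bits h | z != [ffun=> false]) (1 * (K * S / 2 ^+ h))))).
  rewrite ler_pM2l ?invr_gt0 ?exprn_gt0 ?ltr0n // lerD2l.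
  by apply: ler_sum => z /nonzero; rewrite mul1r.
rewrite -mulr_suml card1.
have d0 : 0 < 2 ^+ h :> C by rewrite exprn_gt0 ?ltr0n.
have -> : K * (2 / 2 ^+ h) * S = 2 ^- h * (K * S + 2 ^+ h * (K * S / 2 ^+ h)).
  by field; rewrite gt_eqF.
rewrite ler_pM2l ?invr_gt0 // lerD2l ler_wpM2r //.
  by rewrite !mulr_ge0 ?invr_ge0 // ltW.
by rewrite lerBlDr lerDl ler01.
Qed.

End Pair.
End Collision.

(** * Averaging over the gates *)

Section GateMoments.
Variable R : realType.
Local Notation C := (R[i]).
Variable k : nat.

Lemma prod_bool (T : finType) (b : pred T) :
  \prod_i (b i)%:R = ([forall i, b i])%:R :> C.
Proof.
have [bT|] := boolP [forall i, b i].
  by rewrite big1 // => i _; rewrite (forallP bT).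
by case/forallPn => i bi; rewrite (bigD1 i) //= (negPf bi) mul0r.
Qed.

(** Values of a uniform function at distinct points are independent and uniform; the sum factors
    over the points of [D]. *)
Lemma sum_prescribed_in (I D B : finType) (b : pred I) (p : I -> D) (q : I -> B) :
  {in b &, injective p} ->
  (\sum_(h : {ffun D -> B}) \prod_(i | b i) (h (p i) == q i)%:R) * #|B|%:R ^+ #|b| =
  #|{ffun D -> B}|%:R :> C.
Proof.
move=> p_inj; pose G d v : C := \prod_(i | b i && (p i == d)) (v == q i)%:R.
have GE (h : {ffun D -> B}) : \prod_(i | b i) (h (p i) == q i)%:R = \prod_d G d (h d).
  rewrite (partition_big p predT) //=; apply: eq_bigr => d _.
  by apply: eq_bigr => i /andP[_ /eqP ->].
under eq_bigr do rewrite GE.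
rewrite -(bigA_distr_bigA G).
have -> : #|B|%:R ^+ #|b| = \prod_d \prod_(i | b i && (p i == d)) (#|B|%:R : C).
  by rewrite -prodr_const (partition_big p predT).
rewrite -big_split /= card_ffun natrX -prodr_const; apply: eq_bigr => d _; rewrite /G.
have [/existsP[i /andP[bi /eqP pid]]|nd] := boolP [exists i, b i && (p i == d)].
  have pE : (fun j => b j && (p j == d)) =1 pred1 i.
    move=> j /=; apply/andP/eqP => [[bj /eqP pj]|->]; last by rewrite pid.
    by apply: p_inj => //; rewrite pid.
  under eq_bigr do rewrite (eq_bigl _ _ pE) big_pred1_eq.
  rewrite (eq_bigl _ _ pE) big_pred1_eq (bigD1 (q i)) //= eqxx big1 ?addr0 ?mul1r //.
  by move=> v vq; rewrite (negPf vq).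
have pE : (fun j => b j && (p j == d)) =1 pred0.
  by move=> j; apply: contraNF nd => pj; apply/existsP; exists j.
under eq_bigr do rewrite (eq_bigl _ _ pE) big_pred0_eq.
by rewrite (eq_bigl _ _ pE) big_pred0_eq mulr1 sumr_const.
Qed.

Lemma sum_prescribed (D B : finType) (p : 'I_k -> D) (q : 'I_k -> B) : injective p ->
  (\sum_(h : {ffun D -> B}) ([forall i, h (p i) == q i])%:R) * #|B|%:R ^+ k =
  #|{ffun D -> B}|%:R :> C.
Proof.
move=> p_inj; rewrite -(@sum_prescribed_in _ D B predT p q); last by move=> i j _ _; exact: p_inj.
by rewrite card_ord; congr (_ * _); apply: eq_bigr => f _; rewrite prod_bool.
Qed.

(* The two layers draw their parameters from separate families; jointly, the
   parameters actually used are uniform on the family indexed by the gates. *)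
Lemma sum_gate_params (D D1 T : finType) (e : D -> D1) (b : pred D)
    (F : {ffun D -> T} -> C) : injective e ->
  #|T|%:R ^+ #|D| *
  (\sum_(t : {ffun D1 -> T} * {ffun D1 -> T})
     F [ffun c => if b c then t.1 (e c) else t.2 (e c)]) =
  #|{ffun D1 -> T}|%:R * #|{ffun D1 -> T}|%:R * \sum_s F s.
Proof.
move=> e_inj.
pose st (t : {ffun D1 -> T} * {ffun D1 -> T}) : {ffun D -> T} :=
  [ffun c => if b c then t.1 (e c) else t.2 (e c)].
have -> : \sum_t F (st t) = \sum_s F s * \sum_t (st t == s)%:R.
  under [RHS]eq_bigr do rewrite mulr_sumr.
  rewrite exchange_big; apply: eq_bigr => t _ /=.
  rewrite (bigD1 (st t)) //= eqxx mulr1 big1 ?addr0 // => s.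
  by rewrite eq_sym => /negPf ->; rewrite mulr0.
rewrite !mulr_sumr; apply: eq_bigr => s _; rewrite mulrCA [RHS]mulrC; congr (_ * _).
have -> : \sum_t (st t == s)%:R =
    (\sum_(f : {ffun D1 -> T}) \prod_(c | b c) (f (e c) == s c)%:R) *
    (\sum_(f : {ffun D1 -> T}) \prod_(c | ~~ b c) (f (e c) == s c)%:R) :> C.
  rewrite mulr_suml; under [RHS]eq_bigr do rewrite mulr_sumr.
  rewrite pair_bigA /=; apply: eq_bigr => t _.
  transitivity (\prod_c (st t c == s c)%:R : C).
    rewrite prod_bool; congr (nat_of_bool _)%:R.
    by apply/eqP/forallP => [-> //|h]; apply/ffunP => c; apply/eqP.
  rewrite (bigID b) /=; congr (_ * _); apply: eq_bigr => c bc; rewrite ffunE ?bc //.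
  by rewrite (negPf bc).
have cD : #|D| = (#|b| + #|[pred c | ~~ b c]|)%N by rewrite -(cardC b).
rewrite cD exprD mulrC mulrACA.
rewrite sum_prescribed_in; last by move=> i j _ _; exact: e_inj.
by rewrite (@sum_prescribed_in _ _ _ [pred c | ~~ b c]) // => i j _ _; exact: e_inj.
Qed.

Lemma avg_gate_params (D D1 A B : finType) (e : D -> D1) (b : pred D)
    (F : {ffun D -> A * B} -> C) : injective e -> (0 < #|A|)%N -> (0 < #|B|)%N ->
  #|{: {ffun D1 -> A * B} * {ffun D1 -> A * B}}|%:R^-1 *
  (\sum_(t : {ffun D1 -> A * B} * {ffun D1 -> A * B})
     F [ffun c => if b c then t.1 (e c) else t.2 (e c)]) =
  (#|{ffun D -> A}|%:R * #|{ffun D -> B}|%:R)^-1 *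
  \sum_(w : {ffun D -> A}) \sum_(v : {ffun D -> B}) F [ffun c => (w c, v c)].
Proof.
move=> e_inj A0 B0; have law := sum_gate_params b F e_inj.
have -> : \sum_(w : {ffun D -> A}) \sum_(v : {ffun D -> B}) F [ffun c => (w c, v c)] = \sum_s F s.
  rewrite pair_bigA /= [RHS](reindex (fun wv : {ffun D -> A} * {ffun D -> B} =>
    [ffun c => (wv.1 c, wv.2 c)])) //=.
  exists (fun s => ([ffun c => (s c).1], [ffun c => (s c).2])) => [[w v] _|s _] /=.
    by congr (_, _); apply/ffunP => c; rewrite !ffunE.
  by apply/ffunP => c; rewrite !ffunE -surjective_pairing.
have nAB : #|{: A * B}|%:R ^+ #|D| = #|{ffun D -> A}|%:R * #|{ffun D -> B}|%:R :> C.
  by rewrite card_prod !card_ffun -!natrX -natrM expnMn.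
rewrite nAB in law; rewrite card_prod natrM.
have nz (T T' : finType) : (0 < #|T|)%N -> #|{ffun T' -> T}|%:R != 0 :> C.
  by move=> T0; rewrite pnatr_eq0 -lt0n card_ffun expn_gt0 T0.
have AB0 : (0 < #|{: A * B}|)%N by rewrite card_prod muln_gt0 A0.
apply: (mulfI (mulf_neq0 (nz _ D A0) (nz _ D B0))).
rewrite [in RHS]mulVKf ?mulf_neq0 ?nz // mulrCA law mulKf //.
by rewrite mulf_neq0 // nz.
Qed.

Lemma sum_triple (A B D : finType) (F : A * B * D -> C) :
  \sum_w F w = \sum_a \sum_b \sum_d F (a, b, d).
Proof.
by rewrite pair_bigA /= pair_bigA /=; apply: eq_bigr => -[[a b] d].
Qed.

Definition is_perm_of (T : finType) (x x' : 'I_k -> T) (g : 'S_k) : bool :=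
  [forall i, x' i == x (g i)].

Lemma is_perm_of_unique (T : finType) (x x' : 'I_k -> T) g g' :
  injective x -> is_perm_of x x' g -> is_perm_of x x' g' -> g = g'.
Proof.
move=> x_inj /forallP xg /forallP xg'; apply/permP => i; apply: x_inj.
by rewrite -(eqP (xg i)) (eqP (xg' i)).
Qed.

Lemma sum_is_perm_of (T : finType) (x x' : 'I_k -> T) g : injective x ->
  is_perm_of x x' g -> \sum_(g' : 'S_k) (is_perm_of x x' g')%:R = 1 :> C.
Proof.
move=> x_inj xg; rewrite (bigD1 g) //= xg big1 ?addr0 // => g' g'g.
case: (boolP (is_perm_of _ _ _)) => // xg'.
by rewrite (is_perm_of_unique x_inj xg' xg) eqxx in g'g.
Qed.

Lemma perm_of_subset (T : finType) (x x' : 'I_k -> T) : injective x ->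
  (forall i, exists j, x' j = x i) -> exists g, is_perm_of x x' g.
Proof.
move=> x_inj /choice[t tP].
have t_inj : injective t by move=> i j tij; apply: x_inj; rewrite -!tP tij.
exists ((perm t_inj)^-1)%g; apply/forallP => i.
by rewrite -tP -{1}(permKV (perm t_inj) i) permE.
Qed.

(** If [x'] is not a permutation of [x], some [x i0] does not occur in [x']. It occurs exactly once
    in [x], so flipping [f] at this point negates every term and the sum vanishes. *)
Lemma sum_random_signs (T : finType) (x x' : 'I_k -> T) : injective x ->
  \sum_(f : {ffun T -> bool}) \prod_i ((-1) ^+ f (x i) * (-1) ^+ f (x' i)) =
  #|{ffun T -> bool}|%:R * \sum_(g : 'S_k) (is_perm_of x x' g)%:R :> C.
Proof.
move=> x_inj.
have [/existsP[g xg]|ng] := boolP [exists g, is_perm_of x x' g].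
  rewrite (sum_is_perm_of x_inj xg) mulr1 -[RHS]sumr_const; apply: eq_bigr => f _.
  rewrite big_split /= [X in _ * X](_ : _ = \prod_i (-1) ^+ f (x i)); last first.
    rewrite [RHS](reindex g) /=; last by apply: onW_bij; exists (g^-1)%g => i; rewrite ?permK ?permKV.
    by apply: eq_bigr => i _; rewrite (eqP (forallP xg i)).
  by rewrite -big_split big1 //= => i _; case: (f _); rewrite ?expr0 ?expr1 ?mulrNN mulr1.
rewrite [X in _ * X]big1 ?mulr0; last first.
  move=> g _; have /existsPn/(_ g) := ng; by move/negPf => ->.
have [i0 /forallP xi0] : exists i, [forall j, x' j != x i].
  apply/existsP; apply: contraNT ng => /existsPn H; apply/existsP.
  apply: perm_of_subset => // i; have := H i; rewrite negb_forall => /existsP[j].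
  by rewrite negbK => /eqP; exists j.
pose tog (f : {ffun T -> bool}) : {ffun T -> bool} := [ffun v => f v (+) (v == x i0)].
have togK : involutive tog.
  by move=> f; apply/ffunP => v; rewrite !ffunE -addbA addbb addbF.
set S := LHS; have : S = - S.
  rewrite {1}/S (reindex_inj (inv_inj togK)) /S -sumrN; apply: eq_bigr => f _.
  rewrite (bigD1 i0) //= [in RHS](bigD1 i0) //= !ffunE eqxx (negPf (xi0 _)) addbT addbF.
  rewrite signrN !mulNr; congr (- (_ * _)); apply: eq_bigr => i ii0.
  by rewrite !ffunE (inj_eq x_inj) (negPf ii0) (negPf (xi0 _)) !addbF.
by move/eqP; rewrite -subr_eq0 opprK -mulr2n mulrn_eq0 => /eqP.
Qed.

Section Gate.
Variable h : nat.
Local Notation Y := (bits (h + h)).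

Definition wparam :=
  ({ffun bits h -> bits h} * {ffun bits h -> bits h} * {ffun Y -> bool})%type.

Definition wop (w : wparam) : op R Y :=
  let: (hL, hR, f) := w in SL R hL *m SR R hR *m phaseop R f.

Definition feistel (hL hR : {ffun bits h -> bits h}) (x : Y) : Y :=
  let r := bxor (right_half x) (hR (left_half x)) in
  join (bxor (left_half x) (hL r)) r.

Lemma ent_wop hL hR f y x :
  ent (wop (hL, hR, f)) y x = (y == feistel hL hR x)%:R * (-1) ^+ f x.
Proof.
rewrite /wop ent_mul (bigD1 x) //= ent_mkop eqxx mul1r big1 ?addr0; last first.
  by move=> z zx; rewrite ent_mkop (negPf zx) mul0r mulr0.
congr (_ * _); rewrite ent_mul.
set r := join (left_half x) (bxor (right_half x) (hR (left_half x))).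
rewrite (bigD1 r) //= !ent_mkop eqxx mulr1 big1 ?addr0; last first.
  by move=> z zx; rewrite !ent_mkop (negPf zx) mulr0.
by rewrite /r left_join right_join.
Qed.

Lemma bxorK (a b : bits h) : bxor a (bxor a b) = b.
Proof. by apply/ffunP => q; rewrite !ffunE addbA addbb addFb. Qed.

(** An input-output pair prescribes one value of each round function: [hR] at the left input half,
    [hL] at the right output half. Distinctness of these halves is what makes several prescriptions
    independent. *)
Lemma feistel_eq hL hR x y : (y == feistel hL hR x) =
  (hR (left_half x) == bxor (right_half x) (right_half y)) &&
  (hL (right_half y) == bxor (left_half x) (left_half y)).
Proof.
rewrite /feistel; apply/eqP/andP => [->|[/eqP rE /eqP lE]].
  by rewrite left_join right_join !bxorK.
by rewrite rE bxorK lE bxorK join_halves.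
Qed.

Lemma wop_real w y x : (ent (wop w) y x)^* = ent (wop w) y x.
Proof.
case: w => -[hL hR] f; rewrite ent_wop rmorphM rmorph_nat rmorphXn rmorphN rmorph1 //.
Qed.

Lemma card_bits_h n : #|bits n|%:R = 2 ^+ n :> C.
Proof. by rewrite card_ffun card_bool card_ord natrX. Qed.

(** The signs force [x'] to be a permutation of [x]; the Feistel map then makes [y'] the same
    permutation of [y], so the second set of constraints repeats the first, whose probability is
    [#|Y| ^- k] by [feistel_eq]. *)
Lemma wop_moments (x y x' y' : 'I_k -> Y) :
  injective (@left_half h \o x) -> injective (@right_half h \o y) ->
  (\sum_w \prod_i (ent (wop w) (y i) (x i) * ent (wop w) (y' i) (x' i))) *
    #|Y|%:R ^+ k =
  #|{: wparam}|%:R * \sum_(g : 'S_k) (is_perm_of x x' g && is_perm_of y y' g)%:R.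
Proof.
move=> xL yR; have x_inj : injective x by move=> i j xij; apply: xL; rewrite /= xij.
pose hit hL hR := [forall i, y i == feistel hL hR (x i)].
transitivity (#|{ffun Y -> bool}|%:R *
    (\sum_hL \sum_hR (hit hL hR)%:R) * #|Y|%:R ^+ k *
    \sum_(g : 'S_k) (is_perm_of x x' g && is_perm_of y y' g)%:R : C).
  rewrite mulrAC; congr (_ * _).
  rewrite (eq_bigr (fun w : wparam => let: (hL, hR, f) := w in
     ([forall i, y i == feistel hL hR (x i)] && [forall i, y' i == feistel hL hR (x' i)])%:R *
     \prod_i ((-1) ^+ f (x i) * (-1) ^+ f (x' i)) : C)); last first.
    move=> [[hL hR] f] _; under eq_bigr do rewrite !ent_wop mulrACA.
    rewrite big_split /=; congr (_ * _).
    have [/andP[/forallP A /forallP B]|] := boolP (_ && _).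
      by rewrite big1 // => i _; rewrite A B mulr1.
    rewrite negb_and => /orP[]/forallPn[i hi]; rewrite (bigD1 i) //= (negPf hi);
      by rewrite ?mul0r ?mulr0 ?mul0r.
  rewrite sum_triple -mulrA mulrCA mulr_suml.
  apply: eq_bigr => hL _; rewrite mulr_suml; apply: eq_bigr => hR _.
  rewrite -mulr_sumr sum_random_signs // -/(hit hL hR).
  suff E : (hit hL hR && [forall i, y' i == feistel hL hR (x' i)])%:R *
      (\sum_g (is_perm_of x x' g)%:R) =
      (hit hL hR)%:R * \sum_g (is_perm_of x x' g && is_perm_of y y' g)%:R :> C.
    by rewrite mulrCA -E; apply: mulrCA.
  rewrite !mulr_sumr; apply: eq_bigr => g _; rewrite -!natrM !mulnb; congr (nat_of_bool _)%:R.
  case: (boolP (hit hL hR)) => //= /forallP hit_xy.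
  case: (boolP (is_perm_of x x' g)) => [/forallP xg|]; last by rewrite andbF.
  rewrite andbT; apply: eq_forallb => i.
  by rewrite (eqP (xg i)) -(eqP (hit_xy (g i))).
congr (_ * _); rewrite -mulrA; transitivity
    (#|{ffun Y -> bool}|%:R * (#|{ffun bits h -> bits h}|%:R * #|{ffun bits h -> bits h}|%:R) : C).
  congr (_ * _).
  have -> : \sum_hL \sum_hR (hit hL hR)%:R =
      (\sum_(hL : {ffun bits h -> bits h})
         ([forall i, hL ((@right_half h \o y) i) == bxor (left_half (x i)) (left_half (y i))])%:R) *
      (\sum_(hR : {ffun bits h -> bits h})
         ([forall i, hR ((@left_half h \o x) i) == bxor (right_half (x i)) (right_half (y i))])%:R) :> C.
    rewrite mulr_suml; apply: eq_bigr => hL _; rewrite mulr_sumr; apply: eq_bigr => hR _.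
    rewrite -natrM mulnb; congr (nat_of_bool _)%:R; rewrite /hit.
    apply/forallP/andP => [H|[/forallP A /forallP B] i].
      by split; apply/forallP => i; have := H i; rewrite feistel_eq => /andP[].
    by rewrite feistel_eq B A.
  rewrite card_bits_h exprD exprMn -!card_bits_h mulrACA.
  by rewrite !sum_prescribed.
by rewrite -!natrM; congr (_%:R); rewrite !card_prod mulnC.
Qed.

End Gate.
End GateMoments.

(** Resampling one coordinate preserves the uniform distribution; the proof exchanges the old value
    and the new one. Later used to isolate the Clifford of a gate, the input of a query, or one
    coordinate of a tuple. *)
Lemma big_upd (Vt : zmodType) (D T : finType) (a : D) (F : {ffun D -> T} -> Vt) :
  \sum_(c : {ffun D -> T}) \sum_(d : T) F [ffun b => if b == a then d else c b] =
  (\sum_c F c) *+ #|T|.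
Proof.
pose phi (cd : {ffun D -> T} * T) : {ffun D -> T} * T :=
  ([ffun b => if b == a then cd.2 else cd.1 b], cd.1 a).
have phiK : involutive phi.
  case=> c d; rewrite /phi /= ffunE eqxx; congr (_, _).
  by apply/ffunP => b; rewrite !ffunE; case: eqP => [->|].
rewrite pair_bigA /= (reindex_inj (inv_inj phiK)) /=.
rewrite (eq_bigr (fun cd => F cd.1)) => [|[c d] _ /=]; last first.
  congr F; apply/ffunP => b; rewrite !ffunE; case: eqP => // ->; by rewrite ?eqxx.
rewrite -(pair_bigA _ (fun c _ => F c)) /= -sumrMnl; apply: eq_bigr => c _.
by rewrite sumr_const.
Qed.

Lemma sum_fst (Vt : zmodType) (S T : finType) (I : pred S) (F : S * T -> Vt) :
  \sum_(q | I q.1) F q = \sum_(y | I y) \sum_x F (y, x).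
Proof.
rewrite pair_big_dep /=; apply: eq_big => [[y x]|[y x] _] //=.
by rewrite andbT.
Qed.

(** * Second moments of a family of gates with arbitrary amplitudes *)

Section GateLemma.
Variable R : realType.
Local Notation C := (R[i]).
Variables (G : finType) (k h N : nat).
Local Notation Y := (bits (h + h)).
Local Notation J := (G * 'I_k)%type.
Local Notation tup := {ffun J -> Y}.
Local Notation gperm := {ffun G -> 'S_k}.

Definition gate_act (g : gperm) (j : J) : J := (j.1, g j.1 j.2).
Definition tperm_act (x : tup) (g : gperm) : tup := tcomp x (gate_act g).

Definition gmul (g g' : gperm) : gperm := [ffun a => (g a * g' a)%g].
Definition ginv (g : gperm) : gperm := [ffun a => (g a)^-1%g].

Lemma gate_actK g : cancel (gate_act g) (gate_act (ginv g)).
Proof. by case=> a i; rewrite /gate_act /= ffunE permK. Qed.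

Lemma gate_actKV g : cancel (gate_act (ginv g)) (gate_act g).
Proof. by case=> a i; rewrite /gate_act /= ffunE permKV. Qed.

Lemma gate_act_bij g : bijective (gate_act g).
Proof. by exists (gate_act (ginv g)); [exact: gate_actK | exact: gate_actKV]. Qed.

Lemma tperm_actM x g g' : tperm_act (tperm_act x g) g' = tperm_act x (gmul g' g).
Proof. by apply/ffunP => -[a i]; rewrite !ffunE /gate_act /= ffunE permM. Qed.

Lemma tperm_actK g : cancel (tperm_act^~ g) (tperm_act^~ (ginv g)).
Proof.
by move=> x; apply/ffunP => -[a i]; rewrite !ffunE /gate_act /= ffunE permKV.
Qed.

Lemma tperm_actKV g : cancel (tperm_act^~ (ginv g)) (tperm_act^~ g).
Proof.
by move=> x; apply/ffunP => -[a i]; rewrite !ffunE /gate_act /= ffunE permK.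
Qed.

Lemma gmul_bij g : bijective (fun g' => gmul g' g).
Proof.
by exists (fun g' => gmul g' (ginv g)) => g'; apply/ffunP => a; rewrite !ffunE ?mulgK ?mulgKV.
Qed.

Definition lcoll (x : tup) (e : G * 'I_k * 'I_k) : bool :=
  left_half (x (e.1.1, e.1.2)) == left_half (x (e.1.1, e.2)).
Definition rcoll (x : tup) (e : G * 'I_k * 'I_k) : bool :=
  right_half (x (e.1.1, e.1.2)) == right_half (x (e.1.1, e.2)).
Definition ldist x := [forall e : G * 'I_k * 'I_k, (e.1.2 != e.2) ==> ~~ lcoll x e].
Definition rdist x := [forall e : G * 'I_k * 'I_k, (e.1.2 != e.2) ==> ~~ rcoll x e].

Lemma ldistP x a : ldist x -> injective (@left_half h \o (fun i => x (a, i))).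
Proof.
move=> /forallP xL i j /= /eqP xij; apply/eqP; apply: contraTT xij => ij.
by have := xL (a, i, j); rewrite ij.
Qed.

Lemma rdistP x a : rdist x -> injective (@right_half h \o (fun i => x (a, i))).
Proof.
move=> /forallP xR i j /= /eqP xij; apply/eqP; apply: contraTT xij => ij.
by have := xR (a, i, j); rewrite ij.
Qed.

Lemma ldist_act x g : ldist (tperm_act x g) = ldist x.
Proof.
have imp y g' : ldist y -> ldist (tperm_act y g').
  move=> /forallP yL; apply/forallP => -[[a i] j]; apply/implyP => /= ij.
  have := yL (a, g' a i, g' a j); rewrite /= (inj_eq perm_inj) ij.
  by rewrite /lcoll /= !ffunE.
by apply/idP/idP => [/(imp _ (ginv g))|/imp //]; rewrite tperm_actK.
Qed.

Lemma rdist_act x g : rdist (tperm_act x g) = rdist x.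
Proof.
have imp y g' : rdist y -> rdist (tperm_act y g').
  move=> /forallP yL; apply/forallP => -[[a i] j]; apply/implyP => /= ij.
  have := yL (a, g' a i, g' a j); rewrite /= (inj_eq perm_inj) ij.
  by rewrite /rcoll /= !ffunE.
by apply/idP/idP => [/(imp _ (ginv g))|/imp //]; rewrite tperm_actK.
Qed.

Local Notation WP := {ffun G -> wparam h}.
Local Notation CP := {ffun G -> clifford R (h + h)}.

Definition wamp (w : WP) (q : tup * tup) : C :=
  \prod_(j : J) ent (wop R (w j.1)) (q.1 j) (q.2 j).

Lemma wamp_real w q : (wamp w q)^* = wamp w q.
Proof. by rewrite rmorph_prod; apply: eq_bigr => j _; exact: wop_real. Qed.

Definition qact (q : tup * tup) (g : gperm) := (tperm_act q.1 g, tperm_act q.2 g).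

Lemma sum_wamp q q' : ldist q.2 -> rdist q.1 ->
  \sum_w wamp w q * wamp w q' =
  #|{: WP}|%:R / #|Y|%:R ^+ (#|G| * k) * \sum_g (q' == qact q g)%:R.
Proof.
case: q q' => y x [y' x'] /= xL yR.
pose f a (v : wparam h) : C :=
  \prod_i (ent (wop R v) (y (a, i)) (x (a, i)) * ent (wop R v) (y' (a, i)) (x' (a, i))).
transitivity (\prod_a \sum_v f a v).
  rewrite bigA_distr_bigA; apply: eq_bigr => w _; rewrite -big_split /=.
  by rewrite /f pair_bigA; apply: eq_bigr => -[a i].
pose p a (s : 'S_k) := is_perm_of (fun i => x (a, i)) (fun i => x' (a, i)) s &&
                       is_perm_of (fun i => y (a, i)) (fun i => y' (a, i)) s.
have Y0 : #|Y|%:R != 0 :> C by rewrite card_bits_h expf_neq0 // pnatr_eq0.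
transitivity (\prod_a (#|{: wparam h}|%:R / #|Y|%:R ^+ k * \sum_s (p a s)%:R) : C).
  apply: eq_bigr => a _; apply: (mulIf (expf_neq0 k Y0)).
  rewrite wop_moments; [|exact: ldistP|exact: rdistP].
  by rewrite mulrAC divfK // expf_neq0.
rewrite big_split /= prodr_const; congr (_ * _).
  by rewrite exprMn exprVn -exprM (mulnC k) [in RHS]card_ffun natrX.
rewrite bigA_distr_bigA; apply: eq_bigr => g _; rewrite prod_bool; congr (nat_of_bool _)%:R.
apply/forallP/eqP => [H|[Ey Ex] a].
  congr (_, _); apply/ffunP => -[a i]; rewrite ffunE /gate_act /=.
    by have /andP[_ /forallP/(_ i)/eqP] := H a.
  by have /andP[/forallP/(_ i)/eqP] := H a.
by apply/andP; split; apply/forallP => i; rewrite ?Ex ?Ey ffunE.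
Qed.

Variable A : tup -> tup -> 'cV[C]_N.

(** Right halves of outputs and left halves of inputs feed [wop_moments]; left halves of outputs
    serve the gluing of neighbouring gates. *)
Definition qgood (q : tup * tup) := [&& ldist q.1, rdist q.1 & ldist q.2].
Definition ydist (y : tup) := ldist y && rdist y.

Lemma qgood_act q g : qgood (qact q g) = qgood q.
Proof. by rewrite /qgood /= !ldist_act rdist_act. Qed.

Lemma ydist_act y g : ydist (tperm_act y g) = ydist y.
Proof. by rewrite /ydist ldist_act rdist_act. Qed.

Section Symmetrize.
Variable B : tup * tup -> 'cV[C]_N.

Definition qsym q := \sum_g B (qact q g).

(** Turns a pairing sum into diagonal values of [hform H], so that nonnegativity and domination
    apply termwise. Of the two permutations in the square only the quotient matters, whence the
    factor [#|gperm|]. *)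
Lemma qsym_form (H : 'M[C]_N) (I : pred (tup * tup)) :
  (forall q g, I (qact q g) = I q) ->
  \sum_(q | I q) hform H (qsym q) (qsym q) =
  (\sum_(q | I q) \sum_g hform H (B (qact q g)) (B q)) *+ #|{: gperm}|.
Proof.
move=> Iact; transitivity (\sum_(g' : gperm) \sum_(q | I q) \sum_g hform H (B (qact q g)) (B q)); last first.
  by rewrite sumr_const.
transitivity (\sum_(g' : gperm) \sum_(q | I q) \sum_g hform H (B (qact q g)) (B (qact q g'))).
  rewrite exchange_big; apply: eq_bigr => q _ /=; rewrite hform_sumr.
  by apply: eq_bigr => g' _; rewrite hform_suml.
apply: eq_bigr => g' _.
have qK : cancel (qact^~ g') (qact^~ (ginv g')).
  by case=> y x; rewrite /qact /= !tperm_actK.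
have qKV : cancel (qact^~ (ginv g')) (qact^~ g').
  by case=> y x; rewrite /qact /= !tperm_actKV.
rewrite (reindex (qact^~ (ginv g'))) /=; last by apply: onW_bij; exists (qact^~ g').
rewrite (eq_bigl I) => [|q]; last exact: Iact.
apply: eq_bigr => q _.
rewrite [LHS](reindex (fun g => gmul g g')) /=; last exact/onW_bij/gmul_bij.
apply: eq_bigr => g _; rewrite qKV; congr hform; congr B.
rewrite /qact /= !tperm_actM; congr (tperm_act _ _, tperm_act _ _);
  by apply/ffunP => a; rewrite !ffunE mulgK.
Qed.

End Symmetrize.

(* The value obtained from the amplitudes [A] if the pairing by permutations
   were exact for every input tuple; it does not change when a fixed unitary
   acts on the inputs of each gate. *)
Definition Kform (H : 'M[C]_N) : C :=
  \sum_(q | ydist q.1) \sum_g hform H (A (qact q g).1 (qact q g).2) (A q.1 q.2).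

Definition cop (c : CP) (j : J) : op R Y := val (c j.1).
Definition Acl (c : CP) (q : tup * tup) := tact (cop c) (A q.1) q.2.

Lemma cop_unitary c j : unitary (cop c j).
Proof. exact: clifford_unitary. Qed.

Lemma Acl_act c q g :
  Acl c (qact q g) = tact (cop c) (fun v => A (tperm_act q.1 g) (tperm_act v g)) q.2.
Proof. by rewrite /Acl /= /tperm_act tact_tcomp //; exact: gate_act_bij. Qed.

(** [ydist] constrains outputs only, so the inputs range over all strings and [tact_form] removes
    the Cliffords. This is why colliding inputs are kept in [Kform]. *)
Lemma Kform_clifford (c : CP) (H : 'M[C]_N) :
  \sum_(q | ydist q.1) \sum_g hform H (Acl c (qact q g)) (Acl c q) = Kform H.
Proof.
rewrite /Kform !sum_fst; apply: eq_bigr => y _.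
rewrite exchange_big [RHS]exchange_big; apply: eq_bigr => g _ /=.
have E := tact_form H (fun v => A (tperm_act y g) (tperm_act v g)) (A y) (cop_unitary c).
by apply: etrans E; apply: eq_bigr => x _; rewrite Acl_act.
Qed.

Definition psi (w : WP) (c : CP) : 'cV[C]_N :=
  \sum_(y : tup) \sum_(x : tup) (\prod_(j : J) ent (wop R (w j.1) *m val (c j.1)) (y j) (x j)) *: A y x.

Lemma psiE w c : psi w c = \sum_q wamp w q *: Acl c q.
Proof.
rewrite /psi -(pair_bigA _ (fun y x => wamp w (y, x) *: Acl c (y, x))) /=.
apply: eq_bigr => y _; rewrite /Acl /tact /=.
under [RHS]eq_bigr do rewrite scaler_sumr.
rewrite exchange_big; apply: eq_bigr => v _ /=.
under [RHS]eq_bigr do rewrite scalerA.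
rewrite -scaler_suml; congr (_ *: _); rewrite /wamp /=.
under [RHS]eq_bigr do rewrite -big_split /=.
rewrite -(bigA_distr_bigA (fun j z => ent (wop R (w j.1)) (y j) z * ent (cop c j) z (v j))).
by apply: eq_bigr => j _; rewrite ent_mul.
Qed.

Definition cst : C := #|{: WP}|%:R / #|Y|%:R ^+ (#|G| * k).

Definition goodsum (H : 'M[C]_N) c : C :=
  \sum_(q | qgood q) \sum_g hform H (Acl c (qact q g)) (Acl c q).
Definition psibad w c : 'cV[C]_N := \sum_(q | ~~ qgood q) wamp w q *: Acl c q.
Definition badsum (H : 'M[C]_N) c : C := \sum_w hform H (psibad w c) (psibad w c).

Lemma qgood_sum q q' : qgood q ->
  \sum_w wamp w q * wamp w q' = cst * \sum_g (q' == qact q g)%:R.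
Proof. by case/and3P => _ qR qL; apply: sum_wamp. Qed.

Lemma qgood_bad q q' : qgood q -> ~~ qgood q' -> \sum_w wamp w q * wamp w q' = 0.
Proof.
move=> qg qb; rewrite qgood_sum // big1 ?mulr0 // => g _.
by case: eqP => // q'E; rewrite q'E qgood_act qg in qb.
Qed.

(* The cross terms vanish because the random signs only pair tuples that differ by a permutation. *)
Lemma sum_psi (H : 'M[C]_N) c :
  \sum_w hform H (psi w c) (psi w c) = cst * goodsum H c + badsum H c.
Proof.
pose g w := \sum_(q | qgood q) wamp w q *: Acl c q.
have cross (I I' : pred (tup * tup)) :
    \sum_w hform H (\sum_(q | I q) wamp w q *: Acl c q) (\sum_(q | I' q) wamp w q *: Acl c q)
    = \sum_(q' | I' q') \sum_(q | I q) (\sum_w wamp w q * wamp w q') * hform H (Acl c q) (Acl c q').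
  under eq_bigr do rewrite hform_sumr.
  rewrite exchange_big; apply: eq_bigr => q' _ /=.
  under eq_bigr do rewrite hform_suml.
  rewrite exchange_big; apply: eq_bigr => q _ /=.
  by rewrite mulr_suml; apply: eq_bigr => w _; rewrite hformZl hformZr wamp_real mulrA.
transitivity (\sum_w hform H (g w) (g w) + \sum_w hform H (psibad w c) (psibad w c)).
  transitivity (\sum_w (hform H (g w) (g w) + hform H (psibad w c) (psibad w c)
     + (hform H (g w) (psibad w c) + hform H (psibad w c) (g w)))).
    apply: eq_bigr => w _; rewrite psiE (bigID qgood) /= -/(g w) -/(psibad w c).
    by rewrite hformDl !hformDr; ring.
  rewrite !big_split /= !cross [X in _ + (X + _)]big1 => [|q' bq']; last first.
    by apply: big1 => q gq; rewrite qgood_bad // mul0r.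
  rewrite [X in _ + (_ + X)]big1 ?addr0 // => q' gq'; apply: big1 => q bq.
  by under eq_bigr do rewrite mulrC; rewrite qgood_bad // mul0r.
congr (_ + _); rewrite cross /goodsum mulr_sumr; apply: eq_bigr => q' gq'.
transitivity (\sum_q (\sum_w wamp w q' * wamp w q) * hform H (Acl c q) (Acl c q')).
  rewrite [RHS](bigID qgood) /= [X in _ + X]big1 ?addr0.
    by apply: eq_bigr => q _; under eq_bigr do rewrite mulrC.
  by move=> q bq; rewrite qgood_bad // mul0r.
under eq_bigr do rewrite qgood_sum // mulr_sumr mulr_suml.
rewrite exchange_big mulr_sumr; apply: eq_bigr => s _ /=.
rewrite (bigD1 (qact q' s)) //= eqxx mulr1 big1 ?addr0 //.
by move=> q qn; rewrite (negPf qn) mulr0 mul0r.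
Qed.

Definition kbad (q : tup * tup) := ydist q.1 && ~~ ldist q.2.
Definition kbadsum (H : 'M[C]_N) c : C :=
  \sum_(q | kbad q) \sum_g hform H (Acl c (qact q g)) (Acl c q).

Lemma Kform_split H c : Kform H = goodsum H c + kbadsum H c.
Proof.
rewrite -(Kform_clifford c) (bigID (fun q => ldist q.2)) /=; congr (_ + _).
by apply: eq_bigl => q; rewrite /qgood /ydist andbA.
Qed.

Local Notation ng := (#|{: gperm}|%:R : C).

Lemma ng_gt0 : 0 < ng.
Proof. by rewrite ltr0n; apply/card_gt0P; exists [ffun=> 1%g]. Qed.

Lemma kbadsum_sym H c :
  ng * kbadsum H c = \sum_(q | kbad q) hform H (qsym (Acl c) q) (qsym (Acl c) q).
Proof.
rewrite qsym_form ?mulr_natl // => q g.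
by rewrite /kbad /= ydist_act ldist_act.
Qed.

Definition Asym y x := \sum_g A (tperm_act y g) (tperm_act x g).

Lemma qsym_Acl c q : qsym (Acl c) q = tact (cop c) (Asym q.1) q.2.
Proof. by rewrite /qsym tact_sum; apply: eq_bigr => g _; rewrite Acl_act. Qed.

Lemma Kform_sym : ng * Kform 1%:M = \sum_(y | ydist y) fnorm (Asym y).
Proof.
have E := @qsym_form (fun q => A q.1 q.2) 1%:M (fun q => ydist q.1) (fun q g => ydist_act q.1 g).
by rewrite mulr_natl -[RHS]/(\sum_(y | ydist y) \sum_x hform 1%:M (Asym y x) (Asym y x));
  rewrite -E sum_fst.
Qed.

Lemma Kform1_ge0 : 0 <= Kform 1%:M.
Proof.
rewrite -(pmulr_rge0 _ ng_gt0) Kform_sym; apply: sumr_ge0 => y _; exact: fnorm_ge0.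
Qed.

Local Notation ncl := (#|{: clifford R (h + h)}|%:R : C).
Local Notation nCP := (#|{: CP}|%:R : C).

Lemma ncl_gt0 : 0 < ncl.
Proof. by rewrite ltr0n; exact: clifford_card_gt0. Qed.

Definition collsum c (e : G * 'I_k * 'I_k) (F : tup -> 'cV[C]_N) : C :=
  \sum_(x | lcoll x e) hform 1%:M (tact (cop c) F x) (tact (cop c) F x).

Lemma collsum_avg (e : G * 'I_k * 'I_k) (F : tup -> 'cV[C]_N) : e.1.2 != e.2 ->
  \sum_(c : CP) collsum c e F <= nCP * (2 / 2 ^+ h * fnorm F).
Proof.
case: e => -[a i] j /= ij; rewrite -(ler_pM2l ncl_gt0).
(* Resampling only the Clifford of gate [a] leaves the sum over all Cliffords unchanged up to a
   factor, and the other gates can be held fixed. *)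
have -> : ncl * (\sum_(c : CP) collsum c (a, i, j) F) =
    \sum_(c : CP) \sum_(d : clifford R (h + h))
       collsum [ffun b => if b == a then d else c b] (a, i, j) F.
  by rewrite (big_upd a (fun c => collsum c (a, i, j) F)) mulr_natl.
have -> : ncl * (nCP * (2 / 2 ^+ h * fnorm F)) =
    \sum_(c : CP) (ncl * (2 / 2 ^+ h) * fnorm F).
  by rewrite sumr_const -[in RHS]mulr_natl; ring.
apply: ler_sum => c _.
have ij' : (a, i) != (a, j) :> J by rewrite xpair_eqE eqxx.
apply: (clifford_collision (M := fun d => cop [ffun b => if b == a then d else c b]) ij').
- by move=> d l; exact: cop_unitary.
- by move=> d; rewrite /cop ffunE eqxx.
- by move=> d; rewrite /cop ffunE eqxx.
Qed.

(** Union bound over ordered pairs of queries of each gate: a tuple failing [ldist] has a colliding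
    pair, and all further terms are squared norms. *)
Lemma kbadsum_le (c : CP) :
  ng * kbadsum 1%:M c <= \sum_(e | e.1.2 != e.2) \sum_(y | ydist y) collsum c e (Asym y).
Proof.
rewrite kbadsum_sym; under eq_bigr do rewrite qsym_Acl.
have -> : \sum_(e : G * 'I_k * 'I_k | e.1.2 != e.2) \sum_(y | ydist y) collsum c e (Asym y) =
  \sum_(q | ydist q.1) \sum_(e : G * 'I_k * 'I_k | (e.1.2 != e.2) && lcoll q.2 e)
     hform 1%:M (tact (cop c) (Asym q.1) q.2) (tact (cop c) (Asym q.1) q.2).
  rewrite exchange_big sum_fst; apply: eq_bigr => y _ /=; rewrite /collsum.
  under eq_bigr do rewrite big_mkcond /=.
  rewrite exchange_big; apply: eq_bigr => x _ /=.
  by rewrite big_mkcondr.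
rewrite [leRHS](bigID (fun q => ldist q.2)) /= -[leLHS]add0r; apply: lerD.
  by apply: sumr_ge0 => q _; apply: sumr_ge0 => e _; exact: hform1_ge0.
apply: ler_sum => q /andP[_ /forallPn[e]]; rewrite negb_imply negbK => qe.
rewrite (bigD1 e) //= lerDl; apply: sumr_ge0 => e' _; exact: hform1_ge0.
Qed.

Lemma kbadsum_avg :
  \sum_(c : CP) kbadsum 1%:M c <= nCP * (2 / 2 ^+ h * (#|G| * k * k)%:R * Kform 1%:M).
Proof.
rewrite -(ler_pM2l ng_gt0) mulr_sumr.
apply: (@le_trans _ _ (\sum_(e : G * 'I_k * 'I_k | e.1.2 != e.2) \sum_(y | ydist y)
          nCP * (2 / 2 ^+ h * fnorm (Asym y)))).
  apply: (@le_trans _ _ (\sum_(c : CP) \sum_(e : G * 'I_k * 'I_k | e.1.2 != e.2)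
      \sum_(y | ydist y) collsum c e (Asym y))).
    by apply: ler_sum => c _; exact: kbadsum_le.
  rewrite exchange_big; apply: ler_sum => e ije; rewrite exchange_big.
  by apply: ler_sum => y _; exact: collsum_avg.
have -> : \sum_(y | ydist y) nCP * (2 / 2 ^+ h * fnorm (Asym y)) =
          nCP * (2 / 2 ^+ h) * (ng * Kform 1%:M).
  by rewrite Kform_sym mulr_sumr; apply: eq_bigr => y _; rewrite mulrA.
set z := nCP * _ * _.
have z0 : 0 <= z.
  by rewrite !mulr_ge0 ?ler0n ?invr_ge0 ?exprn_ge0 // Kform1_ge0.
have -> : ng * (nCP * (2 / 2 ^+ h * (#|G| * k * k)%:R * Kform 1%:M)) = z *+ (#|G| * k * k).
  by rewrite -[RHS]mulr_natr /z; ring.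
have <- : \sum_(e : G * 'I_k * 'I_k) z = z *+ (#|G| * k * k).
  by rewrite sumr_const !card_prod !card_ord.
by rewrite [leRHS](bigID (fun e : G * 'I_k * 'I_k => e.1.2 != e.2)) /= lerDl sumr_ge0.
Qed.

Definition realform (H : 'M[C]_N) : C :=
  (#|{: WP}|%:R * nCP)^-1 * \sum_w \sum_c hform H (psi w c) (psi w c).
Definition knorm (H : 'M[C]_N) : C := Kform H / #|Y|%:R ^+ (#|G| * k).

(** Domination bounds the error for [V] by the averages of [badsum] and [cst * kbadsum] at the
    identity. By [diff], [badsum] there is the gap between [realform] and [knorm] plus
    [cst * kbadsum] again, so [kbadsum_avg] enters twice and 2 becomes 4. *)
Lemma realform_knorm (V : 'M[C]_N) :
  (forall u, `|hform V u u| <= hform 1%:M u u) ->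
  `|realform V - knorm V| <=
  realform 1%:M - knorm 1%:M + 4 / 2 ^+ h * (#|G| * k * k)%:R * knorm 1%:M.
Proof.
move=> V1.
have w0 : 0 < #|{: WP}|%:R :> C.
  by rewrite ltr0n; apply/card_gt0P; exists [ffun=> ([ffun x => x], [ffun x => x], [ffun=> true])].
have c0 : 0 < nCP.
  have /card_gt0P[c _] := clifford_card_gt0 R (h + h).
  by rewrite ltr0n; apply/card_gt0P; exists [ffun=> c].
have y0 : 0 < #|Y|%:R ^+ (#|G| * k) :> C.
  by rewrite exprn_gt0 // card_bits_h exprn_gt0 // ltr0n.
pose n : C := #|{: WP}|%:R * nCP.
have n0 : 0 < n by rewrite mulr_gt0.
have cst0 : 0 < cst by rewrite divr_gt0.
have diff H : n * (realform H - knorm H) = \sum_c (badsum H c - cst * kbadsum H c).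
  rewrite mulrBr /realform mulrA divff ?gt_eqF // mul1r exchange_big /=.
  under eq_bigr do rewrite sum_psi.
  have -> : n * knorm H = \sum_(c : CP) cst * Kform H.
    by rewrite sumr_const -[RHS]mulr_natl /n /knorm /cst; ring.
  rewrite -sumrB; apply: eq_bigr => c _; rewrite (Kform_split H c); ring.
have bad c : `|badsum V c| <= badsum 1%:M c.
  by apply: le_trans (ler_norm_sum _ _ _) _; apply: ler_sum => w _; exact: V1.
have kb c : `|kbadsum V c| <= kbadsum 1%:M c.
  rewrite -(ler_pM2l ng_gt0) -{1}(gtr0_norm ng_gt0) -normrM !kbadsum_sym.
  by apply: le_trans (ler_norm_sum _ _ _) _; apply: ler_sum => q _; exact: V1.
rewrite -(ler_pM2l n0) -{1}(gtr0_norm n0) -normrM diff.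
apply: (@le_trans _ _ (\sum_c (badsum 1%:M c + cst * kbadsum 1%:M c))).
  apply: le_trans (ler_norm_sum _ _ _) _; apply: ler_sum => c _.
  apply: le_trans (ler_normB _ _) _; apply: lerD (bad c) _.
  by rewrite normrM gtr0_norm // ler_pM2l.
rewrite mulrDr diff -lerBlDl -sumrB.
have -> : \sum_c (badsum 1%:M c + cst * kbadsum 1%:M c - (badsum 1%:M c - cst * kbadsum 1%:M c))
   = 2 * cst * \sum_c kbadsum 1%:M c.
  by rewrite mulr_sumr; apply: eq_bigr => c _; ring.
have -> : n * (4 / 2 ^+ h * (#|G| * k * k)%:R * knorm 1%:M) =
   2 * cst * (nCP * (2 / 2 ^+ h * (#|G| * k * k)%:R * Kform 1%:M)).
  by rewrite /n /knorm /cst; ring.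
have p0 : 0 < 2 * cst by rewrite mulr_gt0 // ltr0n.
by rewrite ler_pM2l //; exact: kbadsum_avg.
Qed.

End GateLemma.

(** * The two-layer circuit *)

Section Circuit.
Variable R : realType.
Local Notation C := (R[i]).
Variables (n xi g : nat).
Hypothesis xi_gt0 : (0 < xi)%N.
Hypothesis xi_n : (xi %| n)%N.
Hypothesis npE : npatch n xi = g.+1.
Hypothesis g_gt0 : (0 < g)%N.
Local Notation Y := (bits (xi + xi)).
Local Notation gates := {ffun 'I_g -> Y}.
Implicit Types (x u m w z : bits n) (y : gates) (c : 'I_g) (l : bool) (q : 'I_n).

(** Gate [c] covers patches [c] and [c + 1], counted from 0. Layer [true] consists of the even [c]
    and acts first. *)
Definition inlay l (c : nat) : bool := odd c.+1 == l.
Definition covers (c q : nat) : bool := (c * xi <= q < c * xi + (xi + xi))%N.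

Definition wid c : 'I_(npatch n xi) := cast_ord (esym npE) (widen_ord (leqnSn g) c).

Lemma nE : n = (g.+1 * xi)%N.
Proof. by rewrite -npE /npatch divnK. Qed.

Lemma gate_lt c (j : 'I_(xi + xi)) : (c * xi + j < n)%N.
Proof.
have := ltn_ord c; have := ltn_ord j; have := nE; nia.
Qed.

Lemma restrE x c (j : 'I_(xi + xi)) : restr xi x c j = x (Ordinal (gate_lt c j)).
Proof.
rewrite ffunE; case: insubP => [q _ qE|]; last by rewrite gate_lt.
by rewrite /=; congr (x _); apply: val_inj.
Qed.

Lemma covers_unique l c c' (q : nat) :
  inlay l c -> inlay l c' -> covers c q -> covers c' q -> c = c'.
Proof.
rewrite /inlay /covers => /eqP lc /eqP lc' /andP[h1 h2] /andP[h3 h4]; apply: val_inj => /=.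
have : odd c = odd c' by move: lc lc' => /= <-; case: (odd c); case: (odd c').
move=> oc; case: (ltngtP c c') => // cc; [have : (c + 2 <= c')%N | have : (c' + 2 <= c)%N];
  by [lia | nia].
Qed.

Lemma covers_ord c q : covers c q -> (q - c * xi < xi + xi)%N.
Proof. rewrite /covers; lia. Qed.

Definition fill l y u : bits n :=
  [ffun q : 'I_n => if [pick c : 'I_g | inlay l c && covers c q] is Some c
             then oapp (y c) false (insub (q - c * xi)%N) else u q].

Lemma fill_covered l y u c (j : 'I_(xi + xi)) q :
  inlay l c -> q = (c * xi + j)%N :> nat -> fill l y u q = y c j.
Proof.
move=> lc qE; rewrite ffunE.
have cq : covers c q by rewrite /covers qE; have := ltn_ord j; lia.
case: pickP => [c' /andP[lc' cq']|/(_ c)]; last by rewrite lc cq.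
have -> : c' = c by exact: (covers_unique lc' lc cq' cq).
case: insubP => [j' _ j'E|]; last by rewrite covers_ord.
by congr (y c _); apply: val_inj; rewrite j'E qE addKn.
Qed.

Lemma coveredE l q : covered xi l q = [exists c : 'I_g, inlay l c && covers c q].
Proof.
apply/existsP/existsP => [[a /and3P[/andP[la ap] h1 h2]]|[c /andP[lc cq]]].
  have ag : (a < g)%N by rewrite -ltnS -npE.
  by exists (Ordinal ag); rewrite /inlay la /covers h1.
exists (wid c); rewrite /in_layer /= -/(inlay l c) lc npE ltnS ltn_ord /=.
exact: cq.
Qed.

Lemma fill_uncovered l y u q : ~~ covered xi l q -> fill l y u q = u q.
Proof.
rewrite coveredE => /existsPn cq; rewrite ffunE; case: pickP => // c.
by have := cq c => /negPf ->.
Qed.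

Lemma restr_fill l y u c : inlay l c -> restr xi (fill l y u) c = y c.
Proof. by move=> lc; apply/ffunP => j; rewrite restrE (fill_covered y u (j := j) lc). Qed.

Lemma coveredP l q : covered xi l q ->
  exists2 c : 'I_g, inlay l c & exists j : 'I_(xi + xi), q = Ordinal (gate_lt c j).
Proof.
rewrite coveredE => /existsP[c /andP[lc cq]]; exists c => //.
exists (Ordinal (covers_ord cq)); apply: val_inj => /=.
by move: cq; rewrite /covers; lia.
Qed.

Lemma covered_some q : ~~ covered xi false q -> covered xi true q.
Proof.
have cov l c : inlay l c -> covers c q -> covered xi l q.
  by move=> lc cq; rewrite coveredE; apply/existsP; exists c; rewrite lc cq.
have qn : (q < g.+1 * xi)%N by rewrite -nE.
have qd : (q %/ xi < g.+1)%N by rewrite ltn_divLR.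
have qe := divn_eq q xi; have qm := ltn_pmod q xi_gt0.
have [a cq] : exists a : 'I_g, covers a q.
  case: (ltnP (q %/ xi) g) => qg.
    by exists (Ordinal qg); rewrite /covers /=; lia.
  (* No gate starts at the last patch; its qubits belong to gate [g - 1]. *)
  have ag : (g.-1 < g)%N by rewrite prednK.
  exists (Ordinal ag); rewrite /covers /=.
  have qg' : (q %/ xi)%N = g by apply/eqP; rewrite eqn_leq qg -ltnS qd.
  move: qe; rewrite qg' => qe; have : (g.-1 * xi + xi = g * xi)%N by nia.
  by lia.
move=> unc; case la: (inlay true a); first exact: cov la cq.
by move: unc; rewrite (cov false a) //; move: la; rewrite /inlay; case: (odd _).
Qed.

Lemma fillP l y u x :
  fill l y u = x <-> (forall c, inlay l c -> y c = restr xi x c) /\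
                    (forall q, ~~ covered xi l q -> x q = u q).
Proof.
split=> [<-|[xc xu]].
  by split=> [c lc|q qu]; rewrite ?restr_fill ?fill_uncovered.
apply/ffunP => q; have [/coveredP[c lc [j ->]]|qu] := boolP (covered xi l q); last first.
  by rewrite fill_uncovered // xu.
by rewrite (fill_covered y u (j := j) lc) // xc // restrE.
Qed.

Lemma eq_restr l x x' : (forall c, inlay l c -> restr xi x c = restr xi x' c) ->
  (forall q, ~~ covered xi l q -> x q = x' q) -> x = x'.
Proof.
move=> xc xu; have /fillP <- : (forall c, inlay l c -> [ffun c : 'I_g => restr xi x' c] c = restr xi x c) /\
  (forall q, ~~ covered xi l q -> x q = x' q) by split=> // c lc; rewrite ffunE xc.
by apply/fillP; split=> // c lc; rewrite ffunE.
Qed.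

Lemma prod_layer l (F : 'I_(npatch n xi) -> C) :
  \prod_(a | in_layer l a) F a = \prod_(c : 'I_g | inlay l c) F (wid c).
Proof.
pose h (a : 'I_(npatch n xi)) : 'I_g := insubd (Ordinal g_gt0) (val a).
rewrite (reindex_onto wid h) /= => [|a /andP[_ ap]].
  apply: eq_bigl => c; rewrite /in_layer /= npE ltnS ltn_ord andbT -/(inlay l c).
  rewrite [X in _ && X](_ : _ = true) ?andbT //; apply/eqP/val_inj.
  by rewrite /h val_insubd /= ltn_ord.
apply: val_inj; rewrite /= val_insubd; case: ltnP => //.
by rewrite leqNgt -ltnS -npE ap.
Qed.

Lemma ent_layer l (t : {ffun 'I_(npatch n xi) -> lrfc_param R xi}) z x :
  ent (layer l t) z x =
  (\prod_(c : 'I_g | inlay l c) ent (lrfc (t (wid c))) (restr xi z c) (restr xi x c)) *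
  ([forall q, ~~ covered xi l q ==> (z q == x q)])%:R.
Proof. by rewrite ent_mkop prod_layer. Qed.

(** A string equal to [x] off the layer is given freely by its restrictions to the disjoint supports
    of the gates, so the sum of products factors. *)
Lemma sum_fill l x (f : 'I_g -> Y -> C) :
  \sum_(z : bits n | [forall q, ~~ covered xi l q ==> (z q == x q)])
     \prod_(c : 'I_g | inlay l c) f c (restr xi z c) =
  \prod_(c : 'I_g | inlay l c) \sum_v f c v.
Proof.
(* [v0] pins the coordinates of gates outside the layer, so that tuples of the expanded product
   correspond one to one to strings [z]. *)
pose v0 : Y := [ffun=> false].
rewrite (big_distr_big v0) /=.
pose h' z : gates := [ffun c : 'I_g => if inlay l c then restr xi z c else v0].
rewrite (reindex_onto (fun y => fill l y x) h') /= => [|z /forallP zx]; last first.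
  apply/fillP; split=> [c lc|q qu]; first by rewrite ffunE lc.
  by apply/eqP; have := zx q; rewrite qu.
apply: eq_big => [y|y _]; last first.
  by apply: eq_bigr => c lc; rewrite restr_fill.
have -> : [forall q, ~~ covered xi l q ==> (fill l y x q == x q)].
  by apply/forallP => q; apply/implyP => qu; rewrite fill_uncovered.
apply/eqP/pffun_onP => [<-|[supp _]].
  split=> [|v _ //]; apply/fintype.subsetP => c; rewrite !inE ffunE.
  by case: ifP => //; rewrite eqxx.
apply/ffunP => c; rewrite ffunE; case: ifP => lc; first by rewrite restr_fill.
apply/esym/eqP; apply/negPn/negP => yc.
by have : inlay l c := fintype.subsetP supp c yc; rewrite lc.
Qed.


Lemma layer_unitary l (t : {ffun 'I_(npatch n xi) -> lrfc_param R xi}) :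
  (forall a, unitary (lrfc (t a))) -> unitary (layer l t).
Proof.
move=> ut; apply/unitaryP => x x'.
under eq_bigr do rewrite !ent_layer rmorphM rmorph_nat mulrACA rmorph_prod -big_split /= -natrM mulnb.
have [xx'|] := boolP [forall q, ~~ covered xi l q ==> (x q == x' q)]; last first.
  case/forallPn => q; rewrite negb_imply => /andP[qu xq].
  rewrite big1 => [|z _]; first by case: (eqVneq x x') xq => // ->; rewrite eqxx.
  case: forallP => // h1; case: forallP => // h2; rewrite ?mulr0 //.
  have := h1 q; have := h2 q; rewrite qu /= => /eqP zx /eqP; rewrite zx => xx.
  by rewrite xx eqxx in xq.
transitivity (\sum_(z : bits n | [forall q, ~~ covered xi l q ==> (z q == x q)])
    \prod_(c : 'I_g | inlay l c) ((ent (lrfc (t (wid c))) (restr xi z c) (restr xi x c))^* *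
        ent (lrfc (t (wid c))) (restr xi z c) (restr xi x' c))).
  rewrite [RHS]big_mkcond; apply: eq_bigr => z _.
  case: forallP => h1 /=; last by rewrite mulr0.
  rewrite (_ : [forall q, _]) ?mulr1 //; apply/forallP => q; apply/implyP => qu.
  by have := h1 q; rewrite qu => /eqP ->; have := forallP xx' q; rewrite qu.
rewrite (sum_fill l x (fun c v => (ent (lrfc (t (wid c))) v (restr xi x c))^* *
   ent (lrfc (t (wid c))) v (restr xi x' c))).
under eq_bigr => c _ do rewrite ((unitaryP _).1 (ut (wid c))).
have [<-|xn] := eqVneq x x'; first by rewrite big1 // => c _; rewrite eqxx.
have [c lc xc] : exists2 c : 'I_g, inlay l c & restr xi x c != restr xi x' c.
  apply/exists_inP; apply: contraNT xn => /exists_inPn h; apply/eqP.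
  apply: (eq_restr (l := l)) => [c lc|q qu]; first by apply/eqP; have := h c lc; rewrite negbK.
  by apply/eqP; have := forallP xx' q; rewrite qu.
by rewrite (bigD1 c) //= (negPf xc) mul0r.
Qed.

(* [fill l y u] overwrites with the gate outputs [y] the qubits covered by layer
   [l]; [mfill] is the string between the two layers, [wfill] the circuit output
   (every qubit is covered, so the input does not matter) and [vhat] lists the
   gate inputs. *)
Definition mfill y u : bits n := fill true y u.
Definition wfill y : bits n := fill false y (mfill y [ffun=> false]).
Definition vhat y u : gates :=
  [ffun c : 'I_g => if inlay true c then restr xi u c else restr xi (mfill y u) c].

Definition gate_param (t : blocked_param R n xi) c : lrfc_param R xi :=
  if inlay true c then t.1 (wid c) else t.2 (wid c).

Lemma inlay_false (c : nat) : inlay false c = ~~ inlay true c.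
Proof. by rewrite /inlay; case: (odd _). Qed.

Lemma wfillE y u : wfill y = fill false y (mfill y u).
Proof.
apply/esym/fillP; split=> [c lc|q qu]; first by rewrite restr_fill.
rewrite fill_uncovered //; have /coveredP[c lc [j ->]] := covered_some qu.
by rewrite !(fill_covered _ _ (j := j) lc).
Qed.

(** The sum over intermediate strings becomes a sum over gate outputs: first-layer entries of [y]
    record the intermediate string, second-layer entries record [w]. Gates of both layers then stand
    in a single product. *)
Lemma ent_blocked (t : blocked_param R n xi) w u :
  ent (blocked_lrfc t) w u =
  \sum_(y : gates | w == wfill y) \prod_c ent (lrfc (gate_param t c)) (y c) (vhat y u c).
Proof.
rewrite ent_mul.
pose L c := ent (lrfc (gate_param t c)).
pose valid m := [forall q, ~~ covered xi false q ==> (w q == m q)] &&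
                [forall q, ~~ covered xi true q ==> (m q == u q)].
transitivity (\sum_(m | valid m)
   (\prod_(c : 'I_g | inlay true c) L c (restr xi m c) (restr xi u c)) *
   (\prod_(c : 'I_g | ~~ inlay true c) L c (restr xi w c) (restr xi m c))).
  rewrite [RHS]big_mkcond; apply: eq_bigr => m _; rewrite !ent_layer mulrACA -natrM mulnb -/(valid m).
  case: (valid m); rewrite ?mulr0 ?mulr1 // mulrC; congr (_ * _).
    by apply: eq_bigr => c lc; rewrite /L /gate_param lc.
  by apply: eq_big => [c|c]; rewrite inlay_false // => /negPf lc; rewrite /L /gate_param lc.
pose h' m : gates := [ffun c : 'I_g => if inlay true c then restr xi m c else restr xi w c].
rewrite (reindex_onto (fun y => mfill y u) h') /= => [|m /andP[/forallP _ /forallP mu]]; last first.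
  apply/fillP; split=> [c lc|q qu]; first by rewrite ffunE lc.
  by apply/eqP; have := mu q; rewrite qu.
apply: eq_big => [y|y].
  apply/andP/eqP => [[/andP[/forallP wm _] /eqP hy]|wE].
    apply/esym; rewrite (wfillE y u); apply/fillP; split=> [c|q qu]; last first.
      by apply/eqP; have := wm q; rewrite qu.
    by rewrite inlay_false => /negPf lc; rewrite -{1}hy ffunE lc.
  have wu : fill false y (mfill y u) = w by rewrite -wfillE.
  split.
    apply/andP; split; apply/forallP => q; apply/implyP => qu.
      by rewrite -wu fill_uncovered.
    by rewrite fill_uncovered.
  apply/eqP/ffunP => c; rewrite ffunE; case: ifP => lc; first by rewrite restr_fill.
  by rewrite -wu restr_fill // inlay_false lc.
move=> /andP[_ /eqP hy]; rewrite [RHS](bigID (fun c : 'I_g => inlay true c)) /=.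
congr (_ * _); apply: eq_bigr => c lc; rewrite [vhat _ _ _]ffunE ?lc.
  by rewrite restr_fill.
by rewrite (negPf lc) -{2}hy ffunE (negPf lc).
Qed.

Lemma restr_next x (c : nat) : right_half (restr xi x c) = left_half (restr xi x c.+1).
Proof.
apply/ffunP => j; rewrite !ffunE /=; congr (oapp x false (insub _)).
by rewrite mulSn; lia.
Qed.

(** The shared patch carries an output of the first-layer gate into its second-layer neighbour. Here
    the first-layer gate is on the left, which concerns its right output half; [vhat_link_even] is
    the mirror case. *)
Lemma vhat_link_odd y u c c' : inlay true c -> c' = c.+1 :> nat ->
  left_half (vhat y u c') = right_half (y c).
Proof.
move=> lc cc'; have lc' : inlay true c' = false.
  by rewrite cc'; move: lc; rewrite /inlay /=; case: (odd c).
by rewrite [vhat _ _ _]ffunE lc' cc' -restr_next (restr_fill _ _ lc).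
Qed.

Lemma vhat_link_even y u c c' : inlay true c = false -> c' = c.+1 :> nat ->
  right_half (vhat y u c) = left_half (y c').
Proof.
move=> lc cc'; have lc' : inlay true c'.
  by rewrite cc'; move: lc; rewrite /inlay /=; case: (odd c).
by rewrite [vhat _ _ _]ffunE lc restr_next -cc' (restr_fill _ _ lc').
Qed.

(** First-layer gates read their part of [u] directly; the remaining qubits pass unchanged through
    [mfill] and are read by the second layer. *)
Lemma vhat_inj y u u' : vhat y u = vhat y u' -> u = u'.
Proof.
move=> /ffunP E; apply: (eq_restr (l := true)) => [c lc|q qu].
  by have := E c; rewrite !ffunE lc.
have : covered xi false q.
  by apply: contraNT qu; exact: covered_some.
move=> /coveredP[c lc [j qE]]; have := congr1 (fun v : Y => v j) (E c).
move: lc; rewrite inlay_false => /negPf lc; rewrite ![vhat _ _ _]ffunE lc !restrE -qE.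
by rewrite !fill_uncovered.
Qed.

(** The first patch meets only gate 0, of the first layer, so its final content is the left output
    half of that gate. This yields the distinctness of the strings in [wtup y]. *)
Lemma wfill_left (y y' : gates) : wfill y = wfill y' ->
  left_half (y (Ordinal g_gt0)) = left_half (y' (Ordinal g_gt0)).
Proof.
move=> /ffunP E; apply/ffunP => j.
pose q := Ordinal (gate_lt (Ordinal g_gt0) (lshift xi j)).
have qu : ~~ covered xi false q.
  rewrite coveredE; apply/existsPn => c; rewrite /inlay /covers /=.
  have := ltn_ord j; case: (val c) => [//|c'] jx; rewrite negb_and; apply/orP; right.
  by rewrite negb_and mulSn -ltnNge mul0n add0n ltn_addr.
have wE (z : gates) : wfill z q = left_half (z (Ordinal g_gt0)) j.
  rewrite fill_uncovered // (fill_covered z _ (c := Ordinal g_gt0) (j := lshift xi j)) //.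
  by rewrite ffunE.
by rewrite -!wE E.
Qed.

End Circuit.

(** * Experiments *)

Section Snoc.
Variables (S : finType) (j : nat).

Definition fsnoc (f : {ffun 'I_j -> S}) (s : S) : {ffun 'I_j.+1 -> S} :=
  [ffun i => if unlift ord_max i is Some i' then f i' else s].

Lemma fsnoc_max f s : fsnoc f s ord_max = s.
Proof. by rewrite ffunE unlift_none. Qed.

Lemma fsnoc_lift f s i : fsnoc f s (lift ord_max i) = f i.
Proof. by rewrite ffunE liftK. Qed.

Lemma big_fsnoc (Vt : nmodType) (F : {ffun 'I_j.+1 -> S} -> Vt) :
  \sum_f F f = \sum_f \sum_s F (fsnoc f s).
Proof.
rewrite pair_bigA /= (reindex (fun fs : {ffun 'I_j -> S} * S => fsnoc fs.1 fs.2)) //=.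
exists (fun f => ([ffun i => f (lift ord_max i)], f ord_max)) => [[f s] _|f _] /=.
  by rewrite fsnoc_max; congr (_, _); apply/ffunP => i; rewrite ffunE fsnoc_lift.
apply/ffunP => i; rewrite ffunE; case: unliftP => [i' ->|->] //.
by rewrite ffunE.
Qed.

End Snoc.

Section Runs.
Variable R : realType.
Local Notation C := (R[i]).
Variables n m : nat.
Local Notation X := (bits n).
Local Notation OP := (op R X).
Local Notation ext := (@ext R n m).

Lemma bits_split (x y : bits (n + m)) :
  (x == y) = (sys_part x == sys_part y) && (anc_part x == anc_part y).
Proof.
apply/eqP/andP => [-> //|[/eqP/ffunP xs /eqP/ffunP xa]]; apply/ffunP => q.
rewrite -(splitK q); case: (fintype.split q) => i /=.
  by have := xs i; rewrite !ffunE.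
by have := xa i; rewrite !ffunE.
Qed.

Lemma sum_bits (F : X -> bits m -> C) :
  \sum_(z : bits (n + m)) F (sys_part z) (anc_part z) = \sum_s \sum_a F s a.
Proof.
pose mk (p : X * bits m) : bits (n + m) :=
  [ffun i => match fintype.split i with inl j => p.1 j | inr j => p.2 j end].
have mks p : sys_part (mk p) = p.1.
  by apply/ffunP => i; rewrite !ffunE (unsplitK (inl i)).
have mka p : anc_part (mk p) = p.2.
  by apply/ffunP => i; rewrite !ffunE (unsplitK (inr i)).
rewrite pair_bigA /= (reindex mk) /=; first by apply: eq_bigr => p _; rewrite mks mka.
exists (fun z => (sys_part z, anc_part z)) => [p _|z _]; first by rewrite mks mka; case: p.
by apply/eqP; rewrite bits_split mks mka !eqxx.
Qed.

Lemma ext_mul (A B : OP) : ext (A *m B) = ext A *m ext B.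
Proof.
apply: ent_inj => y x; rewrite ent_mul ent_mkop ent_mul.
under [RHS]eq_bigr do rewrite !ent_mkop.
rewrite (sum_bits (fun s a => ent A (sys_part y) s * (anc_part y == a)%:R *
  (ent B s (sys_part x) * (a == anc_part x)%:R))).
rewrite mulr_suml; apply: eq_bigr => s _; rewrite (bigD1 (anc_part y)) //= eqxx mulr1.
rewrite big1 ?addr0 ?mulrA // => a ay.
by rewrite eq_sym (negPf ay) mulr0 mul0r.
Qed.

Lemma ext_adj (A : OP) : ext (adjm A) = adjm (ext A).
Proof.
by apply: ent_inj => y x; rewrite ent_adj !ent_mkop ent_adj rmorphM rmorph_nat eq_sym.
Qed.

Lemma ext1 : ext 1%:M = 1%:M.
Proof. by apply: ent_inj => y x; rewrite ent_mkop !ent1 bits_split -natrM mulnb. Qed.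

Lemma ext_unitary (A : OP) : unitary A -> unitary (ext A).
Proof. by move=> uA; rewrite /unitary -ext_adj -ext_mul uA ext1. Qed.

Lemma ext_add (A B : OP) : ext (A + B) = ext A + ext B.
Proof. by apply: ent_inj => y x; rewrite ent_add !ent_mkop ent_add mulrDl. Qed.

Lemma ext_scale a (A : OP) : ext (a *: A) = a *: ext A.
Proof. by apply: ent_inj => y x; rewrite ent_scale !ent_mkop ent_scale mulrA. Qed.

Lemma ext0 : ext 0 = 0.
Proof. by rewrite -(scale0r 0) ext_scale scale0r. Qed.

Lemma ext_sum I (r : seq I) (P : pred I) (F : I -> OP) :
  ext (\sum_(i <- r | P i) F i) = \sum_(i <- r | P i) ext (F i).
Proof. by elim/big_rec2: _ => [|i A B _ <-]; rewrite ?ext0 ?ext_add. Qed.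

Definition ketbra (w u : X) : OP := mkop (fun y x => ((y == w) && (x == u))%:R).

Lemma ketbra_adj w u : adjm (ketbra w u) = ketbra u w.
Proof. by apply: ent_inj => y x; rewrite ent_adj !ent_mkop rmorph_nat andbC. Qed.

Lemma ketbra_mul w u (A : OP) v x :
  ketbra w u *m A *m ketbra v x = ent A u v *: ketbra w x.
Proof.
apply: ent_inj => y z; rewrite ent_scale ent_mul (bigD1 v) //= !ent_mkop eqxx /= big1 ?addr0.
  rewrite ent_mul (bigD1 u) //= ent_mkop eqxx andbT big1 ?addr0.
    by case: (y == w); case: (z == x); rewrite ?mul1r ?mul0r ?mulr1 ?mulr0.
  by move=> t tu; rewrite ent_mkop (negPf tu) andbF mul0r.
by move=> t tv; rewrite ent_mkop (negPf tv) mulr0.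
Qed.

Lemma ketbra_comp w u v x : ketbra w u *m ketbra v x = (u == v)%:R *: ketbra w x.
Proof. by rewrite -[ketbra w u]mulmx1 ketbra_mul ent1. Qed.

Lemma sum_ketbra : \sum_v ketbra v v = 1%:M.
Proof.
apply: ent_inj => y x; rewrite ent1 /ent summxE.
under eq_bigr do rewrite -/(ent _ y x) ent_mkop.
rewrite (bigD1 y) //= eqxx big1 ?addr0 ?[x == y]eq_sym // => v vy.
by rewrite eq_sym (negPf vy).
Qed.

Variable k : nat.
Variable W : 'I_k.+1 -> op R (bits (n + m)).

(** A separate operator for each query lets every query be expanded on its own into rank-one
    terms. *)
Fixpoint runf (O : nat -> OP) (j : nat) : 'cV[C]_#|bits (n + m)| :=
  match j with
  | 0 => W (inord 0) *m zero_state R n m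
  | j'.+1 => W (inord j) *m (ext (O j') *m runf O j')
  end.

Lemma run_runf U j : run W U j = runf (fun=> U) j.
Proof. by elim: j => //= j ->. Qed.

Lemma eq_runf O O' j : (forall i, (i < j)%N -> O i = O' i) -> runf O j = runf O' j.
Proof.
elim: j => //= j IH OO; rewrite IH ?OO // => i ij; apply: OO; exact: ltnW.
Qed.

Definition otup j (O : 'I_j -> OP) (i : nat) : OP := oapp O 1%:M (insub i).

Lemma otup_ord j (O : 'I_j -> OP) (i : 'I_j) : otup O i = O i.
Proof. by rewrite /otup valK. Qed.

Lemma otup_lt j (O : 'I_j -> OP) i (ij : (i < j)%N) : otup O i = O (Ordinal ij).
Proof. exact: (otup_ord O (Ordinal ij)). Qed.

Lemma runf_expand (S : finType) (a : nat -> S -> C) (Q : nat -> S -> OP) (U : nat -> OP) j :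
  (forall i, (i < j)%N -> U i = \sum_s a i s *: Q i s) ->
  runf U j = \sum_(f : {ffun 'I_j -> S}) (\prod_(i < j) a i (f i)) *: runf (otup (fun i : 'I_j => Q i (f i))) j.
Proof.
elim: j => [|j IH] UE /=.
  have f0 : {ffun 'I_0 -> S} by apply: finfun; case.
  rewrite (bigD1 f0) //= big_ord0 scale1r big1 ?addr0 // => f.
  by case/eqP; apply/ffunP; case.
rewrite big_fsnoc IH => [|i ij]; last by apply: UE; exact: ltnW.
rewrite UE // ext_sum mulmx_sumr mulmx_sumr; apply: eq_bigr => f _.
rewrite mulmx_suml mulmx_sumr; apply: eq_bigr => s _.
rewrite big_ord_recr /= fsnoc_max.
rewrite ext_scale -scalemxAl -!scalemxAr scalerA mulrC.
have -> : \prod_(i < j) a i (fsnoc f s (widen_ord (leqnSn j) i)) = \prod_(i < j) a i (f i).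
  apply: eq_bigr => i _; congr a.
  have -> : widen_ord (leqnSn j) i = lift ord_max i.
    by apply: val_inj; rewrite /= /bump leqNgt ltn_ord.
  by rewrite fsnoc_lift.
rewrite mulrC; congr (_ *: (_ *m (_ *m _))).
  have /= -> := otup_ord (fun i : 'I_j.+1 => Q i (fsnoc f s i)) ord_max.
  by rewrite fsnoc_max.
apply: eq_runf => i ij; have /= -> := otup_ord (fun i : 'I_j => Q i (f i)) (Ordinal ij).
have ij1 : (i < j.+1)%N by exact: ltnW.
have /= -> := otup_ord (fun i : 'I_j.+1 => Q i (fsnoc f s i)) (Ordinal ij1).
congr Q; have -> : Ordinal ij1 = lift ord_max (Ordinal ij).
  by apply: val_inj; rewrite /= /bump leqNgt ij.
by rewrite fsnoc_lift.
Qed.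

Local Notation utup := {ffun 'I_k -> X}.

(* The final state when query [i] is replaced by [|w i><u i|]. *)
Definition phi (w u : utup) := runf (otup (fun i => ketbra (w i) (u i))) k.

Hypothesis uW : forall i, unitary (W i).

Definition ucomp (u : utup) (d : 'S_k) : utup := [ffun i => u (d i)].

(** Overlap after [j] queries, still summed over all coordinates of [u]; each query removed
    therefore costs a power of [#|X|]. *)
Definition peel (w : utup) (d : 'S_k) (j : nat) : C :=
  \sum_u hform 1%:M (runf (otup (fun i => ketbra (ucomp w d i) (ucomp u d i))) j)
                    (runf (otup (fun i => ketbra (w i) (u i))) j).

Lemma hform_ketbra w u w' u' r r' :
  hform 1%:M (ext (ketbra w' u') *m r') (ext (ketbra w u) *m r) =
  (w' == w)%:R * hform (ext (ketbra u' u)) r' r.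
Proof.
by rewrite hform_mulmx mulmx1 -ext_adj -ext_mul ketbra_adj ketbra_comp ext_scale hformHZ.
Qed.

(** Since [d] fixes query [j], both states project onto the same [w j], and summing over [u j]
    resolves the identity. On the right-hand side [u j] is a free coordinate, hence the factor
    [#|X|]. *)
Lemma peel_step w (d : 'S_k) (j : 'I_k) : (forall i : 'I_k, (j <= i)%N -> d i = i) ->
  #|X|%:R * peel w d j.+1 = peel w d j.
Proof.
move=> dfix; pose O (w u : utup) := otup (fun i => ketbra (w i) (u i)).
pose F (u : utup) := hform 1%:M (runf (O (ucomp w d) (ucomp u d)) j.+1) (runf (O w u) j.+1).
have -> : #|X|%:R * peel w d j.+1 = \sum_(u : utup) \sum_(v : X) F [ffun b => if b == j then v else u b].
  by rewrite (big_upd j F) mulr_natl.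
apply: eq_bigr => u _.
set r' := runf _ j; set r := runf _ j.
transitivity (\sum_v hform (ext (ketbra v v)) r' r).
  apply: eq_bigr => v _; rewrite /F /= hform_unitary //.
  rewrite /O !otup_ord -/O hform_ketbra [ucomp w d j]ffunE dfix // eqxx mul1r.
  set u' : utup := [ffun b => _].
  have u'E (i : 'I_k) : (i < j)%N -> u' i = u i /\ u' (d i) = u (d i).
    move=> ij; rewrite !ffunE -!val_eqE /= (ltn_eqF ij); split=> //.
    have -> // : (val (d i) == j) = false.
    apply/negP => /eqP/val_inj dij; have := dfix j (leqnn _); rewrite -dij => /perm_inj E.
    by move: ij; rewrite -E dij ltnn.
  rewrite [ucomp u' d j]ffunE dfix // [u' j]ffunE eqxx.
  congr hform; apply: eq_runf => i ij.
    have ik := ltn_trans ij (ltn_ord j); rewrite /O.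
    rewrite !(otup_lt _ ik) ![ucomp _ d (Ordinal ik)]ffunE.
    by rewrite (u'E (Ordinal ik) ij).2.
  have ik := ltn_trans ij (ltn_ord j); rewrite /O.
  by rewrite !(otup_lt _ ik) (u'E (Ordinal ik) ij).1.
rewrite -[hform 1%:M r' r]/(hform 1%:M r' r) -ext1 -sum_ketbra ext_sum.
elim/big_rec2: _ => [|v A x _ ->]; last by rewrite hformHD.
by rewrite /hform mulmx0 mul0mx mxE.
Qed.

Lemma card_X_gt0 : 0 < #|X|%:R :> C.
Proof. by rewrite card_bits_h exprn_gt0 // ltr0n. Qed.

Lemma zero_state_norm : hform 1%:M (zero_state R n m) (zero_state R n m) = 1.
Proof.
rewrite hform1E sum_enum_rank (bigD1 [ffun=> false]) //= !mxE enum_rankK eqxx rmorph1 mul1r.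
by rewrite big1 ?addr0 // => x x0; rewrite !mxE enum_rankK (negPf x0) mulr0.
Qed.

Lemma run_norm U j : unitary U -> hform 1%:M (run W U j) (run W U j) = 1.
Proof.
move=> uU; elim: j => [|j IH] /=; first by rewrite hform_unitary // zero_state_norm.
by rewrite !hform_unitary //; exact: ext_unitary.
Qed.

(** For the trivial permutation all [k] queries peel off. Otherwise let [i1] be the largest index
    moved: later queries peel off, and at [i1] the outputs [w (d i1)] and [w i1] are orthogonal
    because [w] is injective. *)
Lemma sum_phi (w : utup) (d : 'S_k) : injective w ->
  \sum_u hform 1%:M (phi (ucomp w d) (ucomp u d)) (phi w u) = (d == 1%g)%:R.
Proof.
move=> w_inj; rewrite -/(peel w d k); have X0 := card_X_gt0.
have [d1|dn] := eqVneq d 1%g.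
  have : forall j, (j <= k)%N -> #|X|%:R ^+ j * peel w d j = #|X|%:R ^+ k.
    elim=> [_|j IH jk].
      rewrite expr0 mul1r /peel /=; under eq_bigr do rewrite hform_unitary // zero_state_norm.
      by rewrite sumr_const card_ffun card_ord natrX.
    rewrite exprSr -mulrA (peel_step w (j := Ordinal jk)) ?IH //; first exact: ltnW.
    by move=> i _; rewrite d1 perm1.
  move/(_ k (leqnn _)) => E; apply: (mulfI (expf_neq0 k (lt0r_neq0 X0))).
  by rewrite E mulr1.
have [i0 di0] : exists i, d i != i.
  apply/existsP; apply: contraNT dn => /existsPn h; apply/eqP/permP => i.
  by rewrite perm1; apply/eqP; have := h i; rewrite negbK.
have := @arg_maxnP _ i0 (fun i => d i != i) val di0; case=> i1 di1 maxi.
suff : forall j, (i1 < j <= k)%N -> peel w d j = 0 by move=> H; apply: H; rewrite ltn_ord leqnn.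
elim=> [//|j IH] /andP[]; rewrite ltnS leq_eqVlt => /orP[/eqP <- _|ij jk].
  apply: big1 => u _ /=; rewrite hform_unitary // !otup_ord hform_ketbra [ucomp w d i1]ffunE.
  by rewrite (inj_eq w_inj) (negPf di1) mul0r.
apply: (mulfI (lt0r_neq0 X0)); rewrite mulr0 (peel_step w (j := Ordinal jk)).
  by rewrite IH // ij ltnW.
move=> i ji; apply/eqP; apply: contraLR ij => /maxi; rewrite -leqNgt; exact: leq_trans.
Qed.

End Runs.

Lemma lrfcE (R : realType) h (t : lrfc_param R h) : lrfc t = wop R t.1 *m val t.2.
Proof. by case: t => -[[hL hR] f] c. Qed.

Section RightShift.
Variable R : realType.
Local Notation C := (R[i]).
Variables n m k : nat.
Local Notation X := (bits n).
Local Notation OP := (op R X).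
Local Notation utup := {ffun 'I_k -> X}.
Variable W : 'I_k.+1 -> op R (bits (n + m)).

(* Querying [U *m M] is the same as querying [U] in the experiment [shiftW M]. *)
Definition shiftW (M : OP) (j : 'I_k.+1) : op R (bits (n + m)) :=
  if (j < k)%N then ext m M *m W j else W j.

(** Each [W j] with [j < k] absorbs the [M] of the query that follows it, so that factor is left in
    front until the last query has been made. *)
Lemma runf_shiftW M O j : (j <= k)%N ->
  runf (shiftW M) O j =
  (if (j < k)%N then ext m M else 1%:M) *m runf W (fun i => O i *m M) j.
Proof.
elim: j => [_|j IH jk] /=; first by rewrite /shiftW inordK //; case: ifP => _; rewrite ?mul1mx ?mulmxA.
rewrite IH ?jk; last exact: ltnW.
rewrite /shiftW inordK // ext_mul; case: ifP => _; by rewrite ?mul1mx !mulmxA.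
Qed.

Lemma run_shiftW M U : run W (U *m M) k = run (shiftW M) U k.
Proof. by rewrite !run_runf runf_shiftW // ltnn mul1mx. Qed.

(** Multiplying [ketbra w u] by [M] on the right expands the bra in the basis: only the inputs [u]
    are mixed, and the outputs [w] stay. *)
Lemma phi_shiftW M (w u : utup) :
  phi (shiftW M) w u = tact (fun=> M) (phi W w) u.
Proof.
rewrite /phi runf_shiftW // ltnn mul1mx.
pose ev (f : utup) (i : nat) : X := oapp f [ffun=> false] (insub i).
have evE f (i : 'I_k) : ev f i = f i by rewrite /ev valK.
rewrite (runf_expand W (a := fun i v => ent M (ev u i) v) (Q := fun i v => ketbra R (ev w i) v)).
  apply: eq_bigr => v _; congr (_ *: _); first by apply: eq_bigr => i _; rewrite evE.
  by apply: eq_runf => i ik; rewrite !(otup_lt _ ik) (evE w (Ordinal ik)).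
move=> i ik; rewrite (otup_lt _ ik) -(evE w (Ordinal ik)) -(evE u (Ordinal ik)) /=.
rewrite -[LHS]mulmx1 -sum_ketbra mulmx_sumr; apply: eq_bigr => v _.
by rewrite ketbra_mul.
Qed.

Lemma shiftW_unitary M : unitary M -> (forall i, unitary (W i)) ->
  forall i, unitary (shiftW M i).
Proof.
move=> uM uW i; rewrite /shiftW; case: ifP => // _.
by apply: unitaryM => //; exact: ext_unitary.
Qed.

End RightShift.

(** * From one permutation per gate to one global permutation *)

Section GluedGates.
Variable R : realType.
Local Notation C := (R[i]).
Variables (n xi g m k : nat).
Hypothesis xi_gt0 : (0 < xi)%N.
Hypothesis xi_n : (xi %| n)%N.
Hypothesis npE : npatch n xi = g.+1.
Hypothesis g_gt0 : (0 < g)%N.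
Local Notation X := (bits n).
Local Notation Y := (bits (xi + xi)).
Local Notation gates := {ffun 'I_g -> Y}.
Local Notation tup := {ffun 'I_g * 'I_k -> Y}.
Local Notation utup := {ffun 'I_k -> X}.
Local Notation gperm := {ffun 'I_g -> 'S_k}.

Definition yat (y : tup) (i : 'I_k) : gates := [ffun c => y (c, i)].
Definition wtup (y : tup) : utup := [ffun i => wfill n (yat y i)].
Definition vtup (y : tup) (u : utup) : tup :=
  [ffun j => vhat (yat y j.2) (u j.2) j.1].
Definition gconst (d : 'S_k) : gperm := [ffun=> d].

Lemma yatE y i c : yat y i c = y (c, i).
Proof. by rewrite ffunE. Qed.

Lemma tperm_actE (x : tup) (p : gperm) c i : tperm_act x p (c, i) = x (c, p c i).
Proof. by rewrite ffunE. Qed.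

Lemma vtupE y u c i : vtup y u (c, i) = vhat (yat y i) (u i) c.
Proof. by rewrite ffunE. Qed.

Lemma yat_gconst y d i : yat (tperm_act y (gconst d)) i = yat y (d i).
Proof. by apply/ffunP => c; rewrite !ffunE /gate_act /= ffunE. Qed.

Lemma wtup_gconst y d : wtup (tperm_act y (gconst d)) = ucomp (wtup y) d.
Proof. by apply/ffunP => i; rewrite !ffunE yat_gconst. Qed.

Lemma vtup_gconst y u d :
  vtup (tperm_act y (gconst d)) (ucomp u d) = tperm_act (vtup y u) (gconst d).
Proof.
by apply/ffunP => -[c i]; rewrite tperm_actE !vtupE yat_gconst !ffunE.
Qed.

Lemma gconst_inj : injective gconst.
Proof. by move=> d d' /ffunP/(_ (Ordinal g_gt0)); rewrite !ffunE. Qed.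

(* Two consecutive gates share a patch on which the intermediate values are
   pairwise distinct, which forces their permutations to coincide. *)
Lemma glue y (p : gperm) u u' : ydist y ->
  vtup (tperm_act y p) u' = tperm_act (vtup y u) p ->
  exists d, p = gconst d /\ u' = ucomp u d.
Proof.
case/andP => yL yR /ffunP E.
have next (c c' : 'I_g) : c' = c.+1 :> nat -> p c' = p c.
  move=> cc'; apply/permP => i.
  have := E (c', i); have := E (c, i); rewrite !tperm_actE !vtupE => Ec Ec'.
  case lc: (inlay true c).
    have := congr1 (@left_half xi) Ec'.
    rewrite !(vhat_link_odd xi_gt0 xi_n npE g_gt0 _ _ lc cc') !yatE tperm_actE => yE.
    by apply: (rdistP (a := c) yR); rewrite /= yE.
  have := congr1 (@right_half xi) Ec.
  rewrite !(vhat_link_even xi_gt0 xi_n npE g_gt0 _ _ lc cc') !yatE tperm_actE => yE.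
  by apply: (ldistP (a := c') yL); rewrite /= yE.
pose c0 := Ordinal g_gt0; exists (p c0).
have pE : p = gconst (p c0).
  apply/ffunP => -[c cg]; rewrite ffunE; elim: c cg => [|c IH] cg.
    by congr (p _); apply: val_inj.
  by rewrite (next (Ordinal (ltnW cg)) (Ordinal cg)) ?IH.
split=> //; apply/ffunP => i; rewrite [RHS]ffunE.
apply: (vhat_inj xi_gt0 xi_n npE g_gt0 (y := yat y (p c0 i))); apply/ffunP => c.
by have := E (c, i); rewrite pE tperm_actE !vtupE yat_gconst !ffunE.
Qed.

Lemma glue_sum y (p : gperm) u u' : ydist y ->
  (vtup (tperm_act y p) u' == tperm_act (vtup y u) p)%:R =
  \sum_(d : 'S_k) ((p == gconst d) && (u' == ucomp u d))%:R :> C.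
Proof.
move=> yD; case: eqP => [/(glue yD)[d [-> ->]]|ne].
  rewrite (bigD1 d) //= !eqxx big1 ?addr0 // => d' d'd.
  by rewrite (inj_eq gconst_inj) eq_sym (negPf d'd).
rewrite big1 // => d _; case: eqP => //= pE; case: eqP => // uE.
by case: ne; rewrite pE uE vtup_gconst.
Qed.

Section Amplitudes.
Variable W : 'I_k.+1 -> op R (bits (n + m)).
Local Notation dim := #|bits (n + m)|.
Local Notation phi := (phi W).

(** By [vhat_inj] at most one [u] contributes, and none if the gate inputs [x] are incompatible with
    the outputs [y]. Inputs and outputs can thus be treated as independent indices. *)
Definition Aexp (y x : tup) : 'cV[C]_dim :=
  \sum_(u : utup) (vtup y u == x)%:R *: phi (wtup y) u.

Definition Kfin (H : 'M[C]_dim) : C :=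
  (\sum_(y : tup | ydist y) \sum_(d : 'S_k) \sum_(u : utup)
     hform H (phi (ucomp (wtup y) d) (ucomp u d)) (phi (wtup y) u))
  / #|Y|%:R ^+ (g * k).

Lemma knorm_Aexp H : knorm Aexp H = Kfin H.
Proof.
rewrite /knorm card_ord; congr (_ / _); rewrite /Kform sum_fst; apply: eq_bigr => y yD.
pose F (p : gperm) u' u := hform H (phi (wtup (tperm_act y p)) u') (phi (wtup y) u).
transitivity (\sum_(p : gperm) \sum_u \sum_u'
   (vtup (tperm_act y p) u' == tperm_act (vtup y u) p)%:R * F p u' u).
  rewrite exchange_big; apply: eq_bigr => p _ /=.
  transitivity (\sum_x \sum_u \sum_u' (vtup y u == x)%:R *
     ((vtup (tperm_act y p) u' == tperm_act x p)%:R * F p u' u)).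
    apply: eq_bigr => x _; rewrite /Aexp hform_sumr; apply: eq_bigr => u _.
    rewrite hform_suml; apply: eq_bigr => u' _.
    by rewrite hformZr hformZl rmorph_nat.
  rewrite exchange_big; apply: eq_bigr => u _ /=; rewrite exchange_big; apply: eq_bigr => u' _ /=.
  rewrite (bigD1 (vtup y u)) //= eqxx mul1r big1 ?addr0 // => x.
  by rewrite eq_sym => /negPf ->; rewrite mul0r.
(* [glue_sum] keeps only the permutations that are constant over the gates, with [u'] permuted in
   the same way. *)
transitivity (\sum_(p : gperm) \sum_u \sum_u' \sum_(d : 'S_k)
   ((p == gconst d) && (u' == ucomp u d))%:R * F p u' u).
  by do 3![apply: eq_bigr => ? _]; rewrite glue_sum // mulr_suml.
rewrite exchange_big [RHS]exchange_big /=; apply: eq_bigr => u _.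
rewrite exchange_big /=; under eq_bigr do rewrite exchange_big /=.
rewrite exchange_big /=; apply: eq_bigr => d _.
rewrite (bigD1 (ucomp u d)) //= [X in _ + X]big1 ?addr0; last first.
  by move=> u' /negPf u'u; apply: big1 => p _; rewrite u'u andbF mul0r.
rewrite (bigD1 (gconst d)) //= !eqxx mul1r big1 ?addr0; last first.
  by move=> p /negPf ->; rewrite mul0r.
by rewrite /F wtup_gconst.
Qed.

Definition wpart (t : blocked_param R n xi) : {ffun 'I_g -> wparam xi} :=
  [ffun c => (gate_param npE t c).1].
Definition cpart (t : blocked_param R n xi) : {ffun 'I_g -> clifford R (xi + xi)} :=
  [ffun c => (gate_param npE t c).2].

Lemma run_blocked t : run W (blocked_lrfc t) k = psi Aexp (wpart t) (cpart t).
Proof.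
pose a (s : gates * X) : C := \prod_c ent (lrfc (gate_param npE t c)) (s.1 c) (vhat s.1 s.2 c).
rewrite run_runf (runf_expand W (a := fun=> a) (Q := fun _ s => ketbra R (wfill n s.1) s.2)); last first.
  move=> _ _; apply: ent_inj => w u; rewrite (ent_blocked xi_gt0 xi_n npE g_gt0).
  rewrite /ent summxE -(pair_bigA _ (fun y v => (a (y, v) *: ketbra R (wfill n y) v)
      (enum_rank w) (enum_rank u))) /= big_mkcond; apply: eq_bigr => y _.
  rewrite (bigD1 u) //= -/(ent _ w u) ent_scale ent_mkop eqxx andbT [X in _ = _ + X]big1 ?addr0.
    by case: eqP => _; rewrite ?mulr1 ?mulr0.
  by move=> v vu; rewrite -/(ent _ w u) ent_scale ent_mkop [u == v]eq_sym (negPf vu) andbF mulr0.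
transitivity (\sum_(y : tup) \sum_(u : utup)
   (\prod_j ent (wop R (wpart t j.1) *m val (cpart t j.1)) (y j) (vtup y u j)) *: phi (wtup y) u).
  rewrite pair_bigA /= (reindex (fun yu : tup * utup =>
     [ffun i => (yat yu.1 i, yu.2 i)] : {ffun 'I_k -> gates * X})) /=; last first.
    exists (fun f : {ffun 'I_k -> gates * X} =>
      ([ffun j => (f j.2).1 j.1] : tup, [ffun i => (f i).2] : utup)) => [[y u] _|f _] /=.
      congr (_, _); apply/ffunP; first by case=> c i; rewrite !ffunE.
      by move=> i; rewrite !ffunE.
    apply/ffunP => i; rewrite !ffunE [RHS]surjective_pairing; congr (_, _).
    by apply/ffunP => c; rewrite !ffunE.
  apply: eq_bigr => -[y u] _ /=; congr (_ *: _).
    transitivity (\prod_c \prod_i ent (wop R (wpart t c) *m val (cpart t c))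
        (y (c, i)) (vtup y u (c, i))); last by rewrite pair_bigA; apply: eq_bigr => -[c i].
    rewrite exchange_big /=; apply: eq_bigr => i _; rewrite ffunE /a /=; apply: eq_bigr => c _.
    by rewrite lrfcE !ffunE.
  by apply: eq_runf => i ik; rewrite !(otup_lt _ ik) !ffunE.
rewrite /psi; apply: eq_bigr => y _.
under [RHS]eq_bigr do rewrite /Aexp scaler_sumr.
rewrite exchange_big; apply: eq_bigr => u _ /=.
rewrite (bigD1 (vtup y u)) //= eqxx scale1r [X in _ = _ + X]big1 ?addr0 // => x.
by rewrite eq_sym => /negPf ->; rewrite scale0r scaler0.
Qed.

End Amplitudes.
End GluedGates.

(** * The invariant form and its value at the identity *)

Section InvariantForm.
Variable R : realType.
Local Notation C := (R[i]).
Variables (n xi g m k : nat).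
Hypothesis xi_gt0 : (0 < xi)%N.
Hypothesis xi_n : (xi %| n)%N.
Hypothesis npE : npatch n xi = g.+1.
Hypothesis g_gt0 : (0 < g)%N.
Local Notation X := (bits n).
Local Notation Y := (bits (xi + xi)).
Local Notation gates := {ffun 'I_g -> Y}.
Local Notation tup := {ffun 'I_g * 'I_k -> Y}.
Local Notation utup := {ffun 'I_k -> X}.
Local Notation dim := #|bits (n + m)|.

(** The shift applies the same [M] to every coordinate of [u], so it commutes with the permutation
    [d], and [tact_form] removes it from the sum over [u]. *)
Lemma Kfin_shiftW (W : 'I_k.+1 -> op R (bits (n + m))) M H : unitary M ->
  Kfin xi g (shiftW W M) H = Kfin xi g W H.
Proof.
move=> uM; congr (_ / _); apply: eq_bigr => y _; apply: eq_bigr => d _.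
set w := wtup n y.
have E := tact_form H (fun v => phi W (ucomp w d) (tcomp v d)) (phi W w) (M := fun=> M) (fun=> uM).
apply: etrans E; apply: eq_bigr => u _; rewrite !phi_shiftW.
have db : bijective d by exists (d^-1)%g => i; rewrite ?permK ?permKV.
have shift (f : utup -> 'cV[C]_dim) :
    tact (fun=> M) f (ucomp u d) = tact (fun=> M) (fun v => f (tcomp v d)) u.
  exact: (tact_tcomp (M := fun=> M) f u db (fun=> erefl)).
by rewrite shift.
Qed.

Lemma wtup_inj (y : tup) : ydist y -> injective (wtup n y).
Proof.
case/andP => yL _ i j; rewrite !ffunE => /(wfill_left xi_gt0 xi_n npE g_gt0).
by rewrite !yatE => E; apply: (ldistP yL (a := Ordinal g_gt0)).
Qed.

Section OneExperiment.
Variable W : 'I_k.+1 -> op R (bits (n + m)).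
Hypothesis uW : forall i, unitary (W i).

(** Under [ydist] the strings in [wtup y] are distinct, so by [sum_phi] only the trivial permutation
    contributes, with value 1. *)
Lemma Kfin1E : Kfin xi g W 1%:M = (\sum_(y : tup | ydist y) 1) / #|Y|%:R ^+ (g * k).
Proof.
congr (_ / _); apply: eq_bigr => y yD.
rewrite (eq_bigr (fun d : 'S_k => (d == 1%g)%:R)) => [|d _]; last first.
  by apply: sum_phi => //; exact: wtup_inj.
by rewrite (bigD1 1%g) //= eqxx big1 ?addr0 // => d /negPf ->.
Qed.

Lemma card_tup : #|{: tup}|%:R = #|Y|%:R ^+ (g * k) :> C.
Proof. by rewrite card_ffun card_prod !card_ord natrX. Qed.

Lemma Y_gt0 : 0 < #|Y|%:R :> C.
Proof. by rewrite card_bits_h exprn_gt0 // ltr0n. Qed.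

Lemma Kfin1_le1 : Kfin xi g W 1%:M <= 1.
Proof.
rewrite Kfin1E ler_pdivrMr ?exprn_gt0 ?Y_gt0 // mul1r -card_tup -[leRHS]sumr_const.
by rewrite [leRHS](bigID (@ydist _ _ _)) /= lerDl sumr_ge0.
Qed.

Lemma half_count (f : Y -> bits xi) (b : bits xi) :
  (f = @left_half xi \/ f = @right_half xi) ->
  \sum_(d : Y) (f d == b)%:R = 2 ^+ xi :> C.
Proof.
move=> fE; pose J2 (p : bits xi * bits xi) : Y := join p.1 p.2.
rewrite (reindex J2) /=; last first.
  exists (fun x => (left_half x, right_half x)) => [p _|x _] /=.
    by rewrite left_join right_join; case: p.
  exact: join_halves.
rewrite -(pair_bigA _ (fun u v => (f (J2 (u, v)) == b)%:R : C)) /=.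
case: fE => ->.
  rewrite (bigD1 b) //= [X in _ + X]big1 ?addr0 => [|u ub]; last first.
    by apply: big1 => v _; rewrite left_join (negPf ub).
  under eq_bigr do rewrite left_join eqxx.
  by rewrite sumr_const card_bits_h.
rewrite exchange_big (bigD1 b) //= [X in _ + X]big1 ?addr0 => [|u ub]; last first.
  by apply: big1 => v _; rewrite right_join (negPf ub).
under eq_bigr do rewrite right_join eqxx.
by rewrite sumr_const card_bits_h.
Qed.

Lemma coll_count (f : Y -> bits xi) (e : 'I_g * 'I_k * 'I_k) :
  (f = @left_half xi \/ f = @right_half xi) -> e.1.2 != e.2 ->
  \sum_(y : tup) (f (y (e.1.1, e.1.2)) == f (y (e.1.1, e.2)))%:R =
  #|{: tup}|%:R / 2 ^+ xi :> C.
Proof.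
move=> fE; case: e => -[a i] j /= ij.
have Y0 := lt0r_neq0 Y_gt0; apply: (mulfI Y0).
pose F (y : tup) : C := (f (y (a, i)) == f (y (a, j)))%:R.
have -> : #|Y|%:R * \sum_y F y = \sum_(y : tup) \sum_(d : Y) F [ffun b => if b == (a, i) then d else y b].
  by rewrite big_upd mulr_natl.
transitivity (\sum_(y : tup) (2 ^+ xi : C)).
  apply: eq_bigr => y _; rewrite /F -(half_count (f (y (a, j))) fE).
  apply: eq_bigr => d _; rewrite !ffunE eqxx xpair_eqE eqxx /= [j == i]eq_sym (negPf ij).
  by [].
rewrite sumr_const -[LHS]mulr_natl [#|Y|%:R]card_bits_h exprD; field.
by rewrite expf_neq0 // pnatr_eq0.
Qed.

Lemma Kfin1_ge : 1 - 2 / 2 ^+ xi * (g * k * k)%:R <= Kfin xi g W 1%:M.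
Proof.
rewrite Kfin1E -card_tup.
have T0 : 0 < #|{: tup}|%:R :> C by rewrite card_tup exprn_gt0 // Y_gt0.
rewrite ler_pdivlMr // mulrBl mul1r lerBlDr -{1}[#|{: tup}|%:R]sumr_const.
rewrite [leLHS](bigID (@ydist _ _ _)) /= lerD2l.
pose E := ('I_g * 'I_k * 'I_k)%type.
apply: (@le_trans _ _ (\sum_(y : tup) \sum_(e : E | e.1.2 != e.2)
    ((lcoll y e)%:R + (rcoll y e)%:R))).
  rewrite [leRHS](bigID (@ydist _ _ _)) /= -[leLHS]add0r; apply: lerD.
    by apply: sumr_ge0 => y _; apply: sumr_ge0 => e _; rewrite addr_ge0.
  apply: ler_sum => y; rewrite negb_and => /orP[]/forallPn[e];
    rewrite negb_imply negbK => /andP[ne ce];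
    rewrite (bigD1 e) //= ce -[leLHS]addr0 lerD ?lerDl ?lerDr ?ler0n //;
    by apply: sumr_ge0 => e' _; rewrite addr_ge0.
rewrite exchange_big /=.
apply: (@le_trans _ _ (\sum_(e : E | e.1.2 != e.2) (2 / 2 ^+ xi * #|{: tup}|%:R))).
  apply: ler_sum => e ne; rewrite big_split /=.
  rewrite (coll_count (or_introl erefl) ne) (coll_count (or_intror erefl) ne).
  by rewrite le_eqVlt; apply/orP; left; apply/eqP; ring.
set z := 2 / _ * _.
have z0 : 0 <= z by rewrite !mulr_ge0 ?invr_ge0 ?exprn_ge0 // ltW.
have -> : 2 / 2 ^+ xi * (g * k * k)%:R * #|{: tup}|%:R = z *+ (g * k * k).
  by rewrite -[RHS]mulr_natr /z; ring.
have <- : \sum_(e : E) z = z *+ (g * k * k).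
  by rewrite sumr_const !card_prod !card_ord.
by rewrite [leRHS](bigID (fun e : E => e.1.2 != e.2)) /= lerDl sumr_ge0.
Qed.

Lemma lrfc_unitary (t : lrfc_param R xi) : unitary (lrfc t).
Proof.
case: t => -[[hL hR] f] c; rewrite /lrfc.
have involL : injective (fun x : Y => join (bxor (left_half x) (hL (right_half x))) (right_half x)).
  apply: (can_inj (g := fun x : Y => join (bxor (left_half x) (hL (right_half x))) (right_half x))).
  move=> x; rewrite left_join right_join -[RHS]join_halves; congr join.
  by apply/ffunP => q; rewrite !ffunE -addbA addbb addbF.
have involR : injective (fun x : Y => join (left_half x) (bxor (right_half x) (hR (left_half x)))).
  apply: (can_inj (g := fun x : Y => join (left_half x) (bxor (right_half x) (hR (left_half x))))).
  move=> x; rewrite left_join right_join -[RHS]join_halves; congr join.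
  by apply/ffunP => q; rewrite !ffunE -addbA addbb addbF.
apply: unitaryM; last exact: clifford_unitary.
apply: unitaryM; last exact: phaseop_unitary.
by apply: unitaryM; exact: permop_unitary.
Qed.

Lemma blocked_unitary (t : blocked_param R n xi) : unitary (blocked_lrfc t).
Proof.
by apply: unitaryM; apply: (layer_unitary xi_gt0 xi_n npE g_gt0) => a; exact: lrfc_unitary.
Qed.

Lemma wid_inj : injective (@wid n xi g npE).
Proof. by move=> c c' /(congr1 val) /= cc'; apply: val_inj. Qed.

Definition ens_form (H : 'M[C]_dim) : C :=
  #|{: blocked_param R n xi}|%:R^-1 *
  \sum_(t : blocked_param R n xi) hform H (run W (blocked_lrfc t) k) (run W (blocked_lrfc t) k).

(** Each gate takes its entry from the family of its own layer. As [wid] is injective these entries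
    are jointly uniform, so [realform] averages over the law of the ensemble. *)
Lemma realform_ens H : realform (@Aexp R n xi g m k W) H = ens_form H.
Proof.
pose F0 w c := hform H (psi (@Aexp R n xi g m k W) w c) (psi (@Aexp R n xi g m k W) w c).
have F0E w w' c c' : w = w' -> c = c' -> F0 w c = F0 w' c' by move=> -> ->.
pose F (s : {ffun 'I_g -> wparam xi * clifford R (xi + xi)}) : C :=
  F0 [ffun c => (s c).1] [ffun c => (s c).2].
have FE (t : blocked_param R n xi) :
    hform H (run W (blocked_lrfc t) k) (run W (blocked_lrfc t) k) =
    F [ffun c : 'I_g => if inlay true c then t.1 (wid npE c) else t.2 (wid npE c)].
  rewrite (run_blocked xi_gt0 xi_n npE g_gt0).
  by apply: F0E; apply/ffunP => c; rewrite !ffunE.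
have A0 : (0 < #|{: wparam xi}|)%N.
  by apply/card_gt0P; exists ([ffun x => x], [ffun x => x], [ffun=> true]).
have B0 := clifford_card_gt0 R (xi + xi).
have law := avg_gate_params (fun c : 'I_g => inlay true c) F wid_inj A0 B0.
rewrite /ens_form; under [in RHS]eq_bigr do rewrite FE.
apply: etrans (esym law); congr (_ * _); apply: eq_bigr => w _; apply: eq_bigr => c _.
by apply: F0E; apply/ffunP => i; rewrite !ffunE.
Qed.

Lemma ens_form1 : ens_form 1%:M = 1.
Proof.
rewrite /ens_form (eq_bigr (fun=> 1)) => [|t _]; last first.
  by apply: run_norm => //; exact: blocked_unitary.
rewrite sumr_const mulVf // pnatr_eq0 -lt0n.
have B0 := clifford_card_gt0 R (xi + xi); have /card_gt0P[c _] := B0.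
pose t0 : lrfc_param R xi := ([ffun x => x], [ffun x => x], [ffun=> true], c).
by apply/card_gt0P; exists ([ffun=> t0], [ffun=> t0]).
Qed.

Lemma ens_form_Kfin (V : 'M[C]_dim) :
  (forall u, `|hform V u u| <= hform 1%:M u u) ->
  `|ens_form V - Kfin xi g W V| <= 6 / 2 ^+ xi * (g * k * k)%:R.
Proof.
move=> V1; have kE H := knorm_Aexp xi_gt0 xi_n npE g_gt0 W H.
rewrite -realform_ens -kE; apply: le_trans (realform_knorm _ V1) _.
rewrite realform_ens ens_form1 kE card_ord.
set b := (g * k * k)%:R.
have p0 : 0 <= 4 / 2 ^+ xi * b :> C by rewrite !mulr_ge0 ?invr_ge0 ?exprn_ge0 ?ler0n.
(* The 2 is the output-collision loss in [Kfin1_ge]; the 4 comes from [realform_knorm]. *)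
have -> : 6 / 2 ^+ xi * b = 2 / 2 ^+ xi * b + 4 / 2 ^+ xi * b :> C by ring.
apply: lerD; last by rewrite ler_piMr // Kfin1_le1.
by rewrite lerBlDr addrC -lerBlDr Kfin1_ge.
Qed.

End OneExperiment.
End InvariantForm.

(** * Trace norm and Haar integration *)

Section TraceNorm.
Variable R : realType.
Local Notation C := (R[i]).

Lemma char_poly_conj d (P B : 'M[C]_d) : P \in unitmx ->
  char_poly (invmx P *m B *m P) = char_poly B.
Proof.
move=> Pu; rewrite /char_poly.
have PP : map_mx (@polyC C) (invmx P) *m map_mx (@polyC C) P = 1%:M.
  by rewrite -map_mxM mulVmx // map_mx1.
have -> : char_poly_mx (invmx P *m B *m P) =
    map_mx (@polyC C) (invmx P) *m char_poly_mx B *m map_mx (@polyC C) P.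
  rewrite /char_poly_mx mulmxBr mulmxBl !map_mxM; congr (_ - _).
  by rewrite scalar_mxC -mulmxA PP mulmx1.
rewrite !det_mulmx mulrAC -det_mulmx PP det1 mul1r //.
Qed.

Lemma Re_sum I (r : seq I) (Q : pred I) (F : I -> C) :
  complex.Re (\sum_(i <- r | Q i) F i) = \sum_(i <- r | Q i) complex.Re (F i).
Proof. by apply: (big_morph (@complex.Re R)) => // -[a b] [c e]. Qed.

(** In an eigenbasis [A] becomes the real diagonal [D] and [V] its signs; the square roots of the
    eigenvalues of [adjm A *m A] are the absolute values of the entries of [D]. *)
Lemma trace_norm_hermitian d (A : 'M[C]_d) : adjm A = A ->
  exists V : 'M[C]_d, [/\ adjm V = V, V *m V = 1%:M & trace_norm A = complex.Re (\tr (V *m A))].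
Proof.
move=> Ah; have [P [D [Pu PV AE]]] : exists P D,
    [/\ P \in unitmx, invmx P = adjm P & A = invmx P *m diag_mx D *m P].
  exists (spectralmx A), (spectral_diag A); split; first exact: spectral_unit.
    by rewrite adjmE; apply/invmx_unitary/spectral_unitarymx.
  by apply/orthomx_spectralP/normalmxP; rewrite -adjmE Ah.
pose conjP (e : 'rV[C]_d) := adjm P *m diag_mx e *m P.
have conjPM e f : conjP e *m conjP f = conjP (\row_i (e 0 i * f 0 i)).
  rewrite /conjP -PV -!mulmxA; congr (_ *m _).
  rewrite mulKVmx // mulmxA; congr (_ *m _).
  by rewrite mulmx_diag; congr diag_mx; apply/rowP => i; rewrite !mxE.
have conjPadj e : adjm (conjP e) = conjP (\row_i (e 0 i)^*).
  rewrite /conjP !adjmM adjmK mulmxA; congr (_ *m _ *m _).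
  by apply/matrixP => i j; rewrite !mxE conjcE rmorphMn eq_sym; case: eqP => [->|].
have conjP_tr e : \tr (conjP e) = \sum_i e 0 i.
  by rewrite /conjP mxtrace_mulC mulmxA -PV mulmxV // mul1mx mxtrace_diag.
have AD : A = conjP D by rewrite /conjP -PV.
have Dreal i : (D 0 i)^* = D 0 i.
  have := conjPadj D; rewrite -AD Ah => E.
  have : diag_mx D = diag_mx (\row_i (D 0 i)^*).
    move: E; rewrite {1}AD /conjP -PV => /(can_inj (mulmxK Pu)).
    exact: (can_inj (mulKVmx Pu)).
  by move/matrixP/(_ i i); rewrite !mxE eqxx !mulr1n => <-.
(* The sign at 0 is taken to be 1, so that [V] squares to the identity. *)
pose s : 'rV[C]_d := \row_i (if 0 <= D 0 i then 1 else -1).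
exists (conjP s); split.
- rewrite conjPadj; congr conjP; apply/rowP => i; rewrite !mxE.
  by case: ifP => _; rewrite ?rmorphN rmorph1.
- rewrite conjPM (_ : \row_i _ = const_mx 1); last first.
    by apply/rowP => i; rewrite !mxE; case: ifP => _; rewrite ?mulrNN mulr1.
  by rewrite /conjP diag_const_mx mulmx1 -PV mulVmx.
rewrite {2}AD conjPM conjP_tr /trace_norm Ah {1 2}AD conjPM.
set e := \row_i (D 0 i * D 0 i).
have charE : char_poly (conjP e) = \prod_(z <- [seq e 0 i | i <- enum 'I_d]) ('X - z%:P).
  rewrite big_map big_enum /= /conjP -PV char_poly_conj // char_poly_trig ?diag_mx_is_trig //.
  by apply: eq_bigr => i _; rewrite !mxE eqxx mulr1n.
have perm_e : perm_eq (eigenvalues (conjP e)) [seq e 0 i | i <- enum 'I_d].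
  apply: prod_XsubC_eq; rewrite /eigenvalues; case: closed_field_poly_normal => r /= rE.
  by rewrite -charE [RHS]rE (monicP (char_poly_monic _)) scale1r.
rewrite (perm_big _ perm_e) /= big_map big_enum /= Re_sum; apply: eq_bigr => i _.
rewrite !mxE -{2}(Dreal i) -normC_def; congr complex.Re.
have Dr : D 0 i \is Num.real by apply/CrealP.
case: ifP => D0; first by rewrite mul1r ger0_norm.
rewrite mulN1r ler0_norm //.
by move: Dr; rewrite realE D0.
Qed.

End TraceNorm.

Local Open Scope classical_set_scope.
Local Open Scope ring_scope.

(** * Measurability and averages for a Haar measure *)

Section HaarMeasurability.
Variables (R : realType) (d : nat).
Local Notation C := (R[i]).
Local Notation T := (haarT R d).

Definition cmeas (g : T -> C) : Prop :=
  measurable_fun setT (fun M => complex.Re (g M)) /\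
  measurable_fun setT (fun M => complex.Im (g M)).

Lemma cmeas_entry (i j : 'I_d) : cmeas (fun M : T => (M : 'M[C]_d) i j).
Proof.
split=> _ B mB; rewrite setTI; apply: sub_sigma_algebra; exists i, j, B; split=> //.
- by left.
- by right.
Qed.

Lemma cmeas_cst (z : C) : cmeas (fun=> z).
Proof. by split; exact: measurable_cst. Qed.

Lemma cmeasD f g : cmeas f -> cmeas g -> cmeas (fun M => f M + g M).
Proof.
move=> [f1 f2] [g1 g2]; split.
  rewrite (_ : (fun M => _) = (fun M => complex.Re (f M) + complex.Re (g M))).
    exact: measurable_funD.
  by apply/funext => M; case: (f M) => a b; case: (g M).
rewrite (_ : (fun M => _) = (fun M => complex.Im (f M) + complex.Im (g M))).
  exact: measurable_funD.
by apply/funext => M; case: (f M) => a b; case: (g M).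
Qed.

Lemma cmeasM f g : cmeas f -> cmeas g -> cmeas (fun M => f M * g M).
Proof.
move=> [f1 f2] [g1 g2]; split.
  rewrite (_ : (fun M => _) = (fun M => complex.Re (f M) * complex.Re (g M) -
      complex.Im (f M) * complex.Im (g M))).
    by apply: measurable_funB; exact: measurable_funM.
  by apply/funext => M; case: (f M) => a b; case: (g M).
rewrite (_ : (fun M => _) = (fun M => complex.Re (f M) * complex.Im (g M) +
    complex.Im (f M) * complex.Re (g M))).
  by apply: measurable_funD; exact: measurable_funM.
by apply/funext => M; case: (f M) => a b; case: (g M).
Qed.

Lemma cmeas_conj f : cmeas f -> cmeas (fun M => (f M)^*).
Proof.
move=> [f1 f2]; split.
  rewrite (_ : (fun M => _) = (fun M => complex.Re (f M))) //.
  by apply/funext => M; case: (f M).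
rewrite (_ : (fun M => _) = (fun M => - complex.Im (f M))); first exact: measurable_funN.
by apply/funext => M; case: (f M).
Qed.

Lemma cmeas_sum I (r : seq I) (P : pred I) (F : I -> T -> C) :
  (forall i, cmeas (F i)) -> cmeas (fun M => \sum_(i <- r | P i) F i M).
Proof.
move=> mF; elim: r => [|i r IH].
  rewrite (_ : (fun M => _) = (fun=> 0)); first exact: cmeas_cst.
  by apply/funext => M; rewrite big_nil.
rewrite (_ : (fun M => _) =
    (fun M => (if P i then F i M else 0) + \sum_(j <- r | P j) F j M)).
  by apply: cmeasD => //; case: (P i) => //; exact: cmeas_cst.
by apply/funext => M; rewrite big_cons; case: (P i); rewrite ?add0r.
Qed.

Lemma cmeas_mulmx m n p (F : T -> 'M[C]_(m, n)) (G : T -> 'M[C]_(n, p)) :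
  (forall i j, cmeas (fun M => F M i j)) -> (forall i j, cmeas (fun M => G M i j)) ->
  forall i j, cmeas (fun M => (F M *m G M) i j).
Proof.
move=> mF mG i j.
rewrite (_ : (fun M => _) = (fun M => \sum_k F M i k * G M k j)).
  by apply: cmeas_sum => k; exact: cmeasM.
by apply/funext => M; rewrite mxE.
Qed.

Lemma measurable_lmul (B : 'M[C]_d) : measurable_fun setT (fun M : T => (B *m M : T)).
Proof.
apply: (@measurability _ _ T T setT _ (@entry_gen R d)) => // A [A0 [i [j [B0 [mB0 A0E]]]] <-].
have [m1 m2] := cmeas_mulmx (fun a b => cmeas_cst (B a b)) cmeas_entry i j.
by case: A0E => ->; [have := m1 measurableT B0 mB0 | have := m2 measurableT B0 mB0].
Qed.

End HaarMeasurability.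

Section HaarIntegral.
Variables (R : realType) (d : nat).
Local Notation C := (R[i]).
Local Notation T := (haarT R d).
Variable P : probability T R.
Hypothesis haarP : is_haar P.
Local Notation UU := [set M : T | unitary (M : 'M[C]_d)].

(** Polynomials in the entries are unbounded on the space of all matrices, so the bound is asked on
    unitaries; their complement is null, which gives integrability. *)
Definition hgood (g : T -> R) : Prop :=
  measurable_fun setT g /\ exists c, forall M : T, unitary (M : 'M[C]_d) -> `|g M| <= c.

Lemma mUU : measurable UU. Proof. by case: haarP. Qed.
Lemma PUU : P UU = 1%E. Proof. by case: haarP => _ []. Qed.

Lemma PUUC : P (~` UU) = 0%E.
Proof. by rewrite probability_setC ?PUU ?subee //; exact: mUU. Qed.

Lemma hgood_integrable g : hgood g -> P.-integrable setT (EFin \o g).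
Proof.
move=> [mg [c gc]].
apply/(negligible_integrable (measurableC mUU) measurableT _ PUUC).
  exact/measurable_EFinP.
rewrite setTD setCK; apply: measurable_bounded_integrable.
- exact: mUU.
- by apply: le_lt_trans (probability_le1 P mUU) _; exact: ltry.
- exact: measurable_funTS.
exists c; split; first exact: num_real.
by move=> x cx M UM; apply: le_trans (gc M UM) (ltW cx).
Qed.

Lemma hgood_cst r : hgood (fun=> r).
Proof. by split; [exact: measurable_cst | exists `|r|]. Qed.

Lemma hgoodD f g : hgood f -> hgood g -> hgood (fun M => f M + g M).
Proof.
move=> [mf [a fa]] [mg [b gb]]; split; first exact: measurable_funD.
by exists (a + b) => M uM; apply: le_trans (ler_normD _ _) (lerD (fa M uM) (gb M uM)).
Qed.

Lemma hgoodZ r g : hgood g -> hgood (fun M => r * g M).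
Proof.
move=> [mg [b gb]]; split; first by apply: measurable_funM => //; exact: measurable_cst.
by exists (`|r| * b) => M uM; rewrite normrM ler_wpM2l // gb.
Qed.

Lemma hgood_sum I (r : seq I) (F : I -> T -> R) :
  (forall i, hgood (F i)) -> hgood (fun M => \sum_(i <- r) F i M).
Proof.
move=> gF; elim: r => [|i r IH].
  rewrite (_ : (fun M => _) = (fun=> 0)); first exact: hgood_cst.
  by apply/funext => M; rewrite big_nil.
rewrite (_ : (fun M => _) = (fun M => F i M + \sum_(j <- r) F j M)).
  exact: hgoodD.
by apply/funext => M; rewrite big_cons.
Qed.

Local Notation E g := (Rintegral P setT g).

Lemma hE_cst r : E (fun=> r) = r.
Proof. by rewrite Rintegral_cst //= probability_setT mulr1. Qed.

Lemma hED f g : hgood f -> hgood g -> E (fun M => f M + g M) = E f + E g.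
Proof. by move=> gf gg; apply: RintegralD => //; exact: hgood_integrable. Qed.

Lemma hEZ r g : hgood g -> E (fun M => r * g M) = r * E g.
Proof. by move=> gg; apply: RintegralZl => //; exact: hgood_integrable. Qed.

Lemma hE_sum I (r : seq I) (F : I -> T -> R) :
  (forall i, hgood (F i)) -> E (fun M => \sum_(i <- r) F i M) = \sum_(i <- r) E (F i).
Proof.
move=> gF; elim: r => [|i r IH].
  rewrite big_nil (_ : (fun M => _) = (fun=> 0)); first exact: hE_cst.
  by apply/funext => M; rewrite big_nil.
rewrite big_cons -IH -hED //; last exact: hgood_sum.
by congr (Rintegral P setT _); apply/funext => M; rewrite big_cons.
Qed.

Lemma hE_le g c : hgood g -> (forall M : T, unitary (M : 'M[C]_d) -> g M <= c) -> E g <= c.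
Proof.
move=> gg gc; have ig := hgood_integrable gg.
have -> : E g = Rintegral P UU g.
  by congr fine; rewrite (negligible_integral (measurableC mUU) _ _ PUUC) // setTD setCK.
have -> : c = Rintegral P UU (fun=> c).
  transitivity (c * fine 1%E); first by rewrite /= mulr1.
  by rewrite (Rintegral_cst P mUU); congr (_ * fine _); exact: (esym PUU).
apply: le_Rintegral => //; first exact: mUU.
  by apply: integrableS ig => //; exact: mUU.
have := hgood_integrable (hgood_cst c); apply: integrableS => //; exact: mUU.
Qed.

Lemma hgood_lmul (B : 'M[C]_d) g : unitary B -> hgood g -> hgood (fun M => g (B *m M : T)).
Proof.
move=> uB [mg [c gc]]; split.
  exact: (measurableT_comp mg (measurable_lmul B)).
by exists c => M uM; apply: gc; exact: unitaryM.
Qed.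

Lemma hE_lmul (B : 'M[C]_d) g : unitary B -> hgood g -> E (fun M => g (B *m M : T)) = E g.
Proof.
move=> uB gg; congr fine.
have mphi := measurable_lmul B.
have mg : measurable_fun setT (EFin \o g) by apply/measurable_EFinP; case: gg.
have ig : P.-integrable ((fun M : T => (B *m M : T)) @^-1` setT)
    ((EFin \o g) \o (fun M : T => (B *m M : T))).
  by rewrite preimage_setT; exact: (hgood_integrable (hgood_lmul uB gg)).
have := integral_pushforward mphi mg ig measurableT; rewrite preimage_setT => <-.
apply: eq_measure_integral => A mA _.
by case: haarP => _ [_ inv]; exact: (inv B uB A mA).
Qed.

(** By left invariance each [g (B t *m U)] has the same mean as [g], hence so does their average
    over [t]; a bound on that average, valid for every unitary [U], then integrates. *)
Lemma haar_average (Th : finType) (B : Th -> 'M[C]_d) g (kap eps : R) :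
  (0 < #|Th|)%N -> (forall t, unitary (B t)) -> hgood g ->
  (forall U : T, unitary (U : 'M[C]_d) ->
     `|#|Th|%:R^-1 * \sum_t g (B t *m U : T) - kap| <= eps) ->
  `|E g - kap| <= eps.
Proof.
move=> Th0 uB gg bnd.
pose h (U : T) : R := #|Th|%:R^-1 * \sum_t g (B t *m U : T).
have gB t : hgood (fun U => g (B t *m U : T)) by apply: hgood_lmul.
have gh : hgood h by apply: hgoodZ; apply: hgood_sum.
have -> : E g = E h.
  rewrite hEZ ?hE_sum //; last exact: hgood_sum.
  under eq_bigr do rewrite hE_lmul //.
  by rewrite sumr_const -(mulr_natl (E g)) mulrA mulVf ?mul1r // pnatr_eq0 -lt0n.
have up U : unitary (U : 'M[C]_d) -> h U <= kap + eps.
  by move=> /bnd; rewrite ler_distl => /andP[].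
(* [hE_le] gives upper bounds, so the lower one is obtained through [- h]. *)
have lo U : unitary (U : 'M[C]_d) -> -1 * h U <= - (kap - eps).
  by move=> /bnd; rewrite ler_distl mulN1r lerN2 => /andP[].
rewrite ler_distl; apply/andP; split; last exact: hE_le.
by rewrite -lerN2 -mulN1r -hEZ //; apply: hE_le => //; exact: hgoodZ.
Qed.

End HaarIntegral.

Section OutputHaar.
Variable R : realType.
Local Notation C := (R[i]).
Variables n m k : nat.
Variable W : 'I_k.+1 -> op R (bits (n + m)).
Hypothesis uW : forall i, unitary (W i).
Local Notation T := (haarT R #|bits n|).
Local Notation dim := #|bits (n + m)|.

Lemma cmeas_ext i j : cmeas (fun U : T => ext m (U : op R (bits n)) i j).
Proof.
rewrite (_ : (fun U => _) = (fun U : T => (U : 'M[C]_#|bits n|)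
   (enum_rank (sys_part (enum_val i))) (enum_rank (sys_part (enum_val j))) *
   (anc_part (enum_val i) == anc_part (enum_val j))%:R)).
  by apply: cmeasM; [exact: cmeas_entry | exact: cmeas_cst].
by apply/funext => U; rewrite mxE.
Qed.

Lemma cmeas_run l i j : cmeas (fun U : T => run W (U : op R (bits n)) l i j).
Proof.
elim: l i j => [|l IH] i j /=; first exact: cmeas_cst.
apply: (cmeas_mulmx (F := fun=> W (inord l.+1))) => [a b|]; first exact: cmeas_cst.
by apply: cmeas_mulmx => // a b; exact: cmeas_ext.
Qed.

Lemma cmeas_output i j : cmeas (fun U : T => output W (U : op R (bits n)) i j).
Proof.
apply: cmeas_mulmx => a b; first exact: cmeas_run.
rewrite (_ : (fun U => _) = (fun U : T => (run W (U : op R (bits n)) k b a)^*)).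
  exact/cmeas_conj/cmeas_run.
by apply/funext => U; rewrite !mxE.
Qed.

Lemma Re_norm_le (z : C) (b : R) : `|z| <= b%:C%C -> `|complex.Re z| <= b.
Proof. by move=> zb; rewrite -lecR; apply: le_trans (normc_ge_Re z) zb. Qed.

Lemma Im_norm_le (z : C) (b : R) : `|z| <= b%:C%C -> `|complex.Im z| <= b.
Proof.
move=> zb; have := @Re_norm_le (z * 'i%C) b; rewrite ReiNIm normrN; apply.
have -> : `|z * 'i%C| = `|z| by rewrite normrM complexiE normCi mulr1.
exact: zb.
Qed.

(** An output entry is a product of two coordinates of a unit vector, up to conjugation. *)
Lemma output_norm_le U i j : unitary U -> `|output W U i j| <= 1.
Proof.
move=> uU; have := run_norm uW k uU; rewrite hform1E => nrm.
have le1 l : `|run W U k l 0| <= 1.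
  rewrite -(@expr_le1 _ 2) // normCK mulrC -nrm (bigD1 l) //= lerDl sumr_ge0 // => a _.
  by rewrite mulrC mul_conjC_ge0.
rewrite /output mxE big_ord1 !mxE normrM norm_conjC mulr_ile1 //.
Qed.

Lemma hgood_output_Re i j : hgood (fun U : T => complex.Re (output W (U : op R (bits n)) i j)).
Proof.
split; first by case: (cmeas_output i j).
by exists 1 => U uU; apply: Re_norm_le; exact: output_norm_le.
Qed.

Lemma hgood_output_Im i j : hgood (fun U : T => complex.Im (output W (U : op R (bits n)) i j)).
Proof.
split; first by case: (cmeas_output i j).
by exists 1 => U uU; apply: Im_norm_le; exact: output_norm_le.
Qed.

Lemma trace_output (V : 'M[C]_dim) U :
  \tr (V *m output W U) = hform V (run W U k) (run W U k).
Proof. by rewrite /output mulmxA mxtrace_mulC mulmxA trace_mx11. Qed.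

Lemma output_adj U : adjm (output W U) = output W U.
Proof. by rewrite /output adjmM adjmK. Qed.

Variable P : probability T R.
Hypothesis haarP : is_haar P.

Definition ev (V : 'M[C]_dim) (U : T) : R :=
  complex.Re (hform V (run W (U : op R (bits n)) k) (run W (U : op R (bits n)) k)).

(** Exhibits the value as a fixed real-linear combination of parts of the output entries, so that it
    commutes with the entrywise average [haar_avg]. *)
Lemma evE V U : ev V U = \sum_i \sum_j
  (complex.Re (V i j) * complex.Re (output W (U : op R (bits n)) j i) +
   (- complex.Im (V i j)) * complex.Im (output W (U : op R (bits n)) j i)).
Proof.
rewrite /ev -trace_output /mxtrace Re_sum; apply: eq_bigr => i _; rewrite mxE Re_sum.
apply: eq_bigr => j _; case: (V i j) => a b; case: (output W _ j i) => a' b' /=.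
by rewrite mulNr.
Qed.

Lemma hgood_term V i j : hgood (fun U : T =>
  complex.Re (V i j : C) * complex.Re (output W (U : op R (bits n)) j i) +
   (- complex.Im (V i j)) * complex.Im (output W (U : op R (bits n)) j i)).
Proof.
by apply: hgoodD; apply: hgoodZ; [exact: hgood_output_Re | exact: hgood_output_Im].
Qed.

Lemma hgood_ev V : hgood (ev V).
Proof.
rewrite (_ : ev V = (fun U : T => \sum_i \sum_j
  (complex.Re (V i j) * complex.Re (output W (U : op R (bits n)) j i) +
   (- complex.Im (V i j)) * complex.Im (output W (U : op R (bits n)) j i)))).
  by apply: hgood_sum => i; apply: hgood_sum => j; exact: hgood_term.
by apply/funext => U; exact: evE.
Qed.

Lemma trace_haar_avg V :
  complex.Re (\tr (V *m haar_avg P (output W))) = Rintegral P setT (ev V).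
Proof.
rewrite (_ : ev V = (fun U : T => \sum_i \sum_j
  (complex.Re (V i j) * complex.Re (output W (U : op R (bits n)) j i) +
   (- complex.Im (V i j)) * complex.Im (output W (U : op R (bits n)) j i)))); last first.
  by apply/funext => U; exact: evE.
rewrite hE_sum //; last by move=> i; apply: hgood_sum => j; exact: hgood_term.
rewrite /mxtrace Re_sum; apply: eq_bigr => i _; rewrite mxE Re_sum hE_sum //; last first.
  by move=> j; exact: hgood_term.
apply: eq_bigr => j _; rewrite mxE /cexpect hED // ?hEZ //;
  try (apply: hgoodZ); try exact: hgood_output_Re; try exact: hgood_output_Im.
by case: (V i j) => a b /=; rewrite mulNr.
Qed.

Lemma haar_avg_adj : adjm (haar_avg P (output W)) = haar_avg P (output W).
Proof.
apply/matrixP => i j; rewrite !mxE /cexpect conjcE.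
have oE U : output W U j i = (output W U i j)^*.
  by rewrite -{1}(output_adj U) !mxE.
have -> : (fun M : T => complex.Re (output W M j i)) = (fun M : T => complex.Re (output W M i j)).
  by apply/funext => U; rewrite oE; case: (output W U i j).
have -> : (fun M : T => complex.Im (output W M j i)) = (fun M : T => -1 * complex.Im (output W M i j)).
  by apply/funext => U; rewrite oE mulN1r; case: (output W U i j).
rewrite hEZ //; last exact: hgood_output_Im.
by apply/eqP; rewrite eq_complex /= !eqxx mulN1r opprK eqxx.
Qed.

End OutputHaar.

(** * Comparison of the ensemble with the Haar average *)

Section Design.
Variable R : realType.
Local Notation C := (R[i]).
Variables (n xi g m k : nat).
Hypothesis xi_gt0 : (0 < xi)%N.
Hypothesis xi_n : (xi %| n)%N.
Hypothesis npE : npatch n xi = g.+1.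
Hypothesis g_gt0 : (0 < g)%N.
Local Notation Th := (blocked_param R n xi).
Local Notation dim := #|bits (n + m)|.

Definition design_err : R := 6 / 2 ^+ xi * (g * k * k)%:R.

Lemma design_errE : (design_err%:C)%C = 6 / 2 ^+ xi * (g * k * k)%:R :> C.
Proof. by rewrite /design_err !rmorphM fmorphV rmorphXn !rmorph_nat. Qed.

Lemma ens_ev (W : 'I_k.+1 -> op R (bits (n + m))) (V : 'M[C]_dim) :
  complex.Re (ens_form xi W V) =
  #|{: Th}|%:R^-1 * \sum_(t : Th) ev W V (blocked_lrfc t).
Proof.
rewrite /ens_form /ev -Re_sum.
have -> : (#|{: Th}|%:R^-1 : C) = ((#|{: Th}|%:R^-1 : R)%:C)%C by rewrite fmorphV rmorph_nat.
by case: (\sum_t _) => a b /=; rewrite mul0r subr0.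
Qed.

Lemma adjmB d e (A B : 'M[C]_(d, e)) : adjm (A - B) = adjm A - adjm B.
Proof. by apply/matrixP => i j; rewrite !mxE !conjcE rmorphB. Qed.

Lemma ens_avg_adj (D : nat) (S : finType) (F : S -> 'M[C]_D) :
  (forall t, adjm (F t) = F t) -> adjm (ens_avg F) = ens_avg F.
Proof.
move=> Fh; rewrite /ens_avg adjmZ fmorphV rmorph_nat; congr (_ *: _).
rewrite -[in RHS](eq_bigr _ (fun t _ => Fh t)).
by apply: (big_morph (@adjm R D D)) => [A B|]; [exact: adjmD | apply/matrixP => i j; rewrite !mxE conjcE rmorph0].
Qed.

Lemma blocked_error (W : 'I_k.+1 -> op R (bits (n + m)))
    (P : probability (haarT R #|bits n|) R) :
  is_haar P -> (forall i, unitary (W i)) ->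
  trace_norm (ens_avg (fun t : Th => output W (blocked_lrfc t)) - haar_avg P (output W))
    <= 2 * design_err.
Proof.
move=> haarP uW; set D := _ - _.
have Dh : adjm D = D.
  by rewrite /D adjmB ens_avg_adj ?haar_avg_adj // => t; exact: output_adj.
have [V [Vh VV ->]] := trace_norm_hermitian Dh.
have V1 u : `|hform V u u| <= hform 1%:M u u by exact: hform_reflection_le.
pose kap := complex.Re (Kfin xi g W V).
have fin (W' : 'I_k.+1 -> op R (bits (n + m))) : (forall i, unitary (W' i)) -> Kfin xi g W' V = Kfin xi g W V ->
    `|complex.Re (ens_form xi W' V) - kap| <= design_err.
  move=> uW' KE.
  have /Re_norm_le : `|ens_form xi W' V - Kfin xi g W V| <= (design_err%:C)%C.
    by rewrite design_errE -KE; exact: (ens_form_Kfin xi_gt0 xi_n npE g_gt0 uW' V1).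
  by rewrite /kap; case: (ens_form _ _ _) => a b; case: (Kfin _ _ _ _).
have e1 := fin W uW erefl.
have e2 : `|Rintegral P setT (ev W V) - kap| <= design_err.
  apply: (haar_average haarP (B := fun t : Th => blocked_lrfc t)).
  - have /card_gt0P[c _] := clifford_card_gt0 R (xi + xi).
    pose t0 : lrfc_param R xi := ([ffun x => x], [ffun x => x], [ffun=> true], c).
    by apply/card_gt0P; exists ([ffun=> t0], [ffun=> t0]).
  - by move=> t; exact: (blocked_unitary xi_gt0 xi_n npE g_gt0).
  - exact: hgood_ev.
  (* For each fixed unitary [U], averaging [blocked_lrfc t *m U] over [t] in [W] is the ensemble
     average in [shiftW W U], whose reference value is the same [kap]. *)
  move=> U uU; have := fin (shiftW W U) (shiftW_unitary uU uW) (Kfin_shiftW _ _ _ _ uU).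
  rewrite ens_ev; set s := \sum_t _; set s' := \sum_t _.
  suff -> : s' = s by [].
  by apply: eq_bigr => t _; rewrite /ev run_shiftW.
have -> : \tr (V *m D) = \tr (V *m ens_avg (fun t : Th => output W (blocked_lrfc t))) -
    \tr (V *m haar_avg P (output W)).
  by rewrite /D mulmxBr linearB.
have -> : \tr (V *m ens_avg (fun t : Th => output W (blocked_lrfc t))) = ens_form xi W V.
  rewrite /ens_avg -scalemxAr mxtraceZ mulmx_sumr raddf_sum; congr (_ * _).
  by apply: eq_bigr => t _; exact: trace_output.
have -> : complex.Re (ens_form xi W V - \tr (V *m haar_avg P (output W))) =
    complex.Re (ens_form xi W V) - Rintegral P setT (ev W V).
  rewrite -trace_haar_avg //.
  by case: (ens_form _ _ _) => a b; case: (\tr _).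
move: e1 e2; rewrite !ler_distl => /andP[_ h1] /andP[h2 _]; lra.
Qed.

End Design.

Theorem mainTheorem9 :
  exists c : nat,
  forall (R : realType) (n xi k : nat),
    (0 < xi)%N -> (xi %| n)%N -> (2 * xi <= n)%N ->
    @measurable_error R n k (blocked_param R n xi) (@blocked_lrfc R n xi)
      (c%:R * n%:R * (k%:R) ^+ 2 / 2%:R ^+ xi : R).
Proof.
(* The constant is [2 * 6], with 6 from [design_err]; the number [g] of gates is at most [n]. *)
exists 12 => R n xi k xi_gt0 xi_n xi2 P haarP m W uW.
have p2 : (1 < npatch n xi)%N by rewrite /npatch leq_divRL.
have [g npE] : exists g, npatch n xi = g.+1 by exists (npatch n xi).-1; rewrite prednK // ltnW.
have g_gt0 : (0 < g)%N by rewrite -ltnS -npE.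
apply: le_trans (blocked_error xi_gt0 xi_n npE g_gt0 haarP uW) _.
rewrite /design_err !natrM.
have gn : g%:R <= n%:R :> R.
  rewrite ler_nat; apply: leq_trans (leqnSn g) _; rewrite -npE; exact: leq_div.
have -> : 2 * (6 / 2 ^+ xi * (g%:R * k%:R * k%:R)) = 12 * g%:R * k%:R ^+ 2 / 2 ^+ xi :> R by ring.
rewrite ler_wpM2r ?invr_ge0 ?exprn_ge0 // ler_wpM2r ?exprn_ge0 //.
by rewrite ler_wpM2l.
Qed.
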